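(* Let $U$ be an infinite-dimensional vector space over a field $\mathbb{F}$ with $\operatorname{char}\mathbb{F}\ne2$, $\Pi\subset U^*$ a total subspace, and $\mathcal{A}$ an algebra with $\mathfrak{F}_\Pi(U)\subset\mathcal{A}\subset\operatorname{End}(U)$ having an involution $\varphi$. Let $\mathcal{L}$ be a noncentral Lie ideal of $\mathcal{K}(\mathcal{A},\varphi)$. Let $\mathcal{H}$ be a unital commutative associative algebra, $\mathcal{U}$ an associative algebra with involution $*$, $\mathcal{M}$ a Lie ideal of $\mathcal{K}(\mathcal{U},* )$, and $\rho:\mathcal{M}\to\mathcal{L}\otimes\mathcal{H}$ a surjective Lie homomorphism. Then there exist a homomorphism $\sigma:\langle\mathcal{M}\rangle\to\mathcal{A}^\sharp\otimes\mathcal{H}$ and a linear map $\tau:\mathcal{M}\to1\otimes\mathcal{H}$ such that $\tau([\mathcal{M},\mathcal{M}])=0$ and $\rho(x)=\sigma(x)+\tau(x)$ for all $x\in\mathcal{M}$.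
   Context: $\Pi$ total: for each $u\ne0$ some $f\in\Pi$ has $f(u)\ne0$; $\mathfrak{F}_\Pi(U)$ is spanned by $u\mapsto f(u)v$, $v\in U$, $f\in\Pi$. An involution is an $\mathbb{F}$-linear antiautomorphism of order 2. $\mathcal{K}(\mathcal{A},\varphi)=\{a\in\mathcal{A}:\varphi(a)=-a\}$, a Lie algebra under $[a,b]=ab-ba$; a Lie ideal $\mathcal{L}$ of it is noncentral if not contained in the center of $\mathcal{A}$. $\mathcal{A}^\sharp=\mathcal{A}+\mathbb{F}1\subset\operatorname{End}(U)$; $\langle X\rangle$ is the associative subalgebra generated by $X$; $\mathcal{L}\otimes\mathcal{H}\subset\mathcal{A}^\sharp\otimes\mathcal{H}$. *)

(* Defs.v *)
From mathcomp Require Import all_boot all_order all_algebra.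
Set Implicit Arguments. Unset Strict Implicit. Unset Printing Implicit Defensive.
Import GRing.Theory.
Local Open Scope ring_scope.

Section Defs.
Variable F : fieldType.

Definition lin_map (X Y : lmodType F) (f : X -> Y) :=
  forall (c : F) (x y : X), f (c *: x + y) = c *: f x + f y.

Definition lin_fun (X : lmodType F) (f : X -> F) :=
  forall (c : F) (x y : X), f (c *: x + y) = c * f x + f y.

Definition is_subspace (X : lmodType F) (S : X -> Prop) :=
  S 0 /\ forall (c : F) (x y : X), S x -> S y -> S (c *: x + y).

Definition infinite_dim (U : lmodType F) :=
  forall s : seq U, exists u : U,
    ~ exists c : 'I_(size s) -> F, u = \sum_(i < size s) c i *: s`_i.

Definition dual_subspace (U : lmodType F) (Pi : (U -> F) -> Prop) :=
  (forall f, Pi f -> lin_fun f) /\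
  Pi (fun _ => 0) /\
  (forall (c : F) f g, Pi f -> Pi g -> Pi (fun u => c * f u + g u)).

Definition is_total (U : lmodType F) (Pi : (U -> F) -> Prop) :=
  forall u : U, u != 0 -> exists f, Pi f /\ f u != 0.

Definition fzero (U : lmodType F) : U -> U := fun _ => 0.
Definition fadd (U : lmodType F) (f g : U -> U) : U -> U := fun u => f u + g u.
Definition fscale (U : lmodType F) (c : F) (f : U -> U) : U -> U :=
  fun u => c *: f u.
Definition fopp (U : lmodType F) (f : U -> U) : U -> U := fun u => - f u.
Definition fcomm (U : lmodType F) (f g : U -> U) : U -> U :=
  fun u => f (g u) - g (f u).

Definition end_algebra (U : lmodType F) (A : (U -> U) -> Prop) :=
  (forall f, A f -> lin_map f) /\
  A (@fzero U) /\
  (forall (c : F) f g, A f -> A g -> A (fadd (fscale c f) g)) /\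
  (forall f g, A f -> A g -> A (f \o g)).

Definition FPi (U : lmodType F) (Pi : (U -> F) -> Prop) (a : U -> U) :=
  exists s : seq ((U -> F) * U),
    (forall i, (i < size s)%N -> Pi (nth (fun _ => 0, 0) s i).1) /\
    a = (fun u => \sum_(p <- s) p.1 u *: p.2).

Definition end_involution (U : lmodType F) (A : (U -> U) -> Prop)
    (phi : (U -> U) -> (U -> U)) :=
  (forall f, A f -> A (phi f)) /\
  (forall (c : F) f g, A f -> A g ->
       phi (fadd (fscale c f) g) = fadd (fscale c (phi f)) (phi g)) /\
  (forall f g, A f -> A g -> phi (f \o g) = phi g \o phi f) /\
  (forall f, A f -> phi (phi f) = f).

Definition Kend (U : lmodType F) (A : (U -> U) -> Prop)
    (phi : (U -> U) -> (U -> U)) (f : U -> U) :=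
  A f /\ phi f = fopp f.

Definition end_lie_ideal_K (U : lmodType F) (A : (U -> U) -> Prop)
    (phi : (U -> U) -> (U -> U)) (L : (U -> U) -> Prop) :=
  L (@fzero U) /\
  (forall (c : F) f g, L f -> L g -> L (fadd (fscale c f) g)) /\
  (forall f, L f -> Kend A phi f) /\
  (forall k l, Kend A phi k -> L l -> L (fcomm k l)).

Definition noncentral (U : lmodType F) (A : (U -> U) -> Prop)
    (L : (U -> U) -> Prop) :=
  exists l a, L l /\ A a /\ l \o a <> a \o l.

Definition unitize (U : lmodType F) (A : (U -> U) -> Prop) (f : U -> U) :=
  exists a (c : F), A a /\ f = (fun u => a u + c *: u).

Definition assoc_algebra (X : lmodType F) (mul : X -> X -> X) :=
  (forall x y z, mul x (mul y z) = mul (mul x y) z) /\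
  (forall (c : F) x y z, mul (c *: x + y) z = c *: mul x z + mul y z) /\
  (forall (c : F) x y z, mul z (c *: x + y) = c *: mul z x + mul z y).

Definition unital_comm_algebra (X : lmodType F) (mul : X -> X -> X) (one : X) :=
  assoc_algebra mul /\
  (forall x y, mul x y = mul y x) /\
  (forall x, mul one x = x).

Definition is_involution (X : lmodType F) (mul : X -> X -> X) (star : X -> X) :=
  lin_map star /\
  (forall x y, star (mul x y) = mul (star y) (star x)) /\
  (forall x, star (star x) = x).

Definition Kalg (X : lmodType F) (star : X -> X) (x : X) := star x = - x.

Definition lie_ideal_K (X : lmodType F) (mul : X -> X -> X) (star : X -> X)
    (M : X -> Prop) :=
  is_subspace M /\
  (forall x, M x -> Kalg star x) /\
  (forall k m, Kalg star k -> M m -> M (mul k m - mul m k)).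

Definition gen_subalg (X : lmodType F) (mul : X -> X -> X) (M : X -> Prop)
    (x : X) :=
  forall S : X -> Prop,
    is_subspace S -> (forall y z, S y -> S z -> S (mul y z)) ->
    (forall y, M y -> S y) -> S x.

(* A tensor is represented by a finite formal sum  sum_i a_i (x) h_i.  Two
   representatives denote the same tensor iff they agree under every map
   a (x) h |-> g(h) a, g in H^*  (this identifies End(U) (x) H with its
   (injective) image in Hom(H^*, End(U)), valid over a field). *)
Definition Tens (U H : lmodType F) := seq ((U -> U) * H).

Definition teq (U H : lmodType F) (t s : Tens U H) :=
  forall g : H -> F, lin_fun g -> forall u : U,
    \sum_(p <- t) g p.2 *: p.1 u = \sum_(p <- s) g p.2 *: p.1 u.

Definition tadd (U H : lmodType F) (t s : Tens U H) : Tens U H := t ++ s.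
Definition tscale (U H : lmodType F) (c : F) (t : Tens U H) : Tens U H :=
  [seq (fscale c p.1, p.2) | p <- t].
Definition tmul (U H : lmodType F) (mulH : H -> H -> H) (t s : Tens U H)
  : Tens U H :=
  [seq (p.1 \o q.1, mulH p.2 q.2) | p <- t, q <- s].
Definition tbracket (U H : lmodType F) (mulH : H -> H -> H) (t s : Tens U H)
  : Tens U H :=
  tadd (tmul mulH t s) (tscale (-1) (tmul mulH s t)).
Definition tone (U H : lmodType F) (h : H) : Tens U H := [:: (id, h)].

Definition firsts_in (U H : lmodType F) (S : (U -> U) -> Prop) (t : Tens U H) :=
  forall i, (i < size t)%N -> S (nth (@fzero U, 0) t i).1.

Definition in_tensor (U H : lmodType F) (S : (U -> U) -> Prop) (t : Tens U H) :=
  exists s : Tens U H, teq t s /\ firsts_in S s.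

End Defs.

(* Main.v *)
(* The involution [phi] is the adjoint for a nondegenerate form [B] with
   B(y, x) = eps B(x, y), and [L] contains all X_ab = a b^* - eps b a^*.  For [x]
   skew in [V] whose bracket with [M] is given by a finite-rank element of
   A (x) H, call that element vl(x).  The triple product xyz + zyx of three such
   elements is again of this kind, because the identity
     [xyz + zyx, w] + [yzw + wzy, x] + [zwx + xwz, y] + [wxy + yxw, z] = 0
   makes its bracket with [M] a local derivation, and those are inner.  The defect
   D = vl(xyz + zyx) - (vl x vl y vl z + vl z vl y vl x) is symmetric and local,
   and the same identity moves its entries along chains X_{v0 b1}, X_{v1 b2}, ...
   of far rank-two elements, where two degree-five identities kill it.  Hence vl
   extends to a homomorphism of the associative algebra [R] generated by these
   elements.  For [x] in [M], R^3 x is contained in [R] with the expected image,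
   so every relation between products of elements of [M] can be tested by
   multiplying with R^N: sending a product of elements of [M] to the product of
   their images is well defined, and tau = 0 works. *)
From HB Require Import structures.
From mathcomp Require Import all_boot all_order all_algebra.
From mathcomp Require Import boolp classical_sets functions.
From mathcomp Require Import ring zify.
Require Import Defs.
Set Implicit Arguments. Unset Strict Implicit. Unset Printing Implicit Defensive.
Import GRing.Theory.
Local Open Scope ring_scope.

(** No scalar ambiguity arises because a skew tensor commuting with all rank-two skew elements is
    zero: the matrix of a scalar is a multiple of [B], whose symmetry is opposite to that of skew
    matrices. So the tensor through which an element acts on the image is unique as soon as it
    exists, and most questions of well-definedness become questions of existence. The main obstacle
    is a kernel: elements acting as zero on the image of [M] need not lie in [M], and nothing is
    known about their products. Infinite dimension enters through dual pairs of vectors orthogonal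
    to any given finite set. Along chains of such pairs an entry of the defect becomes a constant
    [e0] independent of the chain, and the degree-five identities become linear relations such as
    [e0 = e0 + e0]. *)

(** * Identities in nonunital associative algebras, decided by signed words *)

Inductive nexp := NV of nat | NA of nexp & nexp | NO of nexp | NM of nexp & nexp.

Fixpoint nnorm (e : nexp) : seq (bool * seq nat) :=
  match e with
  | NV i => [:: (false, [:: i])]
  | NA a b => nnorm a ++ nnorm b
  | NO a => [seq (~~ p.1, p.2) | p <- nnorm a]
  | NM a b => [seq (p.1 (+) q.1, p.2 ++ q.2) | p <- nnorm a, q <- nnorm b]
  end.

(** After expansion every word carries a sign and no other coefficient, so pairing each word with an
    opposite copy is enough. The number [n] only bounds the recursion; each step deletes two words,
    so the length of the list suffices. *)
Fixpoint ncancel (n : nat) (l : seq (bool * seq nat)) : bool :=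
  match n, l with
  | _, [::] => true
  | n.+1, p :: t => ((~~ p.1, p.2) \in t) && ncancel n (rem (~~ p.1, p.2) t)
  | _, _ => false
  end.

Section NoncommutativeReflection.
Variables (F : fieldType) (X : lmodType F) (mul : X -> X -> X).
Hypothesis alg : assoc_algebra mul.
Variable env : seq X.

Lemma algA x y z : mul x (mul y z) = mul (mul x y) z. Proof. by case: alg. Qed.
Lemma algDl x y z : mul (x + y) z = mul x z + mul y z.
Proof. by have [_ [/(_ 1 x y z)]] := alg; rewrite !scale1r. Qed.
Lemma algDr x y z : mul z (x + y) = mul z x + mul z y.
Proof. by have [_ [_ /(_ 1 x y z)]] := alg; rewrite !scale1r. Qed.
Lemma alg0l z : mul 0 z = 0.
Proof. by apply: (addrI (mul 0 z)); rewrite -algDl !addr0. Qed.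
Lemma alg0r z : mul z 0 = 0.
Proof. by apply: (addrI (mul z 0)); rewrite -algDr !addr0. Qed.
Lemma algZl c x z : mul (c *: x) z = c *: mul x z.
Proof. by have [_ [/(_ c x 0 z)]] := alg; rewrite alg0l !addr0. Qed.
Lemma algZr c x z : mul z (c *: x) = c *: mul z x.
Proof. by have [_ [_ /(_ c x 0 z)]] := alg; rewrite alg0r !addr0. Qed.
Lemma algNl x z : mul (- x) z = - mul x z.
Proof. by rewrite -scaleN1r algZl scaleN1r. Qed.
Lemma algNr x z : mul z (- x) = - mul z x.
Proof. by rewrite -scaleN1r algZr scaleN1r. Qed.
Lemma alg_suml I (s : seq I) (f : I -> X) z :
  mul (\sum_(i <- s) f i) z = \sum_(i <- s) mul (f i) z.
Proof.
by elim: s => [|i s IH]; rewrite ?big_nil ?alg0l // !big_cons algDl IH.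
Qed.
Lemma alg_sumr I (s : seq I) (f : I -> X) z :
  mul z (\sum_(i <- s) f i) = \sum_(i <- s) mul z (f i).
Proof.
by elim: s => [|i s IH]; rewrite ?big_nil ?alg0r // !big_cons algDr IH.
Qed.

Fixpoint neval (e : nexp) : X :=
  match e with
  | NV i => nth 0 env i
  | NA a b => neval a + neval b
  | NO a => - neval a
  | NM a b => mul (neval a) (neval b)
  end.

(** Without a unit the empty word has only a dummy value; [nnorm_neq0] keeps it out of normal
    forms. *)
Fixpoint weval (w : seq nat) : X :=
  match w with
  | [::] => 0
  | [:: i] => nth 0 env i
  | i :: w' => mul (nth 0 env i) (weval w')
  end.

Definition sweval (p : bool * seq nat) : X :=
  if p.1 then - weval p.2 else weval p.2.

Lemma weval_cat w1 w2 : w1 != [::] -> w2 != [::] ->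
  weval (w1 ++ w2) = mul (weval w1) (weval w2).
Proof.
move=> + w20; elim: w1 => // i [|j w1] IH _; first by case: (w2) w20.
by rewrite [weval (i :: j :: w1)]/= -/(weval (j :: w1)) -algA -IH.
Qed.

Lemma nnorm_neq0 e : all (fun p => p.2 != [::]) (nnorm e).
Proof.
elim: e => //= [a Ha b Hb|a Ha|a Ha b Hb]; first by rewrite all_cat Ha.
  by rewrite all_map.
apply/allP => _ /allpairsP [[p q] /= [pa qb ->]] /=.
by move/allP: Ha => /(_ _ pa); case: (p.2).
Qed.

Lemma nnormE e : neval e = \sum_(p <- nnorm e) sweval p.
Proof.
elim: e => /= [i|a -> b ->|a ->|a IHa b IHb].
- by rewrite big_seq1.
- by rewrite big_cat.
- by rewrite big_map -sumrN; apply: eq_bigr => -[[] w] _; rewrite /sweval /= ?opprK.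
rewrite IHa IHb big_allpairs_dep alg_suml big_seq [RHS]big_seq.
apply: eq_bigr => p pa; rewrite alg_sumr big_seq [RHS]big_seq.
apply: eq_bigr => q qb.
have p0 := allP (nnorm_neq0 a) _ pa; have q0 := allP (nnorm_neq0 b) _ qb.
rewrite /sweval /= weval_cat //.
by case: (p.1) (q.1) => -[]; rewrite ?algNl ?algNr ?opprK.
Qed.

Lemma ncancelP n l : ncancel n l -> \sum_(p <- l) sweval p = 0.
Proof.
elim: n l => [|n IH] [|p l] //=; rewrite ?big_nil // => /andP[].
move=> /perm_to_rem pl /IH IHl.
rewrite big_cons (perm_big _ pl) /= big_cons IHl [X in _ + X]addr0 /sweval /=.
by case: (p.1) => /=; rewrite ?subrr // addNr.
Qed.

Lemma nca_correct e1 e2 :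
  (let l := nnorm (NA e1 (NO e2)) in ncancel (size l) l) -> neval e1 = neval e2.
Proof.
move=> /ncancelP; rewrite -nnormE /= => /eqP.
by rewrite subr_eq0 => /eqP.
Qed.

End NoncommutativeReflection.

(* Atoms are compared up to unification: the same scalar multiplication may be
   reached through different instance paths. *)
Ltac nca_find x l :=
  match l with
  | x :: _ => constr:(0%N)
  | ?y :: _ => let _ := match goal with _ => unify x y end in constr:(0%N)
  | _ :: ?t => let n := nca_find x t in constr:(n.+1)
  end.
Ltac nca_atoms mul t l :=
  match t with
  | mul ?a ?b => let l := nca_atoms mul a l in nca_atoms mul b l
  | ?a + ?b => let l := nca_atoms mul a l in nca_atoms mul b l
  | - ?a => nca_atoms mul a l
  | _ => match l with
         | context [t :: _] => l
         | _ => let _ := nca_find t l in l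
         | _ => constr:(t :: l)
         end
  end.
Ltac nca_reify mul l t :=
  match t with
  | mul ?a ?b => let a := nca_reify mul l a in let b := nca_reify mul l b in
                 constr:(NM a b)
  | ?a + ?b => let a := nca_reify mul l a in let b := nca_reify mul l b in
                 constr:(NA a b)
  | - ?a => let a := nca_reify mul l a in constr:(NO a)
  | _ => let n := nca_find t l in constr:(NV n)
  end.
Ltac nca alg :=
  match type of alg with
  | @assoc_algebra ?F ?X ?mul =>
    match goal with
    | |- ?a = ?b =>
      let l := nca_atoms mul a (@nil X) in
      let l := nca_atoms mul b l in
      let ea := nca_reify mul l a in
      let eb := nca_reify mul l b in
      let H := fresh in
      have H := @nca_correct F X mul alg l ea eb isT;
      cbn [neval nth] in H; exact: H
    end
  end.

(** * Nondegenerate [eps]-symmetric forms in infinite dimension *)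

Section FormSpace.
Variables (F : fieldType) (U : lmodType F) (B : U -> U -> F) (eps : F).

Definition form_axioms :=
  [/\ forall c x y z, B (c *: x + y) z = c * B x z + B y z,
      eps * eps = 1,
      forall x y, B y x = eps * B x y
    & forall u, u != 0 -> exists v, B u v != 0].

Definition perp (S : seq U) (v : U) := forall s, s \in S -> B s v = 0.

Hypothesis BP : form_axioms.

Lemma BDZl c x y z : B (c *: x + y) z = c * B x z + B y z.
Proof. by case: BP. Qed.
Lemma epsK : eps * eps = 1. Proof. by case: BP. Qed.
Lemma BC x y : B y x = eps * B x y. Proof. by case: BP. Qed.
Lemma B0l z : B 0 z = 0.
Proof.
have := BDZl 1 0 0 z; rewrite scale1r addr0 mul1r => h.
by apply: (addrI (B 0 z)); rewrite -h addr0.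
Qed.
Lemma BDl x y z : B (x + y) z = B x z + B y z.
Proof. by have := BDZl 1 x y z; rewrite scale1r mul1r. Qed.
Lemma BZl c x z : B (c *: x) z = c * B x z.
Proof. by have := BDZl c x 0 z; rewrite !addr0 B0l addr0. Qed.
Lemma BNl x z : B (- x) z = - B x z.
Proof. by rewrite -scaleN1r BZl mulN1r. Qed.
Lemma BDr x y z : B z (x + y) = B z x + B z y.
Proof. by rewrite !(BC _ z) BDl mulrDr. Qed.
Lemma BZr c x z : B z (c *: x) = c * B z x.
Proof. by rewrite !(BC _ z) BZl mulrCA. Qed.
Lemma B0r z : B z 0 = 0. Proof. by rewrite BC B0l mulr0. Qed.
Lemma BNr x z : B z (- x) = - B z x.
Proof. by rewrite -scaleN1r BZr mulN1r. Qed.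
Lemma B_sumr I (s : seq I) (f : I -> U) z :
  B z (\sum_(i <- s) f i) = \sum_(i <- s) B z (f i).
Proof. by elim: s => [|i s IH]; rewrite ?big_nil ?B0r // !big_cons BDr IH. Qed.
Lemma B_suml I (s : seq I) (f : I -> U) z :
  B (\sum_(i <- s) f i) z = \sum_(i <- s) B (f i) z.
Proof. by elim: s => [|i s IH]; rewrite ?big_nil ?B0l // !big_cons BDl IH. Qed.
Lemma eps_neq0 : eps != 0.
Proof. by apply: contra_eq_neq epsK => ->; rewrite mulr0 eq_sym oner_neq0. Qed.
Lemma BC0 x y : B x y = 0 -> B y x = 0.
Proof. by rewrite (BC x y) => ->; rewrite mulr0. Qed.
Lemma Binj x y : (forall z, B z x = B z y) -> x = y.
Proof.
move=> h; apply/eqP; rewrite -subr_eq0; apply/negPn/negP => /[dup] _.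
case: BP => _ _ _ /[apply] -[z /negP[]]; apply/eqP/BC0.
by rewrite BDr BNr h subrr.
Qed.

Lemma perpD S u v : perp S u -> perp S v -> perp S (u + v).
Proof. by move=> pu pv s sS; rewrite BDr pu // pv // addr0. Qed.
Lemma perpZ S c u : perp S u -> perp S (c *: u).
Proof. by move=> pu s sS; rewrite BZr pu // mulr0. Qed.
Lemma perp_cat S T v : perp (S ++ T) v <-> perp S v /\ perp T v.
Proof.
split=> [h|[h1 h2] s]; last by rewrite mem_cat => /orP[/h1|/h2].
by split=> s sS; apply: h; rewrite mem_cat sS ?orbT.
Qed.
Lemma perp_cons s S v : perp (s :: S) v <-> B s v = 0 /\ perp S v.
Proof.
split=> [h|[h1 h2] t]; last by rewrite inE => /orP[/eqP->|/h2].
by split=> [|t tS]; apply: h; rewrite inE ?eqxx ?tS ?orbT.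
Qed.
Lemma perp_sub (S T : seq U) v : {subset S <= T} -> perp T v -> perp S v.
Proof. by move=> ST p s /ST/p. Qed.

(** Gram-Schmidt relative to [S], whose span may be degenerate. Subtracting the sum is a projection
    onto the orthogonal complement of [S], and the first components represent functionals vanishing
    there. *)
Lemma dual_system S : exists st : seq (U * U),
  (forall p, p \in st -> forall v, perp S v -> B p.1 v = 0) /\
  (forall u, perp S (u - \sum_(p <- st) B p.1 u *: p.2)).
Proof.
elim: S => [|s S [st [h1 h2]]]; first by exists [::]; split.
pose pr u := u - \sum_(p <- st) B p.1 u *: p.2.
(* If [s] vanishes on the image of the projection, it is already accounted for and no pair is
   added. *)
case: (pselect (exists u, B s (pr u) != 0)) => [[u0 nz]|h]; last first.
  exists st; split=> [p pst v /perp_cons[_]|u]; first exact: h1.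
  by apply/perp_cons; split=> //; apply/eqP/negPn/negP => nz; apply: h; exists u.
(* [s'] represents the functional [B s] composed with the projection. *)
pose s' := s - \sum_(p <- st) B s p.2 *: p.1.
have s'E u : B s' u = B s (pr u).
  rewrite /s' /pr BDl BDr BNl BNr B_suml B_sumr; congr (_ - _).
  by apply: eq_bigr => p _; rewrite BZl BZr mulrC.
pose t := (B s (pr u0))^-1 *: pr u0.
exists ((s', t) :: st); split=> [p|u].
  rewrite inE => /orP[/eqP -> /= v|pst v] /perp_cons[sv Sv]; last exact: h1.
  rewrite s'E /pr BDr sv BNr B_sumr add0r big_seq big1 ?oppr0 // => q qst.
  by rewrite h1 // scale0r B0r.
rewrite big_cons /= opprD addrCA addrC -/(pr u) s'E -scaleNr.
apply/perp_cons; split; last exact/perpD/perpZ/perpZ/h2/h2.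
by rewrite BDr BZr BZr mulVf // mulr1 subrr.
Qed.

Hypothesis infU : infinite_dim U.

Lemma fresh_pair S : exists bv : U * U,
  [/\ perp S bv.1, perp S bv.2 & B bv.1 bv.2 = 1].
Proof.
have [st [h1 h2]] := dual_system S.
(* The first vector is also made orthogonal to the vectors [p.2]; projecting its partner into the
   complement of [S] then leaves their pairing unchanged. *)
have [st' [h1' h2']] := dual_system (S ++ [seq p.2 | p <- st]).
have [u nu] := infU [seq p.2 | p <- st'].
set b := u - \sum_(p <- st') B p.1 u *: p.2 in (h2') *.
have b0 : u - \sum_(p <- st') B p.1 u *: p.2 != 0.
  apply/negP => /eqP /subr0_eq ub; apply: nu.
  exists (fun i => B (nth (0, 0) st' i).1 u); rewrite {1}ub (big_nth (0, 0)).
  rewrite size_map big_mkord; apply: eq_bigr => i _.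
  by rewrite (nth_map (0, 0)).
have [v0 nz] : exists v, B (u - \sum_(p <- st') B p.1 u *: p.2) v != 0.
  by case: BP => _ _ _; apply.
have /perp_cat[Sb stb] := h2' u.
set b' := u - _ in b0 nz Sb stb.
pose v := v0 - \sum_(p <- st) B p.1 v0 *: p.2.
have bv : B b' v = B b' v0.
  rewrite /v BDr BNr B_sumr big_seq big1 ?subr0 // => p pst.
  by rewrite BZr (BC _ b') stb ?map_f ?mulr0.
exists (b', (B b' v)^-1 *: v); split=> //=; first exact/perpZ/h2.
by rewrite BZr mulVf // bv.
Qed.

(** Self-pairings of the [b i] and of the [v i] are left unspecified, since isotropic vectors need
    not exist; this is why computations along chains assume distinct indices. *)
Definition chain (S : seq U) (b v : nat -> U) :=
  [/\ forall i, perp S (b i), forall i, perp S (v i),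
      forall i j, B (b i) (v j) = (i == j)%:R,
      forall i j, i != j -> B (b i) (b j) = 0
    & forall i j, i != j -> B (v i) (v j) = 0].

Lemma exists_chain S : exists b v, chain S b v.
Proof.
have [fr frP] := choice fresh_pair.
(* [l n] collects [S] and all vectors chosen before stage [n], so the pair chosen at stage [n] is
   orthogonal to all of them. *)
pose l := fix l n := if n is n'.+1 then (fr (l n')).1 :: (fr (l n')).2 :: l n'
                     else S.
have lS n : {subset S <= l n}.
  by elim: n => //= n IH s /IH sl; rewrite !inE sl !orbT.
have lm m n : (m < n)%N -> (fr (l m)).1 \in l n /\ (fr (l m)).2 \in l n.
  elim: n => // n IH; rewrite ltnS leq_eqVlt => /orP[/eqP->|/IH[h1 h2]] /=.
    by rewrite !inE !eqxx orbT.
  by rewrite !inE h1 h2 !orbT.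
exists (fun i => (fr (l i)).1), (fun i => (fr (l i)).2); split.
- by move=> i; apply: perp_sub (lS i) _; case: (frP (l i)).
- by move=> i; apply: perp_sub (lS i) _; case: (frP (l i)).
- move=> i j; case: ltngtP => [ij|ji|->]; last by case: (frP (l j)).
    by have [_ + _] := frP (l j); apply; case: (lm _ _ ij).
  by apply: BC0; have [+ _ _] := frP (l i); apply; case: (lm _ _ ji).
- move=> i j; case: ltngtP => // [ij|ji] _.
    by have [+ _ _] := frP (l j); apply; case: (lm _ _ ij).
  by apply: BC0; have [+ _ _] := frP (l i); apply; case: (lm _ _ ji).
- move=> i j; case: ltngtP => // [ij|ji] _.
    by have [_ + _] := frP (l j); apply; case: (lm _ _ ij).
  by apply: BC0; have [_ + _] := frP (l i); apply; case: (lm _ _ ji).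
Qed.

End FormSpace.

(** * Commutators, triads and tetrads *)

Definition cm (X : zmodType) (mul : X -> X -> X) x y := mul x y - mul y x.
Definition jd (X : zmodType) (mul : X -> X -> X) x y := mul x y + mul y x.
(** For skew factors this triad is again skew, as are the commutator and the tetrad [tw4]; [jd] is
    skew when one factor is skew and the other symmetric. *)
Definition T3 (X : zmodType) (mul : X -> X -> X) x y z :=
  mul (mul x y) z + mul (mul z y) x.
Definition tw4 (X : zmodType) (mul : X -> X -> X) a b c d :=
  mul (mul (mul a b) c) d - mul (mul (mul d c) b) a.

Section Commutator.
Variables (F : fieldType) (X : lmodType F) (mul : X -> X -> X).
Hypothesis alg : assoc_algebra mul.
Lemma cmDl x y z : cm mul (x + y) z = cm mul x z + cm mul y z.
Proof. by rewrite /cm; nca alg. Qed.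
Lemma cmDr x y z : cm mul z (x + y) = cm mul z x + cm mul z y.
Proof. by rewrite /cm; nca alg. Qed.
Lemma cmZr c x z : cm mul z (c *: x) = c *: cm mul z x.
Proof. by rewrite /cm (algZl alg) (algZr alg) scalerBr. Qed.
Lemma cmNr x z : cm mul z (- x) = - cm mul z x.
Proof. by rewrite /cm; nca alg. Qed.
Lemma cm0l z : cm mul 0 z = 0.
Proof. by rewrite /cm (alg0l alg) (alg0r alg) subrr. Qed.
Lemma cm0r z : cm mul z 0 = 0.
Proof. by rewrite /cm (alg0l alg) (alg0r alg) subrr. Qed.
End Commutator.

Definition loc (U : eqType) (H : zmodType) (P : seq U -> U -> Prop)
    (S : seq U) (q : U -> U -> H) :=
  forall v, P S v -> forall u, q u v = 0 /\ q v u = 0.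

(* [Q] stands for [A (x) H]: the element [sum a_i (x) h_i] is known through its
   matrix [ev q u v = sum B(u, a_i v) h_i], [el a b h] is
   [(v |-> B(b, v) a) (x) h], and a matrix is local when it vanishes on the
   orthogonal complement of a finite set. *)
Record tensor_model (F : fieldType) (U H Q : lmodType F) (B : U -> U -> F)
    (eps : F) (mulH : H -> H -> H) (mulQ : Q -> Q -> Q) (starQ : Q -> Q)
    (ev : Q -> U -> U -> H) (el : U -> U -> H -> Q) : Prop := TensorModel {
  tm_alg : assoc_algebra mulQ;
  tm_inv : is_involution mulQ starQ;
  tm_evP : forall c q q' u v, ev (c *: q + q') u v = c *: ev q u v + ev q' u v;
  tm_inj : forall q q', (forall u v, ev q u v = ev q' u v) -> q = q';
  tm_evl : forall q c u u' v, ev q (c *: u + u') v = c *: ev q u v + ev q u' v;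
  tm_evr : forall q c u u' v, ev q v (c *: u + u') = c *: ev q v u + ev q v u';
  tm_el : forall a b h u v, ev (el a b h) u v = (B u a * B b v) *: h;
  tm_mulel : forall q a b h u v,
    ev (mulQ q (el a b h)) u v = B b v *: mulH h (ev q u a);
  tm_elmul : forall q a b h u v,
    ev (mulQ (el a b h) q) u v = B u a *: mulH h (ev q b v);
  tm_star : forall q u v, ev (starQ q) u v = eps *: ev q v u;
  tm_mulr : forall k q q' u v v', (forall p, ev q p v = ev q' p v') ->
    ev (mulQ k q) u v = ev (mulQ k q') u v';
  tm_mull : forall k q q' u u' v, (forall p, ev q u p = ev q' u' p) ->
    ev (mulQ q k) u v = ev (mulQ q' k) u' v;
  tm_loc : forall k S, exists S', forall q, loc (perp B) S (ev q) ->
    loc (perp B) S' (ev (mulQ k q)) /\ loc (perp B) S' (ev (mulQ q k)) }.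

(** * Skew and local elements of a tensor model *)

Section Tensor.
Variables (F : fieldType) (U H Q : lmodType F) (B : U -> U -> F) (eps : F).
Variables (mulH : H -> H -> H) (oneH : H) (mulQ : Q -> Q -> Q) (starQ : Q -> Q).
Variables (ev : Q -> U -> U -> H) (el : U -> U -> H -> Q).
Hypothesis two : 2%:R != 0 :> F.
Hypothesis BP : form_axioms B eps.
Hypothesis infU : infinite_dim U.
Hypothesis HP : unital_comm_algebra mulH oneH.
Hypothesis TM : tensor_model B eps mulH mulQ starQ ev el.

Local Notation "p ## q" := (mulQ p q) (at level 40, left associativity).
Local Notation locB S q := (loc (perp B) S (ev q)).

Let algH : assoc_algebra mulH. Proof. by case: HP. Qed.
Let algQ := tm_alg TM.
Lemma mulHC x y : mulH x y = mulH y x. Proof. by case: HP => _ []. Qed.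
Lemma mul1H x : mulH oneH x = x. Proof. by case: HP => _ []. Qed.

Lemma evD q q' u v : ev (q + q') u v = ev q u v + ev q' u v.
Proof. by have := tm_evP TM 1 q q' u v; rewrite !scale1r. Qed.
Lemma ev0 u v : ev 0 u v = 0.
Proof. by apply: (addrI (ev 0 u v)); rewrite -evD !addr0. Qed.
Lemma evZ c q u v : ev (c *: q) u v = c *: ev q u v.
Proof. by have := tm_evP TM c q 0 u v; rewrite !addr0 ev0 addr0. Qed.
Lemma evN q u v : ev (- q) u v = - ev q u v.
Proof. by rewrite -scaleN1r evZ scaleN1r. Qed.
Lemma ev_sum I (s : seq I) (P : pred I) (f : I -> Q) u v :
  ev (\sum_(i <- s | P i) f i) u v = \sum_(i <- s | P i) ev (f i) u v.
Proof. exact: (big_morph (fun q => ev q u v) (fun q q' => evD q q' u v) (ev0 u v)). Qed.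

Lemma evDl q u u' v : ev q (u + u') v = ev q u v + ev q u' v.
Proof. by have := tm_evl TM q 1 u u' v; rewrite !scale1r. Qed.
Lemma ev0l q v : ev q 0 v = 0.
Proof. by apply: (addrI (ev q 0 v)); rewrite -evDl !addr0. Qed.
Lemma evZl c q u v : ev q (c *: u) v = c *: ev q u v.
Proof. by have := tm_evl TM q c u 0 v; rewrite !addr0 ev0l addr0. Qed.
Lemma ev_suml I (s : seq I) (f : I -> U) q v :
  ev q (\sum_(i <- s) f i) v = \sum_(i <- s) ev q (f i) v.
Proof. by elim: s => [|i s IH]; rewrite ?big_nil ?ev0l // !big_cons evDl IH. Qed.
Lemma evDr q u u' v : ev q v (u + u') = ev q v u + ev q v u'.
Proof. by have := tm_evr TM q 1 u u' v; rewrite !scale1r. Qed.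
Lemma ev0r q v : ev q v 0 = 0.
Proof. by apply: (addrI (ev q v 0)); rewrite -evDr !addr0. Qed.
Lemma evZr c q u v : ev q v (c *: u) = c *: ev q v u.
Proof. by have := tm_evr TM q c u 0 v; rewrite !addr0 ev0r addr0. Qed.
Lemma ev_sumr I (s : seq I) (f : I -> U) q v :
  ev q v (\sum_(i <- s) f i) = \sum_(i <- s) ev q v (f i).
Proof. by elim: s => [|i s IH]; rewrite ?big_nil ?ev0r // !big_cons evDr IH. Qed.

Lemma half_eq (W : lmodType F) (x y : W) : x + x = y + y -> x = y.
Proof.
move=> h; apply/eqP; rewrite -subr_eq0 -(inj_eq (scalerI two)) scaler0.
by rewrite scaler_nat mulrnBl !mulr2n h subrr.
Qed.
Lemma eqN_eq0 (W : lmodType F) (x : W) : x = - x -> x = 0.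
Proof. by move=> h; apply: half_eq; rewrite {2}h subrr addr0. Qed.

Definition skQ q := starQ q = - q.
Definition X a b h : Q := locked (el a b h - eps *: el b a h).
Lemma XE a b h : X a b h = el a b h - eps *: el b a h.
Proof. by rewrite /X -lock. Qed.

Lemma starQD q q' : starQ (q + q') = starQ q + starQ q'.
Proof. by have [/(_ 1 q q')] := tm_inv TM; rewrite !scale1r. Qed.
Lemma starQ0 : starQ 0 = 0.
Proof. by apply: (addrI (starQ 0)); rewrite -starQD !addr0. Qed.
Lemma starQZ c q : starQ (c *: q) = c *: starQ q.
Proof. by have [/(_ c q 0)] := tm_inv TM; rewrite starQ0 !addr0. Qed.
Lemma starQN q : starQ (- q) = - starQ q.
Proof. by rewrite -scaleN1r starQZ scaleN1r. Qed.
Lemma starQM p q : starQ (p ## q) = starQ q ## starQ p.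
Proof. by have [_ []] := tm_inv TM. Qed.
Lemma skQD q q' : skQ q -> skQ q' -> skQ (q + q').
Proof. by rewrite /skQ starQD => -> ->; rewrite opprD. Qed.
Lemma skQZ c q : skQ q -> skQ (c *: q).
Proof. by rewrite /skQ starQZ => ->; rewrite scalerN. Qed.
Lemma skQN q : skQ q -> skQ (- q).
Proof. by rewrite /skQ starQN => ->. Qed.
Lemma skQ0 : skQ 0. Proof. by rewrite /skQ starQ0 oppr0. Qed.
Lemma skQ_cm q q' : skQ q -> skQ q' -> skQ (cm mulQ q q').
Proof.
move=> h h'; rewrite /skQ /cm starQD starQN !starQM h h'; nca algQ.
Qed.
Lemma skQ_T3 x y z : skQ x -> skQ y -> skQ z -> skQ (T3 mulQ x y z).
Proof.
by move=> hx hy hz; rewrite /skQ /T3 starQD !starQM hx hy hz; nca algQ.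
Qed.
Lemma ev_skew q u v : skQ q -> ev q u v = - (eps *: ev q v u).
Proof. by move=> h; rewrite -(tm_star TM) h evN opprK. Qed.

Lemma starQ_el a b h : starQ (el a b h) = eps *: el b a h.
Proof.
apply: (tm_inj TM) => u v.
by rewrite (tm_star TM) evZ !(tm_el TM) (BC BP v) (BC BP b) mulrACA (epsK BP) mul1r mulrC.
Qed.
Lemma skX a b h : skQ (X a b h).
Proof.
rewrite /skQ XE starQD starQN starQZ !starQ_el scalerA (epsK BP) scale1r.
by rewrite opprB addrC.
Qed.
Lemma ev_X a b h u v :
  ev (X a b h) u v = (B u a * B b v - eps * (B u b * B a v)) *: h.
Proof. by rewrite XE evD evN evZ !(tm_el TM) scalerA -scalerBl. Qed.
Lemma ev_mulX q a b h u v :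
  ev (q ## X a b h) u v = B b v *: mulH h (ev q u a)
                          - (eps * B a v) *: mulH h (ev q u b).
Proof.
by rewrite XE (algDr algQ) (algNr algQ) (algZr algQ) evD evN evZ !(tm_mulel TM) scalerA.
Qed.
Lemma ev_Xmul q a b h u v :
  ev (X a b h ## q) u v = B u a *: mulH h (ev q b v)
                          - (eps * B u b) *: mulH h (ev q a v).
Proof.
by rewrite XE (algDl algQ) (algNl algQ) (algZl algQ) evD evN evZ !(tm_elmul TM) scalerA.
Qed.
Lemma ev_cmX q a b h u v :
  ev (cm mulQ q (X a b h)) u v =
    B b v *: mulH h (ev q u a) - (eps * B a v) *: mulH h (ev q u b)
    + (B b u *: mulH h (ev q a v) - (eps * B a u) *: mulH h (ev q b v)).
Proof.
rewrite /cm evD evN ev_mulX ev_Xmul; congr (_ + _).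
rewrite opprB (BC BP b u) mulrA (epsK BP) mul1r (BC BP a u).
by rewrite addrC.
Qed.
Lemma ev_cmX1 q a b u v :
  ev (cm mulQ q (X a b oneH)) u v =
    B b v *: ev q u a - (eps * B a v) *: ev q u b
    + (B b u *: ev q a v - (eps * B a u) *: ev q b v).
Proof. by rewrite ev_cmX !mul1H. Qed.

Lemma XC a b h : X b a h = - (eps *: X a b h).
Proof. by rewrite !XE scalerBr scalerA (epsK BP) scale1r opprB. Qed.
Lemma XDZl c a a' b h : X (c *: a + a') b h = c *: X a b h + X a' b h.
Proof.
apply: (tm_inj TM) => u v; rewrite evD evZ !ev_X scalerA -scalerDl.
by congr (_ *: _); rewrite (BDl BP) (BZl BP) (BDr BP) (BZr BP); ring.
Qed.
Lemma XDl a a' b h : X (a + a') b h = X a b h + X a' b h.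
Proof. by have := XDZl 1 a a' b h; rewrite !scale1r. Qed.
Lemma XZl c a b h : X (c *: a) b h = c *: X a b h.
Proof.
apply: (tm_inj TM) => u v; rewrite evZ !ev_X scalerA.
by congr (_ *: _); rewrite (BZl BP) (BZr BP); ring.
Qed.
Lemma XhZ c a b h : X a b (c *: h) = c *: X a b h.
Proof. by apply: (tm_inj TM) => u v; rewrite evZ !ev_X !scalerA mulrC. Qed.

Lemma cmXX a b c d h k :
  cm mulQ (X a b h) (X c d k) =
    (B b c *: X a d (mulH k h) - (eps * B a c) *: X b d (mulH k h))
    + (B b d *: X c a (mulH k h) - (eps * B a d) *: X c b (mulH k h)).
Proof.
apply: (tm_inj TM) => u v.
rewrite ev_cmX !evD !evN !evZ !ev_X !(algZr algH) !scalerA.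
rewrite -!scalerBl -!scalerDl; congr (_ *: _).
rewrite (BC BP u c) (BC BP u d) (BC BP a c) (BC BP b c) (BC BP a d) (BC BP b d).
by have e2 := epsK BP; ring: e2.
Qed.

Lemma loc_sub S T q : (forall v, perp B T v -> perp B S v) -> locB S q -> locB T q.
Proof. by move=> h l v /h; apply: l. Qed.
Lemma locD S q q' : locB S q -> locB S q' -> locB S (q + q').
Proof.
move=> h h' v pv u; have [h1 h2] := h _ pv u; have [h3 h4] := h' _ pv u.
by rewrite !evD h1 h2 h3 h4 !addr0.
Qed.
Lemma locZ S c q : locB S q -> locB S (c *: q).
Proof.
by move=> h v pv u; have [h1 h2] := h _ pv u; rewrite !evZ h1 h2 !scaler0.
Qed.
Lemma locN S q : locB S q -> locB S (- q).
Proof. by rewrite -scaleN1r; apply: locZ. Qed.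
Lemma loc0 S : locB S 0. Proof. by move=> v _ u; rewrite !ev0. Qed.
Lemma loc_sum S I (s : seq I) (P : pred I) (f : I -> Q) :
  (forall i, P i -> locB S (f i)) -> locB S (\sum_(i <- s | P i) f i).
Proof.
by move=> h; elim/big_ind: _ => [|? ?|//]; [exact: loc0|exact: locD].
Qed.
Lemma loc_mull S k q u v : locB S k -> perp B S u -> ev (k ## q) u v = 0.
Proof.
move=> l pu; rewrite -[RHS](ev0 u v) -(alg0l algQ q).
by apply: (tm_mull TM) => p; rewrite ev0; case: (l _ pu p).
Qed.
Lemma loc_mulr S k q u v : locB S k -> perp B S v -> ev (q ## k) u v = 0.
Proof.
move=> l pv; rewrite -[RHS](ev0 u v) -(alg0r algQ q).
by apply: (tm_mulr TM) => p; rewrite ev0; case: (l _ pv p).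
Qed.
Lemma locM S q q' : locB S q -> locB S q' -> locB S (q ## q').
Proof. by move=> l l' v pv u; rewrite (loc_mulr _ _ l' pv) (loc_mull _ _ l pv). Qed.
Lemma loc_cm S q q' : locB S q -> locB S q' -> locB S (cm mulQ q q').
Proof. by move=> l l'; apply: locD; [|apply: locN]; apply: locM. Qed.
Lemma loc_T3 S x y z : locB S x -> locB S y -> locB S z -> locB S (T3 mulQ x y z).
Proof. by move=> lx ly lz; apply: locD; do 2![apply: locM => //]. Qed.
Lemma locX S a b h : (forall v, perp B S v -> B a v = 0 /\ B b v = 0) ->
  locB S (X a b h).
Proof.
move=> ab v /ab[av bv] u; rewrite !ev_X av bv (BC0 BP av) (BC0 BP bv).
by rewrite !mul0r !mulr0 subr0 scale0r.
Qed.
Lemma loc_cm_any k S : exists S', forall q, locB S q -> locB S' (cm mulQ k q).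
Proof.
have [S' h] := tm_loc TM k S; exists S' => q /h [h1 h2].
by apply: locD => //; apply: locN.
Qed.

(** Expanding both arguments of the matrix of [q] along a dual system of [S] gives a sum of terms
    [el]; taking half of [q - starQ q] turns each into half of an [X]. *)
Lemma loc_decomp S q : skQ q -> locB S q -> exists s : seq (U * U * H),
  q = \sum_(p <- s) X p.1.1 p.1.2 p.2 /\
  forall p, p \in s -> forall v, perp B S v -> B p.1.1 v = 0 /\ B p.1.2 v = 0.
Proof.
move=> sq lq; have [st [st1 st2]] := dual_system BP S.
(* The factor [eps] appears because [el] pairs its first vector on the right of [B], the dual system
   on the left. *)
pose g (p r : U * U) := eps *: ev q p.2 r.2.
pose h p r := 2%:R^-1 *: g p r.
exists [seq ((p.1, r.1), h p r) | p <- st, r <- st]; split; last first.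
  by move=> _ /allpairsP[[p r] /= [pst rst ->]] v pv;
     rewrite (st1 _ pst _ pv) (st1 _ rst _ pv).
have qE u v : ev q u v = \sum_(p <- st) \sum_(r <- st)
     (B p.1 u * B r.1 v) *: ev q p.2 r.2.
  rewrite -{1}[u](subrK (\sum_(p <- st) B p.1 u *: p.2)) evDl
    (lq _ (st2 u) v).2 add0r ev_suml; apply: eq_bigr => p _.
  rewrite evZl -{1}[v](subrK (\sum_(p <- st) B p.1 v *: p.2)) evDr
    (lq _ (st2 v) _).1 add0r ev_sumr scaler_sumr.
  by apply: eq_bigr => r _; rewrite evZr scalerA.
have q1 : q = \sum_(p <- st) \sum_(r <- st) el p.1 r.1 (g p r).
  apply: (tm_inj TM) => u v; rewrite qE ev_sum; apply: eq_bigr => p _.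
  rewrite ev_sum; apply: eq_bigr => r _; rewrite (tm_el TM) scalerA.
  by congr (_ *: _); rewrite (BC BP u); ring.
have q2 : q = 2%:R^-1 *: (q - starQ q).
  by rewrite sq opprK -mulr2n -scaler_nat scalerA mulVf // scale1r.
transitivity (2%:R^-1 *: \sum_(p <- st) \sum_(r <- st) X p.1 r.1 (g p r)).
  rewrite {1}q2; congr (_ *: _); rewrite q1 (big_morph _ starQD starQ0) -sumrB.
  apply: eq_bigr => p _; rewrite (big_morph _ starQD starQ0) -sumrB.
  by apply: eq_bigr => r _; rewrite XE starQ_el.
rewrite scaler_sumr big_allpairs_dep; apply: eq_bigr => p _.
by rewrite scaler_sumr /=; apply: eq_bigr => r _; rewrite [RHS]XhZ.
Qed.

(** One bracket through the dual pair gives [X a b h] up to a multiple of [X c' c h] proportional to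
    [B a b]; exchanging [c] and [c'] produces the same multiple with opposite sign. *)
Lemma X_perfect a b c c' h : B c c' = 1 -> perp B [:: a; b] c ->
  perp B [:: a; b] c' ->
  X a b h + X a b h = cm mulQ (X a c oneH) (X c' b h)
                      + eps *: cm mulQ (X a c' oneH) (X c b h).
Proof.
move=> cc' /perp_cons[ac /perp_cons[bc _]] /perp_cons[ac' /perp_cons[bc' _]].
rewrite !cmXX cc' (BC BP c c') cc' ac ac' (BC0 BP bc) (BC0 BP bc').
rewrite ![mulH h oneH]mulHC !mul1H (XC c' c) mulr0 !scale0r !subr0 !sub0r.
rewrite scale1r scalerBr [(_ * B a b) *: - _]scalerN [eps *: - _]scalerN opprK.
rewrite mulr1 !scalerA (epsK BP) scale1r addrACA.
have -> : eps * (eps * B a b) * eps = eps * B a b.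
  by rewrite mulrA (epsK BP) mul1r mulrC.
by rewrite addNr addr0.
Qed.

(** The vanishing brackets make the entries at [(u, a)] and [(a, u)] multiples, by the form, of the
    single element [ev q b v]; comparing the symmetry of the form with skewness of [q] makes the
    entry equal to its negative. *)
Lemma centralizer q : skQ q -> (forall a b, cm mulQ q (X a b oneH) = 0) -> q = 0.
Proof.
move=> sq h; apply: (tm_inj TM) => u a; rewrite ev0.
have [[b v] /= [pb pv bv]] := fresh_pair BP infU [:: u; a].
have [ub /perp_cons[ab _]] := (perp_cons _ _ _ _).1 pb.
have [uv /perp_cons[av _]] := (perp_cons _ _ _ _).1 pv.
have e1 : ev q u a = (eps * B a u) *: ev q b v.
  have := ev_cmX1 q a b u v; rewrite h ev0 bv av (BC0 BP ub) scale1r.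
  rewrite mulr0 !scale0r subr0 add0r => /esym/eqP.
  by rewrite subr_eq0 => /eqP.
have e2 : ev q a u = (eps * B u a) *: ev q b v.
  have := ev_cmX1 q u b a v; rewrite h ev0 bv uv (BC0 BP ab) scale1r.
  rewrite mulr0 !scale0r subr0 add0r => /esym/eqP.
  by rewrite subr_eq0 => /eqP.
apply: eqN_eq0; rewrite {1}(ev_skew _ _ sq) e2 e1 scalerA (BC BP u a).
by rewrite mulrA (epsK BP) mul1r.
Qed.

(* The two steps of the rigidity argument: [v] ranges over the vectors
   orthogonal to the finite set [S], where [q] is allowed to be nonzero only
   from [span S] or to [span S]. *)
Lemma rigid1 S q : skQ q ->
  (forall u v, perp B S u -> perp B S v -> ev q u v = 0) ->
  (forall a b u v, perp B S u -> perp B S v ->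
     ev (cm mulQ q (X a b oneH)) u v = 0) -> locB S q.
Proof.
move=> sq h0 h u pu a.
suff e : ev q u a = 0 by split=> //; rewrite (ev_skew _ _ sq) e scaler0 oppr0.
have [[b v] /= [/perp_cons[ub pb] pv bv]] := fresh_pair BP infU (u :: S).
have {pv} [uv pv] := (perp_cons _ _ _ _).1 pv.
have := h a b u v pu pv.
rewrite ev_cmX1 bv scale1r (BC0 BP ub) scale0r add0r.
by rewrite (h0 u b) // (h0 b v) // !scaler0 !subr0.
Qed.

Lemma rigid2 S q : locB S q ->
  (forall a b, locB S (cm mulQ q (X a b oneH))) -> q = 0.
Proof.
move=> lq h; apply: (tm_inj TM) => u a; rewrite ev0.
have [[b v] /= [/perp_cons[ub pb] pv bv]] := fresh_pair BP infU (u :: S).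
have {pv} [uv pv] := (perp_cons _ _ _ _).1 pv.
have := (h a b v pv u).1; rewrite ev_cmX1 bv scale1r (BC0 BP ub) scale0r add0r.
by rewrite (lq b pb u).1 (lq v pv b).1 !scaler0 !subr0.
Qed.

(** * Lie homomorphisms onto the skew tensors *)

Section Skew.
Variables (V : lmodType F) (mulV : V -> V -> V) (star : V -> V).
Variables (M : V -> Prop) (r : V -> Q).
Hypothesis algV : assoc_algebra mulV.
Hypothesis invV : is_involution mulV star.
Hypothesis idealM : lie_ideal_K mulV star M.
Hypothesis rP : forall c x y, M x -> M y -> r (c *: x + y) = c *: r x + r y.
Hypothesis rL : forall x y, M x -> M y ->
  r (cm mulV x y) = cm mulQ (r x) (r y).
Hypothesis rS : forall x, M x -> skQ (r x).
Hypothesis rX : forall a b h, exists x, M x /\ r x = X a b h.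

Local Notation "x ** y" := (mulV x y) (at level 40, left associativity).
Local Notation cmV := (cm mulV).
Local Notation cmQ := (cm mulQ).

Definition sk x := star x = - x.

Lemma starD x y : star (x + y) = star x + star y.
Proof. by have [/(_ 1 x y)] := invV; rewrite !scale1r. Qed.
Lemma star0 : star 0 = 0.
Proof. by apply: (addrI (star 0)); rewrite -starD !addr0. Qed.
Lemma starZ c x : star (c *: x) = c *: star x.
Proof. by have [/(_ c x 0)] := invV; rewrite star0 !addr0. Qed.
Lemma starN x : star (- x) = - star x.
Proof. by rewrite -scaleN1r starZ scaleN1r. Qed.
Lemma starK x : star (star x) = x. Proof. by have [_ []] := invV. Qed.
Lemma starM x y : star (x ** y) = star y ** star x.
Proof. by have [_ []] := invV. Qed.
Lemma skD x y : sk x -> sk y -> sk (x + y).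
Proof. by rewrite /sk starD => -> ->; rewrite opprD. Qed.
Lemma skZ c x : sk x -> sk (c *: x).
Proof. by rewrite /sk starZ => ->; rewrite scalerN. Qed.
Lemma sk0 : sk 0. Proof. by rewrite /sk star0 oppr0. Qed.
Lemma sk_cm x y : sk x -> sk y -> sk (cmV x y).
Proof. by move=> h h'; rewrite /sk /cm starD starN !starM h h'; nca algV. Qed.
Lemma sk_T3 x y z : sk x -> sk y -> sk z -> sk (T3 mulV x y z).
Proof. by move=> hx hy hz; rewrite /sk /T3 starD !starM hx hy hz; nca algV. Qed.

Lemma M0 : M 0. Proof. by case: idealM => -[]. Qed.
Lemma MP c x y : M x -> M y -> M (c *: x + y).
Proof. by case: idealM => -[_ h] _; apply: h. Qed.
Lemma MD x y : M x -> M y -> M (x + y).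
Proof. by move=> h h'; rewrite -[x]scale1r; apply: MP. Qed.
Lemma MZ c x : M x -> M (c *: x).
Proof. by move=> h; rewrite -[_ *: x]addr0; apply/MP/M0. Qed.
Lemma MN x : M x -> M (- x). Proof. by rewrite -scaleN1r; apply: MZ. Qed.
Lemma M_sk x : M x -> sk x. Proof. by case: idealM => _ [+ _]; apply. Qed.
Lemma M_cm k x : sk k -> M x -> M (cmV k x).
Proof. by case: idealM => _ [_]; apply. Qed.
Lemma M_cmr k x : sk k -> M x -> M (cmV x k).
Proof.
move=> hk hx; have -> : cmV x k = - cmV k x by rewrite /cm opprB.
exact/MN/M_cm.
Qed.

Lemma rD x y : M x -> M y -> r (x + y) = r x + r y.
Proof. by move=> h h'; have := rP 1 h h'; rewrite !scale1r. Qed.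
Lemma r0 : r 0 = 0.
Proof. by apply: (addrI (r 0)); rewrite -rD ?addr0 //; exact: M0. Qed.
Lemma rZ c x : M x -> r (c *: x) = c *: r x.
Proof. by move=> h; have := rP c h M0; rewrite r0 !addr0. Qed.
Lemma rN x : M x -> r (- x) = - r x.
Proof. by move=> h; rewrite -scaleN1r rZ // scaleN1r. Qed.

(* [k] is the element by which [x] acts on the image of [M]. *)
Definition gd x k := [/\ sk x, skQ k & forall m, M m -> r (cmV x m) = cmQ k (r m)].

Lemma gd_M x : M x -> gd x (r x).
Proof. by move=> h; split; [exact: M_sk|exact: rS|move=> m; apply: rL]. Qed.

Lemma gd_uniq x k k' : gd x k -> gd x k' -> k = k'.
Proof.
move=> [_ s h] [_ s' h']; apply/subr0_eq/centralizer; first exact/skQD/skQN.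
move=> a b; have [m [Mm rm]] := rX a b oneH.
transitivity (cmQ k (r m) - cmQ k' (r m)); first by rewrite rm /cm; nca algQ.
by rewrite -h // -h' // subrr.
Qed.

Lemma gdP c x y k l : gd x k -> gd y l -> gd (c *: x + y) (c *: k + l).
Proof.
move=> [s1 s2 h] [s1' s2' h']; split; [exact/skD/s1'/skZ|exact/skQD/s2'/skQZ|].
move=> m Mm; transitivity (r (c *: cmV x m + cmV y m)).
  congr r; rewrite /cm (algDl algV) (algDr algV) (algZl algV) (algZr algV) scalerBr.
  by rewrite opprD addrACA.
rewrite rP ?h ?h' //; [|exact: M_cm|exact: M_cm].
rewrite /cm (algDl algQ) (algDr algQ) (algZl algQ) (algZr algQ) scalerBr.
by rewrite opprD addrACA.
Qed.

Lemma gd_cm x y k l : gd x k -> gd y l -> gd (cmV x y) (cmQ k l).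
Proof.
move=> [s1 s2 h] [s1' s2' h']; split; [exact: sk_cm|exact: skQ_cm|move=> m Mm].
transitivity (r (cmV x (cmV y m) - cmV y (cmV x m))).
  by congr r; rewrite /cm; nca algV.
rewrite rD ?rN ?h ?h' ?h' ?h //; try do ?[exact: M_cm|apply: MN|apply: M_cm => //].
by rewrite /cm; nca algQ.
Qed.

(** Locality of [r x] concerns only the image. A presentation of [x] itself by brackets of elements
    with local images is stronger: the Leibniz rule then bounds the image of the bracket of [x] with
    any skew [t], even when no tensor is known through which [t] acts. *)
Definition cl S x := exists s : seq (V * V), x = \sum_(p <- s) cmV p.1 p.2 /\
  forall p, p \in s -> [/\ M p.1, M p.2, locB S (r p.1) & locB S (r p.2)].

Lemma cl0 S : cl S 0.
Proof. by exists [::]; rewrite big_nil. Qed.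
Lemma clP S c x y : cl S x -> cl S y -> cl S (c *: x + y).
Proof.
move=> [s [-> hs]] [t [-> ht]].
exists ([seq (c *: p.1, p.2) | p <- s] ++ t); split.
  rewrite big_cat big_map scaler_sumr; congr (_ + _); apply: eq_bigr => p _.
  by rewrite /cm /= (algZl algV) (algZr algV) scalerBr.
move=> p; rewrite mem_cat => /orP[/mapP[q /hs[m1 m2 l1 l2] ->]|/ht//] /=.
by split=> //; [apply: MZ|rewrite rZ //; apply: locZ].
Qed.
Lemma cl_M S x : cl S x -> M x.
Proof.
move=> [s [-> hs]]; rewrite big_seq; elim/big_ind: _ => [||p /hs[m1 m2 _ _]].
- exact: M0.
- exact: MD.
- exact/M_cm/m2/M_sk.
Qed.
Lemma r_sum I (s : seq I) (P : pred I) f : (forall i, P i -> M (f i)) ->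
  r (\sum_(i <- s | P i) f i) = \sum_(i <- s | P i) r (f i).
Proof.
move=> h; elim: s => [|i s IH]; rewrite ?big_nil ?r0 // !big_cons.
case: ifP => // /h Mi; rewrite rD ?IH //.
by elim/big_ind: _ => [|x y|]; [exact: M0|exact: MD|].
Qed.
Lemma cl_loc S x : cl S x -> locB S (r x).
Proof.
move=> [s [-> hs]]; rewrite big_seq r_sum => [|p /hs[m1 m2 _ _]]; last first.
  exact/M_cm/m2/M_sk.
by apply: loc_sum => p /hs[m1 m2 l1 l2]; rewrite rL //; apply: loc_cm.
Qed.
Lemma cl_sub S T x : (forall v, perp B T v -> perp B S v) -> cl S x -> cl T x.
Proof.
move=> h [s [-> hs]]; exists s; split=> // p /hs[m1 m2 l1 l2].
by split=> //; apply: loc_sub h _.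
Qed.

(** This is [X_perfect] at the cost of adding a fresh dual pair to [S]. The pair can be made
    orthogonal to any prescribed [v]; letting [v] vary later recovers locality at [S] itself. *)
Lemma lift S v k : skQ k -> locB S k -> perp B S v ->
  exists S' x, [/\ perp B S' v, cl S' x, r x = k
                 & forall u, perp B S' u -> perp B S u].
Proof.
move=> sq lk pv; have [s [-> hs]] := loc_decomp sq lk.
pose T := v :: S ++ flatten [seq [:: p.1.1; p.1.2] | p <- s].
have [[c c'] /= [pc pc' cc']] := fresh_pair BP infU T.
have {pc pc'} [[vc pc] [vc' pc']] := ((perp_cons _ _ _ _).1 pc, (perp_cons _ _ _
  _).1 pc').
have {pc pc'} [[Sc sc] [Sc' sc']] := ((perp_cat _ _ _ _).1 pc, (perp_cat _ _ _ _).1 pc').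
pose S' := c :: c' :: S; exists S'.
have S'S u : perp B S' u -> perp B S u by case/perp_cons=> _ /perp_cons[].
have pS'v : perp B S' v.
  apply/perp_cons; split; first exact: (BC0 BP vc).
  by apply/perp_cons; split=> //; exact: (BC0 BP vc').
suff [x [cx rx]] : exists x, cl S' x /\ r x = \sum_(p <- s) X p.1.1 p.1.2 p.2.
  by exists x; split.
have {sc sc'} hc : forall p, p \in s ->
    perp B [:: p.1.1; p.1.2] c /\ perp B [:: p.1.1; p.1.2] c'.
  move=> p ps; split=> t tp; [apply: sc|apply: sc'];
    by apply/flattenP; exists [:: p.1.1; p.1.2] => //; apply/mapP; exists p.
clear T; elim: s hs hc => [|[[a b] h] s IH] hs hc.
  by exists 0; rewrite big_nil r0; split=> //; apply: cl0.
have [||x [cx rx]] := IH; try by move=> p ps; apply: hs || apply: hc; rewrite inE ps orbT.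
have /= hab := hs _ (mem_head _ _).
have /= [pc pc'] := hc _ (mem_head _ _).
have [m1 [M1 e1]] := rX a c oneH; have [m2 [M2 e2]] := rX c' b h.
have [m3 [M3 e3]] := rX a c' oneH; have [m4 [M4 e4]] := rX c b h.
have lc u : perp B S' u -> B c u = 0 by case/perp_cons.
have lc' u : perp B S' u -> B c' u = 0 by case/perp_cons=> _ /perp_cons[].
have la u : perp B S' u -> B a u = 0 by case/S'S/hab.
have lb u : perp B S' u -> B b u = 0 by case/S'S/hab.
pose y := cmV m1 m2 + cmV (eps *: m3) m4.
have cy : cl S' y.
  exists [:: (m1, m2); (eps *: m3, m4)]; rewrite !big_cons big_nil addr0; split=> //.
  move=> p; rewrite !inE => /orP[] /eqP-> /=; split; rewrite ?rZ ?e1 ?e2 ?e3 ?e4 //;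
    try exact: MZ; try apply: locZ;
    by apply: locX => u pu; split; rewrite ?lc ?lc' ?la ?lb.
exists (2%:R^-1 *: y + x); split; first exact: clP.
have Mx := cl_M cx; have My := cl_M cy.
rewrite rP // rx big_cons /=; congr (_ + _).
rewrite /y rD ?rL ?rZ ?e1 ?e2 ?e3 ?e4 //; try exact: MZ; last first.
- exact/M_cm/M4/M_sk/MZ.
- exact/M_cm/M2/M_sk.
rewrite {2}/cm (algZl algQ) (algZr algQ) -scalerBr -X_perfect //.
by rewrite -mulr2n -scaler_nat scalerA mulVf // scale1r.
Qed.

(** A Lie ideal of [M] which [r] maps onto the local skew tensors. Computations are made here first
    and carried over to [M] by [centralizer]. *)
Definition M1 x := exists S, cl S x.
Lemma M1_M x : M1 x -> M x. Proof. by case=> S; apply: cl_M. Qed.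
Lemma M1P c x y : M1 x -> M1 y -> M1 (c *: x + y).
Proof.
move=> [S cx] [T cy]; exists (S ++ T); apply: clP.
  by apply: cl_sub cx => v /perp_cat[].
by apply: cl_sub cy => v /perp_cat[].
Qed.
Lemma M1_0 : M1 0. Proof. by exists [::]; apply: cl0. Qed.
Lemma M1D x y : M1 x -> M1 y -> M1 (x + y).
Proof. by move=> h h'; rewrite -[x]scale1r; apply: M1P. Qed.
Lemma M1Z c x : M1 x -> M1 (c *: x).
Proof. by move=> h; rewrite -[_ *: x]addr0; apply/M1P/M1_0. Qed.
Lemma M1N x : M1 x -> M1 (- x). Proof. by rewrite -scaleN1r; apply: M1Z. Qed.
Lemma M1_cm x y : M1 x -> M y -> M1 (cmV x y).
Proof.
move=> [S [s [-> hs]]] My.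
have -> : cmV (\sum_(p <- s) cmV p.1 p.2) y = \sum_(p <- s) cmV (cmV p.1 p.2) y.
  by rewrite {1}/cm (alg_suml algV) (alg_sumr algV) -sumrB.
rewrite big_seq; elim/big_ind: _ => [||p /hs[m1 m2 l1 l2]]; [exact: M1_0|exact: M1D|].
have [T hT] := loc_cm_any (r y) S.
have lT q : locB S q -> locB (S ++ T) (cmQ q (r y)).
  move=> /hT /locN; have -> : - cmQ (r y) q = cmQ q (r y) by rewrite /cm opprB.
  by apply: loc_sub => v /perp_cat[].
have lS q : locB S q -> locB (S ++ T) q by apply: loc_sub => v /perp_cat[].
have sy := M_sk My.
exists (S ++ T), [:: (cmV p.1 y, p.2); (p.1, cmV p.2 y)]; split.
  by rewrite !big_cons big_nil /= addr0 /cm; nca algV.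
move=> q; rewrite !inE => /orP[] /eqP-> /=; split; rewrite ?rL //;
  by [apply: M_cmr|apply: lS|apply: lT].
Qed.
Lemma M1_cmr x y : M1 x -> M y -> M1 (cmV y x).
Proof.
move=> h h'; have -> : cmV y x = - cmV x y by rewrite /cm opprB.
exact/M1N/M1_cm.
Qed.
Lemma M1_loc x : M1 x -> exists S, locB S (r x).
Proof. by move=> [S /cl_loc]; exists S. Qed.
Lemma M1_lift k : skQ k -> (exists S, locB S k) -> exists x, M1 x /\ r x = k.
Proof.
move=> s [S l]; have [|S' [x [_ cx rx _]]] := lift (v := 0) s l.
  by move=> t _; rewrite (B0r BP).
by exists x; split=> //; exists S'.
Qed.
Lemma M1X a b h : exists x, M1 x /\ r x = X a b h.
Proof.
apply: M1_lift; first exact: skX.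
exists [:: a; b]; apply: locX => v pv; split; apply: pv; by rewrite !inE eqxx ?orbT.
Qed.

Lemma cmX_far S q a b h : locB S q -> perp B S a -> perp B S b ->
  cmQ q (X a b h) = 0.
Proof.
move=> l pa pb; apply: (tm_inj TM) => u v.
rewrite ev_cmX ev0 (l a pa u).1 (l a pa v).2 (l b pb u).1 (l b pb v).2.
by rewrite !(alg0r algH) !scaler0 !subrr addr0.
Qed.

(** * Local derivations of the image are inner *)

Section Inner.
Variables (d : V -> Q) (S : seq U).
Hypothesis dP : forall c x y, M x -> M y -> d (c *: x + y) = c *: d x + d y.
Hypothesis dS : forall x, M x -> skQ (d x).
Hypothesis dL : forall x y, M x -> M y ->
  d (cmV x y) = cmQ (d x) (r y) + cmQ (r x) (d y).
Hypothesis dloc : forall x u v, M1 x -> perp B S u -> perp B S v ->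
  ev (d x) u v = 0.

Lemma dD x y : M x -> M y -> d (x + y) = d x + d y.
Proof. by move=> h h'; have := dP 1 h h'; rewrite !scale1r. Qed.
Lemma d0 : d 0 = 0.
Proof. by apply: (addrI (d 0)); rewrite -dD ?addr0 //; exact: M0. Qed.
Lemma dZ c x : M x -> d (c *: x) = c *: d x.
Proof. by move=> h; have := dP c h M0; rewrite d0 !addr0. Qed.
Lemma d_sum I (s : seq I) f : (forall i, M (f i)) ->
  d (\sum_(i <- s) f i) = \sum_(i <- s) d (f i).
Proof.
move=> h; elim: s => [|i s IH]; rewrite ?big_nil ?d0 // !big_cons dD ?IH //.
by elim/big_ind: _ => [|x y|]; [exact: M0|exact: MD|].
Qed.

Lemma d_ker_loc n : M1 n -> r n = 0 -> locB S (d n).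
Proof.
move=> hn rn; have Mn := M1_M hn.
apply: rigid1 => [|u v pu pv|a b u v pu pv]; [exact: dS|exact: dloc|].
have [m [Mm rm]] := rX a b oneH.
have -> : cmQ (d n) (X a b oneH) = d (cmV n m).
  by rewrite dL // rn rm [cmQ 0 _]/cm (alg0l algQ) (alg0r algQ) subrr addr0.
by apply: dloc => //; apply: M1_cm.
Qed.

(** Brackets with elements of [M] stay in the kernel of [r]. A first round makes all values of [d]
    on this kernel local; then [d n] is local with local brackets, hence zero. *)
Lemma d_ker n : M1 n -> r n = 0 -> d n = 0.
Proof.
move=> hn rn; have Mn := M1_M hn.
apply: (rigid2 (S := S)) => [|a b]; first exact: d_ker_loc.
have [m [Mm rm]] := rX a b oneH.
have e0 k : cmQ 0 k = 0 by rewrite /cm (alg0l algQ) (alg0r algQ) subrr.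
have -> : cmQ (d n) (X a b oneH) = d (cmV n m) by rewrite dL // rn rm e0 addr0.
by apply: d_ker_loc; [exact: M1_cm|rewrite rL // rn e0].
Qed.

Lemma d_det x y : M1 x -> M1 y -> r x = r y -> d x = d y.
Proof.
move=> hx hy e; have Mx := M1_M hx; have My := M1_M hy.
suff : d (-1 *: x + y) = 0.
  by rewrite dP // scaleN1r addrC => /subr0_eq.
by apply: d_ker; [exact: M1P|rewrite rP // e scaleN1r addNr].
Qed.

Lemma d_far_loc z a b h : M1 z -> r z = X a b h -> perp B S a -> perp B S b ->
  locB S (d z).
Proof.
move=> hz rz pa pb; have Mz := M1_M hz.
apply: rigid1 => [|u v pu pv|c e u v pu pv]; [exact: dS|exact: dloc|].
have [m [hm rm]] := M1X c e oneH; have Mm := M1_M hm.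
have -> : cmQ (d z) (X c e oneH) = d (cmV z m) + cmQ (d m) (X a b h).
  by rewrite dL // rz rm /cm; nca algQ.
rewrite evD dloc ?add0r //; last exact: M1_cm.
by rewrite ev_cmX !dloc // !(alg0r algH) !scaler0 !subrr addr0.
Qed.

(** By [X_perfect], twice the image of [z] is a combination of brackets of elements built on far
    vectors. There [d] is local, and local tensors commute with far rank-two elements, so the
    Leibniz rule gives zero. *)
Lemma d_far z a b h : M1 z -> r z = X a b h -> perp B S a -> perp B S b ->
  d z = 0.
Proof.
move=> hz rz pa pb; have Mz := M1_M hz.
have [[c c'] /= [pc pc' cc']] := fresh_pair BP infU (a :: b :: S).
have [ac /perp_cons[bc Sc]] := (perp_cons _ _ _ _).1 pc.
have [ac' /perp_cons[bc' Sc']] := (perp_cons _ _ _ _).1 pc'.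
have [m1 [h1 e1]] := M1X a c oneH; have [m2 [h2 e2]] := M1X c' b h.
have [m3 [h3 e3]] := M1X a c' oneH; have [m4 [h4 e4]] := M1X c b h.
have [N1 N2 N3 N4] := And4 (M1_M h1) (M1_M h2) (M1_M h3) (M1_M h4).
have kill x y p p' k e e' l : M1 x -> M1 y -> r x = X p p' k -> r y = X e e' l ->
    perp B S p -> perp B S p' -> perp B S e -> perp B S e' -> d (cmV x y) = 0.
  move=> hx hy ex ey *; rewrite dL ?ex ?ey; try exact: M1_M.
  rewrite (@cmX_far S) //; last exact: (d_far_loc hx ex).
  have -> : cmQ (X p p' k) (d y) = - cmQ (d y) (X p p' k) by rewrite /cm opprB.
  by rewrite (@cmX_far S) ?oppr0 ?addr0 //; exact: (d_far_loc hy ey).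
apply: half_eq => //; rewrite addr0 -dD //.
transitivity (d (eps *: cmV m3 m4 + cmV m1 m2)).
  apply: d_det.
  - exact: M1D.
  - by apply: M1P; apply: M1_cm.
  rewrite rD // rP ?rL // ?e1 ?e2 ?e3 ?e4 ?rz; last exact/M_cm/N2/M_sk.
    rewrite [RHS]addrC -X_perfect //; first by apply/perp_cons; split=> //;
      apply/perp_cons; split.
    by apply/perp_cons; split=> //; apply/perp_cons; split.
  exact/M_cm/N4/M_sk.
rewrite dP; [|exact/M_cm/N4/M_sk|exact/M_cm/N2/M_sk].
by rewrite (kill _ _ _ _ _ _ _ _ h3 h4 e3 e4) // (kill _ _ _ _ _ _ _ _ h1 h2 e1 e2)
  // scaler0 addr0.
Qed.

Lemma inner : exists k, [/\ skQ k, locB S k & forall m, M m -> d m = cmQ k (r m)].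
Proof.
have [[c c'] /= [pc pc' cc']] := fresh_pair BP infU S.
have [w /all_and2[w1 wr]] := choice (fun a => M1X a c oneH).
have Mw a : M (w a) by apply: M1_M.
have [st [st1 st2]] := dual_system BP S.
(* If [d] is the bracket with a local [k] then, [c] and [c'] being far, column [c'] of [d (w a)] is
   column [a] of [k]. This forces [k]; the dual system assembles the finitely many columns that
   matter. *)
pose k := \sum_(p <- st) d (w p.2) ## el c' p.1 oneH.
have kE u v : ev k u v = \sum_(p <- st) B p.1 v *: ev (d (w p.2)) u c'.
  by rewrite ev_sum; apply: eq_bigr => p _; rewrite (tm_mulel TM) mul1H.
have kr u v : perp B S v -> ev k u v = 0.
  move=> pv; rewrite kE big_seq big1 // => p pst.
  by rewrite (st1 _ pst _ pv) scale0r.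
have kl u v : perp B S u -> ev k u v = 0.
  move=> pu; rewrite kE big1 // => p _.
  by rewrite dloc // scaler0.
have kw a m u : M1 m -> r m = X a c oneH -> ev (d m) u c' = ev k u a.
  move=> hm rm; pose a' := a - \sum_(p <- st) B p.1 a *: p.2.
  have := M1X a' c oneH => -[z [hz rz]].
  have z0 : d z = 0 by apply: (d_far hz rz) => //; apply: st2.
  have hs : M1 (\sum_(p <- st) B p.1 a *: w p.2).
    elim/big_ind: _ => [||p _]; [exact: M1_0|exact: M1D|exact: M1Z].
  transitivity (ev (d (z + \sum_(p <- st) B p.1 a *: w p.2)) u c').
    congr (ev _ u c'); apply: d_det => //; first exact: M1D.
    rewrite rD; [|exact: M1_M|exact: M1_M].
    rewrite r_sum => [|p _]; last exact: MZ.
    rewrite rm rz -{1}[a](subrK (\sum_(p <- st) B p.1 a *: p.2)) XDl.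
    congr (_ + _); elim: (st) => [|p s IH].
      by rewrite !big_nil; apply: (tm_inj TM) => x y;
         rewrite ev_X (B0l BP) (B0r BP) ev0 mul0r !mulr0 subrr scale0r.
    by rewrite !big_cons XDl IH XZl rZ // wr.
  rewrite dD; [|exact: M1_M|exact: M1_M].
  rewrite z0 add0r d_sum => [|p]; last exact: MZ.
  rewrite ev_sum kE; apply: eq_bigr => p _.
  by rewrite dZ // evZ.
(* The bracket of [m] with a lift of [X b e] has a far image, so [d] kills it; hence [d m] commutes
   with [X b e], and one entry of this relation is the claim. *)
have pfar a m x b : M1 m -> r m = X a c oneH -> perp B S b -> B c b = 0 ->
    ev (d m) x b = 0.
  move=> hm rm pb cb; have Mm := M1_M hm.
  have [[e y] /= [pe py ey]] := fresh_pair BP infU (a :: x :: b :: c :: S).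
  have {pe} [ae /perp_cons[xe /perp_cons[be /perp_cons[ce pe]]]] := (perp_cons _ _
    _ _).1 pe.
  have {py} [ay /perp_cons[xy /perp_cons[By /perp_cons[cy py]]]] := (perp_cons _ _
    _ _).1 py.
  have [z [hz rz]] := M1X b e oneH; have Mz := M1_M hz.
  have z0 : d z = 0 by apply: (d_far hz rz).
  have [z' [hz' rz']] := M1X c e oneH; have Mz' := M1_M hz'.
  have z'0 : d z' = 0 by apply: (d_far hz' rz').
  have d0' : d (cmV m z) = 0.
    transitivity (d (- (eps * B a b) *: z')); last by rewrite dZ // z'0 scaler0.
    apply: d_det; [exact: M1_cm|exact: M1Z|].
    rewrite rL // rm rz cmXX cb ce ae !mulr0 !scale0r mul1H sub0r subrr addr0.
    by rewrite rZ // rz' scaleNr.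
  have := ev_cmX1 (d m) b e x y.
  have -> : cmQ (d m) (X b e oneH) = 0.
    by move: d0'; rewrite dL // z0 rz => <-; rewrite /cm (alg0l algQ) (alg0r algQ)
      subrr addr0.
  rewrite ev0 ey By (BC0 BP xe) (dloc hm pe py) mulr0 !scale0r scaler0 !subr0.
  by rewrite scale1r addr0.
(* [X a b h] differs from the bracket of [X a c] and [X c' b h] only by far elements, so [d m] is
   determined by [d (w a)]. *)
have dX a b h m x y : M1 m -> r m = X a b h -> perp B S b -> B c b = 0 ->
    ev (d m) x y = B b y *: mulH h (ev k x a)
                   - (eps * B b x) *: mulH h (ev k y a).
  move=> hm rm pb cb; have [z [hz rz]] := M1X c' b h; have Mz := M1_M hz.
  have z0 : d z = 0 by apply: (d_far hz rz).
  have [z1 [hz1 rz1]] := M1X c b h; have Mz1 := M1_M hz1.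
  have z10 : d z1 = 0 by apply: (d_far hz1 rz1).
  have [z2 [hz2 rz2]] := M1X c' c h; have Mz2 := M1_M hz2.
  have z20 : d z2 = 0 by apply: (d_far hz2 rz2).
  have -> : d m = cmQ (d (w a)) (X c' b h).
    transitivity (d (cmV (w a) z)); last first.
      by rewrite dL // z0 rz [cmQ _ 0]/cm (alg0l algQ) (alg0r algQ) subrr addr0.
    transitivity (d (eps * B a c' *: z1 + (eps * B a b *: z2 + cmV (w a) z))).
      apply: d_det => //.
        by apply: M1P => //; apply: M1P => //; apply: M1_cm.
      have Mc : M (cmV (w a) z) by apply/M_cm/Mz/M_sk.
      rewrite rP ?rP ?rL //; last exact: MP.
      rewrite rm rz1 rz2 wr rz cmXX cc' cb ![mulH h oneH]mulHC !mul1H.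
      rewrite scale1r scale0r sub0r; nca algQ.
    rewrite dP ?dP ?z10 ?z20 ?scaler0 ?add0r //; try apply: MP => //;
      exact/M_cm/Mz/M_sk.
  have Sw := dS (Mw a); have pf x' := pfar a (w a) x' b (w1 a) (wr a) pb cb.
  have kw' x' := kw a (w a) x' (w1 a) (wr a).
  rewrite ev_cmX (ev_skew b y Sw) (ev_skew c' y Sw) !kw' !pf.
  rewrite scaler0 oppr0 !(alg0r algH) !scaler0 !subr0.
  by rewrite (algNr algH) (algZr algH) scalerN scalerA [B b x * _]mulrC.
(* The bracket of lifts of [X u b0] and [X v b1], with fresh [b0] and [b1], has a far image and is
   killed by [d]. One entry of the Leibniz rule then compares [ev k u v] with [ev k v u]. *)
have sk_k : skQ k.
  apply: (tm_inj TM) => u v; rewrite (tm_star TM) evN.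
  have [b [v' [pb pv bv bb vv]]] := exists_chain BP infU (c :: u :: v :: S).
  have hb i : [/\ B c (b i) = 0, B u (b i) = 0, B v (b i) = 0 & perp B S (b i)].
    by have /perp_cons[? /perp_cons[? /perp_cons[]]] := pb i.
  have hv i : [/\ B c (v' i) = 0, B u (v' i) = 0, B v (v' i) = 0 & perp B S (v' i)].
    by have /perp_cons[? /perp_cons[? /perp_cons[]]] := pv i.
  have [m [hm rm]] := M1X u (b 0%N) oneH; have Mm := M1_M hm.
  have [n [hn rn]] := M1X v (b 1%N) oneH; have Mn := M1_M hn.
  have [z [hz rz]] := M1X (b 0%N) (b 1%N) oneH; have Mz := M1_M hz.
  have [cb0 ub0 vb0 Sb0] := hb 0%N; have [cb1 ub1 vb1 Sb1] := hb 1%N.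
  have [cv0 uv0 vv0 Sv0] := hv 0%N; have [cv1 uv1 vv1 Sv1] := hv 1%N.
  have b01 : B (b 0%N) (b 1%N) = 0 by apply: bb.
  have b0v1 : B (b 0%N) (v' 1%N) = 0 by rewrite bv.
  have b1v0 : B (b 1%N) (v' 0%N) = 0 by rewrite bv.
  have b0v0 : B (b 0%N) (v' 0%N) = 1 by rewrite bv.
  have b1v1 : B (b 1%N) (v' 1%N) = 1 by rewrite bv.
  have z0 : d z = 0 by apply: (d_far hz rz).
  have e0 : d (cmV m n) = 0.
    transitivity (d (- (eps * B u v) *: z)); last by rewrite dZ // z0 scaler0.
    apply: d_det; [exact: M1_cm|exact: M1Z|].
    rewrite rL // rm rn cmXX ub1 b01 (BC0 BP vb0) !mulr0 !scale0r mul1H sub0r subrr addr0.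
    by rewrite rZ // rz scaleNr.
  have e1 : ev (cmQ (d m) (X v (b 1%N) oneH)) (v' 0%N) (v' 1%N)
            = ev (cmQ (d n) (X u (b 0%N) oneH)) (v' 0%N) (v' 1%N).
    congr (ev _ _ _); apply/subr0_eq; rewrite -[RHS]e0 dL // rm rn /cm; nca algQ.
  move: e1; rewrite !ev_cmX1 b1v1 b1v0 b0v0 b0v1 vv1 vv0 uv0 uv1 !mulr0 !scale0r.
  rewrite !subr0 !addr0 add0r !scale1r.
  rewrite (dX u (b 0%N) oneH m) // (dX v (b 1%N) oneH n) // !mul1H.
  rewrite (BC0 BP vb0) (BC0 BP ub1) b0v0 b1v1 mulr1 mulr0 !scale0r sub0r subr0 scale1r.
  by move=> <-; rewrite opprK.
have lk : locB S k by move=> v pv u; split; [apply: kr|apply: kl].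
exists k; split=> //.
have in1 a b h m : M1 m -> r m = X a b h -> perp B S b -> B c b = 0 ->
    d m = cmQ k (r m).
  move=> hm rm pb cb; apply: (tm_inj TM) => x y; rewrite (dX a b h) // rm ev_cmX.
  rewrite !(kr _ b) // !(kl b) // (ev_skew a y sk_k) (algNr algH) (algZr algH).
  by rewrite !(alg0r algH) !scaler0 !subr0 scalerN scalerA [B b x * _]mulrC.
have in2 x y : M x -> M y -> d x = cmQ k (r x) -> d y = cmQ k (r y) ->
    d (cmV x y) = cmQ k (r (cmV x y)).
  by move=> Mx My ex ey; rewrite dL // ex ey rL // /cm; nca algQ.
have inP l x y : M x -> M y -> d x = cmQ k (r x) -> d y = cmQ k (r y) ->
    d (l *: x + y) = cmQ k (r (l *: x + y)).
  move=> Mx My ex ey; rewrite dP // ex ey rP // /cm (algDl algQ) (algDr algQ).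
  by rewrite (algZl algQ) (algZr algQ) scalerBr opprD addrACA.
have in3 a b h m : M1 m -> r m = X a b h -> d m = cmQ k (r m).
  move=> hm rm; have Mm := M1_M hm.
  have [[e e'] /= [pe pe' ee']] := fresh_pair BP infU (a :: b :: c :: S).
  have [ae /perp_cons[be /perp_cons[ce Se]]] := (perp_cons _ _ _ _).1 pe.
  have [ae' /perp_cons[be' /perp_cons[ce' Se']]] := (perp_cons _ _ _ _).1 pe'.
  have [m1 [h1 e1]] := M1X a e oneH; have [m2 [h2 e2]] := M1X b e' h.
  have [m3 [h3 e3]] := M1X a e' oneH; have [m4 [h4 e4]] := M1X b e h.
  have [N1 N2 N3 N4] := And4 (M1_M h1) (M1_M h2) (M1_M h3) (M1_M h4).
  pose n := (- eps) *: cmV m1 m2 + (- (eps * eps)) *: cmV m3 m4.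
  have C1 : M1 (cmV m1 m2) by apply: M1_cm.
  have C2 : M1 (cmV m3 m4) by apply: M1_cm.
  have D1 : M (cmV m1 m2) by apply: M1_M.
  have D2 : M (cmV m3 m4) by apply: M1_M.
  have en : r m + r m = r n.
    rewrite /n rP // ?rZ // ?rL // ?e1 ?e2 ?e3 ?e4 ?rm; last exact: MZ.
    have pabe : perp B [:: a; b] e by do 2![apply/perp_cons; split=> //].
    have pabe' : perp B [:: a; b] e' by do 2![apply/perp_cons; split=> //].
    rewrite (X_perfect h ee' pabe pabe').
    rewrite (XC b e' h) (XC b e h) !(cmNr algQ) !(cmZr algQ).
    by rewrite !scaleNr scalerN scalerA.
  have dn : d n = cmQ k (r n).
    have i1 : d (cmV m1 m2) = cmQ k (r (cmV m1 m2)).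
      by apply: (in2) => //; [apply: (in1 a e oneH)|apply: (in1 b e' h)].
    have i2 : d (cmV m3 m4) = cmQ k (r (cmV m3 m4)).
      by apply: (in2) => //; [apply: (in1 a e' oneH)|apply: (in1 b e h)].
    apply: (inP) => //; first exact: MZ.
    by rewrite -[_ *: cmV _ _]addr0; apply: (inP) => //; [exact: M0|rewrite d0 r0
      (cm0r algQ)].
  have e5 : d m + d m = cmQ k (r m) + cmQ k (r m).
    rewrite -dD // -(cmDr algQ) en -dn.
    by apply: d_det; [exact: M1D|exact/M1P/M1Z|rewrite rD].
  exact: (half_eq e5).
have in4 m : M1 m -> d m = cmQ k (r m).
  move=> hm; have [T lT] := M1_loc hm; have Mm := M1_M hm.
  have [s [rs _]] := loc_decomp (rS Mm) lT.
  have [x [hx rx ex]] : exists x, [/\ M1 x, r x = r m & d x = cmQ k (r x)].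
    rewrite rs; elim: (s) => [|p t [x [hx rx ex]]].
      exists 0; rewrite big_nil r0 d0 /cm (alg0l algQ) (alg0r algQ) subrr.
      by split=> //; apply: M1_0.
    have [y [hy ry]] := M1X p.1.1 p.1.2 p.2.
    have [Mx My] := conj (M1_M hx) (M1_M hy).
    exists (1 *: y + x); split; [exact: M1P|by rewrite rP // scale1r big_cons ry rx|].
    by apply: (inP) => //; apply: in3 ry.
  by rewrite (d_det hm hx) // ex rx.
(* Outside [M1] the equality is tested by brackets with rank-two elements, which bring [m] back into
   [M1]. *)
move=> m Mm; apply/subr0_eq/centralizer.
  by apply: skQD; [exact: dS|apply/skQN/skQ_cm/rS].
move=> a b; have [x [hx rx]] := M1X a b oneH; have Mx := M1_M hx.
have := in4 _ (M1_cmr hx Mm); rewrite dL // rL // (in4 x) // rx => /eqP.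
rewrite -subr_eq0 => /eqP <-; rewrite /cm; nca algQ.
Qed.

End Inner.

Local Notation T3V := (T3 mulV).
Local Notation T3Q := (T3 mulQ).

(** * Triple products *)

Lemma inner_gd t S : sk t ->
  (forall x u v, M1 x -> perp B S u -> perp B S v -> ev (r (cmV t x)) u v = 0) ->
  exists k, gd t k /\ locB S k.
Proof.
move=> st h; have Mt x : M x -> M (cmV t x) by apply: M_cm.
have [||||k [s l e]] := @inner (fun x => r (cmV t x)) S.
- by move=> c x y Mx My; rewrite (cmDr algV) (cmZr algV) rP //; apply: Mt.
- by move=> x Mx; apply/rS/Mt.
- move=> x y Mx My; rewrite -!rL //; try exact: Mt.
  rewrite -rD; [|by apply/M_cm/My/sk_cm/M_sk|by apply: M_cm; [exact: M_sk|exact: Mt]].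
  by congr r; rewrite /cm; nca algV.
- by move=> x u v; apply: h.
by exists k; split=> //; split.
Qed.

(** These arise as the difference between an element and a lift of the tensor through which it acts;
    they need not belong to [M], where alone [r] is controlled. *)
Definition K0 n := gd n 0.

(* In the cyclic identity for [T3 a b c] and [x], a summand [cmV t a] is harmless
   if, up to an element acting as zero on [M], its image vanishes on the
   orthogonal complement of [S]. *)
Definition term S t a := exists e z, [/\ cmV t a = e + z, M e,
  forall u v, perp B S u -> perp B S v -> ev (r e) u v = 0 & gd z 0].

Lemma gd0 : gd 0 0.
Proof.
split; [exact: sk0|exact: skQ0|move=> m Mm].
by rewrite (cm0l algV) (cm0l algQ) r0.
Qed.
Lemma gdD x y k l : gd x k -> gd y l -> gd (x + y) (k + l).
Proof. by move=> h h'; have := gdP 1 h h'; rewrite !scale1r. Qed.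
Lemma gdZ c x k : gd x k -> gd (c *: x) (c *: k).
Proof. by move=> h; have := gdP c h gd0; rewrite !addr0. Qed.
Lemma gdN x k : gd x k -> gd (- x) (- k).
Proof. by rewrite -!scaleN1r; apply: gdZ. Qed.
Lemma r_gd0 x : M x -> gd x 0 -> r x = 0.
Proof. by move=> /gd_M; apply: gd_uniq. Qed.

(** After the Leibniz rule each commutator in the image has one factor local at [S], so its entries
    between two vectors orthogonal to [S] vanish, whatever the other factor is. *)
Lemma term_cl S t a : sk t -> cl S a -> term S t a.
Proof.
move=> st [s [-> hs]]; exists (cmV t (\sum_(p <- s) cmV p.1 p.2)), 0.
have Ma p : p \in s -> M (cmV p.1 p.2) by move=> /hs[m1 m2 _ _]; exact/M_cm/m2/M_sk.
rewrite addr0; split=> // [||]; last exact: gd0.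
  by apply: M_cm => //; rewrite big_seq; elim/big_ind: _ => //; [exact: M0|exact: MD].
move=> u v pu pv.
have -> : cmV t (\sum_(p <- s) cmV p.1 p.2) = \sum_(p <- s) cmV t (cmV p.1 p.2).
  by rewrite {1}/cm (alg_suml algV) (alg_sumr algV) -sumrB.
rewrite big_seq r_sum => [|p /Ma]; last exact: M_cm.
rewrite ev_sum big1 // => p /hs[m1 m2 l1 l2].
have -> : cmV t (cmV p.1 p.2) = cmV (cmV t p.1) p.2 + cmV p.1 (cmV t p.2).
  by rewrite /cm; nca algV.
have [n1 n2] := (M_cm st m1, M_cm st m2).
rewrite rD; [|exact/M_cm/m2/M_sk|exact/M_cm/n2/M_sk].
rewrite (rL n1 m2) (rL m1 n2) /cm !evD !evN (loc_mulr _ _ l2 pv) (loc_mull _ _ l2 pu).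
by rewrite (loc_mulr _ _ l1 pv) (loc_mull _ _ l1 pu) !subrr addr0.
Qed.

Lemma term_K0 S t k a : gd t k -> K0 a -> term S t a.
Proof.
move=> gt ga; exists 0, (cmV t a); rewrite add0r; split=> //; first exact: M0.
  by move=> u v _ _; rewrite r0 ev0.
by rewrite -(cm0r algQ k); apply: gd_cm.
Qed.

Lemma term_M S t k a : gd t k -> M a ->
  (forall u v, perp B S u -> perp B S v -> ev (cmQ k (r a)) u v = 0) -> term S t a.
Proof.
move=> [st sk h] Ma l; exists (cmV t a), 0; rewrite addr0; split=> //.
- exact: M_cm.
- by move=> u v pu pv; rewrite h // l.
- exact: gd0.
Qed.

(** The cyclic identity expresses the bracket of the triad with [x] by the three terms. The
    remainders [z1], [z2], [z3] need not lie in [M] separately; their sum does, as a difference of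
    elements of [M], and since it acts as zero its image is zero. *)
Lemma T3_inner S a b c : sk a -> sk b -> sk c ->
  (forall x, M1 x ->
     [/\ term S (T3V b c x) a, term S (T3V c x a) b & term S (T3V x a b) c]) ->
  exists k, gd (T3V a b c) k /\ locB S k.
Proof.
move=> sa sb sc h; apply: inner_gd => [|x u v hx pu pv]; first exact: sk_T3.
have Mx := M1_M hx.
have [[e1 [z1 [h1 Me1 l1 g1]]] [e2 [z2 [h2 Me2 l2 g2]]] [e3 [z3 [h3 Me3 l3 g3]]]]
  := h _ hx.
have e : cmV (T3V a b c) x = - (e1 + e2 + e3) - (z1 + z2 + z3).
  transitivity (- (cmV (T3V b c x) a + cmV (T3V c x a) b + cmV (T3V x a b) c)).
    by rewrite /cm /T3; nca algV.
  by rewrite h1 h2 h3; nca algV.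
have Me : M (- (e1 + e2 + e3)) by do 3?[apply: MN || apply: MD].
have MT : M (cmV (T3V a b c) x) by apply: M_cm => //; apply: sk_T3.
have Mz : M (- (z1 + z2 + z3)).
  have -> : - (z1 + z2 + z3) = cmV (T3V a b c) x - - (e1 + e2 + e3).
    by rewrite e; nca algV.
  exact/MD/MN.
have rz : r (- (z1 + z2 + z3)) = 0.
  apply: r_gd0 => //; rewrite -oppr0; apply: gdN.
  by rewrite -[0]addr0; apply: gdD => //; rewrite -[0]addr0; apply: gdD.
rewrite e rD // rz addr0 rN; last by do 2?apply: MD.
by rewrite !rD //; [rewrite evN !evD l1 ?l2 ?l3 // !addr0 oppr0|exact: MD].
Qed.

Definition Lt S a := cl S a \/ K0 a.
Lemma cl_sk S a : cl S a -> sk a. Proof. by move=> /cl_M/M_sk. Qed.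

Lemma T3_letters S a b c :
  cl S a \/ K0 a /\ (forall x, M1 x -> exists k, gd (T3V b c x) k) ->
  cl S b \/ K0 b /\ (forall x, M1 x -> exists k, gd (T3V c x a) k) ->
  cl S c \/ K0 c /\ (forall x, M1 x -> exists k, gd (T3V x a b) k) ->
  exists k, gd (T3V a b c) k /\ locB S k.
Proof.
move=> ha hb hc.
have sa : sk a by case: ha => [/cl_sk|[[]]].
have sb : sk b by case: hb => [/cl_sk|[[]]].
have sc : sk c by case: hc => [/cl_sk|[[]]].
apply: T3_inner => // x hx; have sx := M_sk (M1_M hx); split.
- case: ha => [ca|[na /(_ x hx) [k gk]]]; last exact: term_K0 gk na.
  by apply: term_cl => //; apply: sk_T3.
- case: hb => [ca|[na /(_ x hx) [k gk]]]; last exact: term_K0 gk na.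
  by apply: term_cl => //; apply: sk_T3.
- case: hc => [ca|[na /(_ x hx) [k gk]]]; last exact: term_K0 gk na.
  by apply: term_cl => //; apply: sk_T3.
Qed.

(** Induction on the number of letters in [K0]: the term of the cyclic identity belonging to such a
    letter involves a triad where it is replaced by an element of [M1]. The statements [G1] and [G2]
    run through the possible positions. *)
Lemma T3_Lt S a b c : Lt S a -> Lt S b -> Lt S c ->
  exists k, gd (T3V a b c) k /\ locB S k.
Proof.
have wk x y z T : (exists k, gd (T3V x y z) k /\ locB T k) ->
    exists k, gd (T3V x y z) k by move=> [k [? _]]; exists k.
have cc T x y : M1 x -> cl T y -> exists T', cl T' x /\ cl T' y.
  move=> [S' cx] cy; exists (S' ++ T); split.
    by apply: cl_sub cx => v /perp_cat[].
  by apply: cl_sub cy => v /perp_cat[].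
have G0 T x y z : cl T x -> cl T y -> cl T z -> exists k, gd (T3V x y z) k /\ locB T k.
  by move=> cx cy cz; apply: T3_letters; left.
have G0' T x y z : M1 x -> cl T y -> cl T z -> [/\ exists k, gd (T3V x y z) k,
    exists k, gd (T3V y x z) k & exists k, gd (T3V y z x) k].
  move=> [T' cx] cy cz; pose T2 := T' ++ T.
  have {}cx : cl T2 x by apply: cl_sub cx => v /perp_cat[].
  have {}cy : cl T2 y by apply: cl_sub cy => v /perp_cat[].
  have {}cz : cl T2 z by apply: cl_sub cz => v /perp_cat[].
  by split; apply: (wk _ _ _ T2); apply: G0.
have G1 T n y z : K0 n -> cl T y -> cl T z -> [/\ exists k, gd (T3V n y z) k /\ locB T k,
    exists k, gd (T3V y n z) k /\ locB T k & exists k, gd (T3V y z n) k /\ locB T k].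
  move=> kn cy cz; split; apply: T3_letters; try by left.
  - by right; split=> // x /G0'/(_ cy cz)[].
  - by right; split=> // x /G0'/(_ cz cy)[].
  - by right; split=> // x /G0'/(_ cy cz)[].
have G1' T n x y : K0 n -> M1 x -> cl T y ->
    [/\ exists k, gd (T3V n x y) k, exists k, gd (T3V n y x) k
      & exists k, gd (T3V x n y) k] /\
    [/\ exists k, gd (T3V y n x) k, exists k, gd (T3V x y n) k
      & exists k, gd (T3V y x n) k].
  move=> kn hx /(cc _ _ _ hx) [T' [cx cy]].
  have [h1 h2 h3] := G1 _ _ _ _ kn cx cy; have [h4 h5 h6] := G1 _ _ _ _ kn cy cx.
  by do 2!split; apply: wk; eassumption.
have G2 T n m z : K0 n -> K0 m -> cl T z -> [/\ exists k, gd (T3V n m z) k /\ locB T k,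
    exists k, gd (T3V n z m) k /\ locB T k & exists k, gd (T3V z n m) k /\ locB T k].
  move=> kn km cz; split; apply: T3_letters; try (by left);
    right; split=> // x hx.
  - by have [[? ? ?] [? ? ?]] := G1' _ _ _ _ km hx cz.
  - by have [[? ? ?] [? ? ?]] := G1' _ _ _ _ kn hx cz.
  - by have [[? ? ?] [? ? ?]] := G1' _ _ _ _ km hx cz.
  - by have [[? ? ?] [? ? ?]] := G1' _ _ _ _ kn hx cz.
  - by have [[? ? ?] [? ? ?]] := G1' _ _ _ _ km hx cz.
  - by have [[? ? ?] [? ? ?]] := G1' _ _ _ _ kn hx cz.
have G2' n m x : K0 n -> K0 m -> M1 x -> [/\ exists k, gd (T3V n m x) k,
    exists k, gd (T3V n x m) k & exists k, gd (T3V x n m) k].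
  move=> kn km [T' cx]; have [h1 h2 h3] := G2 _ _ _ _ kn km cx.
  by split; apply: wk; eassumption.
move=> [ca|ka] [cb|kb] [cc'|kc].
- exact: G0.
- by have [] := G1 _ _ _ _ kc ca cb.
- by have [] := G1 _ _ _ _ kb ca cc'.
- by have [] := G2 _ _ _ _ kb kc ca.
- by have [] := G1 _ _ _ _ ka cb cc'.
- by have [] := G2 _ _ _ _ ka kc cb.
- by have [] := G2 _ _ _ _ ka kb cc'.
apply: T3_letters; right; split=> // x hx.
- by have [] := G2' _ _ _ kb kc hx.
- by have [] := G2' _ _ _ kc ka hx.
- by have [] := G2' _ _ _ ka kb hx.
Qed.

(** * Elements acting through local tensors, and the defect on triads *)

Definition kf x k := gd x k /\ exists S, locB S k.

Lemma kf_split x k S v : gd x k -> locB S k -> perp B S v ->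
  exists S' y n, [/\ x = y + n, cl S' y, K0 n, perp B S' v
                   & forall u, perp B S' u -> perp B S u].
Proof.
move=> gx lk pv; have sq : skQ k by case: gx.
have [S' [y [pv' cy ry S'S]]] := lift sq lk pv.
exists S', y, (x - y); split=> //; first by rewrite addrC subrK.
rewrite /K0 -(subrr k); apply: gdD => //; apply: gdN; rewrite -ry.
exact/gd_M/(cl_M cy).
Qed.

Lemma kf_T3 x y z k l m S : gd x k -> gd y l -> gd z m ->
  locB S k -> locB S l -> locB S m -> exists q, gd (T3V x y z) q /\ locB S q.
Proof.
move=> gx gy gz lk ll lm.
have main v : perp B S v -> exists q S', [/\ gd (T3V x y z) q, locB S' q & perp B S' v].
  move=> pv.
  have [S1 [x1 [x2 [ex c1 k1 p1 _]]]] := kf_split gx lk pv.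
  have [S2 [y1 [y2 [ey c2 k2 p2 _]]]] := kf_split gy ll pv.
  have [S3 [z1 [z2 [ez c3 k3 p3 _]]]] := kf_split gz lm pv.
  pose S' := S1 ++ S2 ++ S3.
  have pS' : perp B S' v by apply/perp_cat; split=> //; apply/perp_cat.
  have lx1 : Lt S' x1 by left; apply: cl_sub c1 => u /perp_cat[].
  have ly1 : Lt S' y1 by left; apply: cl_sub c2 => u /perp_cat[_ /perp_cat[]].
  have lz1 : Lt S' z1 by left; apply: cl_sub c3 => u /perp_cat[_ /perp_cat[]].
  have [lx2 ly2 lz2] : [/\ Lt S' x2, Lt S' y2 & Lt S' z2] by split; right.
  have [q1 [g1 l1]] := T3_Lt lx1 ly1 lz1; have [q2 [g2 l2]] := T3_Lt lx1 ly1 lz2.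
  have [q3 [g3 l3]] := T3_Lt lx1 ly2 lz1; have [q4 [g4 l4]] := T3_Lt lx1 ly2 lz2.
  have [q5 [g5 l5]] := T3_Lt lx2 ly1 lz1; have [q6 [g6 l6]] := T3_Lt lx2 ly1 lz2.
  have [q7 [g7 l7]] := T3_Lt lx2 ly2 lz1; have [q8 [g8 l8]] := T3_Lt lx2 ly2 lz2.
  exists (q1 + q2 + q3 + q4 + q5 + q6 + q7 + q8), S'; split=> //; last first.
    by do 7?[apply: locD => //].
  have -> : T3V x y z = T3V x1 y1 z1 + T3V x1 y1 z2 + T3V x1 y2 z1 + T3V x1 y2 z2
    + T3V x2 y1 z1 + T3V x2 y1 z2 + T3V x2 y2 z1 + T3V x2 y2 z2.
    by rewrite ex ey ez /T3; nca algV.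
  by do 7?[apply: gdD => //].
(* The set [S'] depends on [v], but the acting tensor does not, so it vanishes at every [v]
   orthogonal to [S]. *)
have [|q [_ [gq _ _]]] := main 0; first by move=> s _; rewrite (B0r BP).
exists q; split=> // v /main [q' [S' [gq' lq' pv]]].
by rewrite (gd_uniq gq gq'); apply: lq'.
Qed.

Lemma kfP c x y k l : kf x k -> kf y l -> kf (c *: x + y) (c *: k + l).
Proof.
move=> [gx [S lx]] [gy [T ly]]; split; first exact: gdP.
exists (S ++ T); apply: locD; first apply: locZ.
  by apply: loc_sub lx => v /perp_cat[].
by apply: loc_sub ly => v /perp_cat[].
Qed.
Lemma kfD x y k l : kf x k -> kf y l -> kf (x + y) (k + l).
Proof. by move=> h h'; have := kfP 1 h h'; rewrite !scale1r. Qed.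
Lemma kf0 : kf 0 0.
Proof. by split; [exact: gd0|exists [::]; exact: loc0]. Qed.
Lemma kfZ c x k : kf x k -> kf (c *: x) (c *: k).
Proof. by move=> h; have := kfP c h kf0; rewrite !addr0. Qed.
Lemma kfN x k : kf x k -> kf (- x) (- k).
Proof. by rewrite -!scaleN1r; apply: kfZ. Qed.
Lemma kf_cm x y k l : kf x k -> kf y l -> kf (cmV x y) (cmQ k l).
Proof.
move=> [gx [S lx]] [gy [T ly]]; split; first exact: gd_cm.
exists (S ++ T); apply: loc_cm.
  by apply: loc_sub lx => v /perp_cat[].
by apply: loc_sub ly => v /perp_cat[].
Qed.
Lemma kf_uniq x k k' : kf x k -> kf x k' -> k = k'.
Proof. by move=> [h _] [h' _]; apply: gd_uniq h'. Qed.

Definition vl (x : V) : Q :=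
  if pselect (exists k, gd x k) is left h then projT1 (cid h) else 0.
Definition Kf x := kf x (vl x).

Lemma vl_gd x k : gd x k -> vl x = k.
Proof.
move=> g; rewrite /vl; case: pselect => [h|[]]; last by exists k.
by case: cid => k' /= g'; apply: gd_uniq g.
Qed.
Lemma vl_kf x k : kf x k -> vl x = k. Proof. by case=> /vl_gd. Qed.
Lemma kf_Kf x k : kf x k -> Kf x. Proof. by move=> h; rewrite /Kf (vl_kf h). Qed.
Lemma Kf_sk x : Kf x -> sk x. Proof. by case=> -[]. Qed.
Lemma vl_sk x : Kf x -> skQ (vl x). Proof. by case=> -[]. Qed.
Lemma KfD x y : Kf x -> Kf y -> Kf (x + y).
Proof. by move=> h h'; apply: kf_Kf (kfD h h'). Qed.
Lemma KfZ c x : Kf x -> Kf (c *: x).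
Proof. by move=> h; apply: kf_Kf (kfZ c h). Qed.
Lemma KfN x : Kf x -> Kf (- x).
Proof. by move=> h; apply: kf_Kf (kfN h). Qed.
Lemma Kf_cm x y : Kf x -> Kf y -> Kf (cmV x y).
Proof. by move=> h h'; apply: kf_Kf (kf_cm h h'). Qed.
Lemma vlD x y : Kf x -> Kf y -> vl (x + y) = vl x + vl y.
Proof. by move=> h h'; apply: vl_kf (kfD h h'). Qed.
Lemma vlN x : Kf x -> vl (- x) = - vl x.
Proof. by move=> h; apply: vl_kf (kfN h). Qed.
Lemma vl_cm x y : Kf x -> Kf y -> vl (cmV x y) = cmQ (vl x) (vl y).
Proof. by move=> h h'; apply: vl_kf (kf_cm h h'). Qed.
Lemma Kf_T3_loc S x y z : Kf x -> Kf y -> Kf z ->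
  locB S (vl x) -> locB S (vl y) -> locB S (vl z) ->
  Kf (T3V x y z) /\ locB S (vl (T3V x y z)).
Proof.
move=> [gx _] [gy _] [gz _] lx ly lz; have [q [gq lq]] := kf_T3 gx gy gz lx ly lz.
by have k : kf (T3V x y z) q by [split=> //; exists S]; rewrite /Kf (vl_kf k).
Qed.
Lemma Kf_T3 x y z : Kf x -> Kf y -> Kf z -> Kf (T3V x y z).
Proof.
move=> hx hy hz; have [[_ [S1 l1]] [_ [S2 l2]] [_ [S3 l3]]] := And3 hx hy hz.
have [] // := @Kf_T3_loc (S1 ++ S2 ++ S3) x y z hx hy hz.
- by apply: loc_sub l1 => v /perp_cat[].
- by apply: loc_sub l2 => v /perp_cat[_ /perp_cat[]].
- by apply: loc_sub l3 => v /perp_cat[_ /perp_cat[]].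
Qed.

(* The defect of [vl] on triple products; it is symmetric in [x], [y], [z]. *)
Definition D x y z := vl (T3V x y z) - T3Q (vl x) (vl y) (vl z).

(** Exchanging two neighbouring letters changes the triad by a double commutator, and [vl] respects
    commutators. *)
Lemma DC1 x y z : Kf x -> Kf y -> Kf z -> D y x z = D x y z.
Proof.
move=> hx hy hz; rewrite /D.
have -> : T3V y x z = T3V x y z + cmV (cmV y x) z by rewrite /cm /T3; nca algV.
rewrite vlD ?vl_cm //; try by do ?[apply: Kf_T3 || apply: Kf_cm].
by rewrite /cm /T3; nca algQ.
Qed.
Lemma D321 x y z : D z y x = D x y z.
Proof. by rewrite /D /T3 (addrC (_ ** z)) (addrC (_ ## vl z)). Qed.
Lemma DC2 x y z : Kf x -> Kf y -> Kf z -> D x z y = D x y z.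
Proof. by move=> hx hy hz; rewrite -D321 DC1 // D321. Qed.

Lemma D_loc S x y z : Kf x -> Kf y -> Kf z ->
  locB S (vl x) -> locB S (vl y) -> locB S (vl z) -> locB S (D x y z).
Proof.
move=> hx hy hz lx ly lz; apply: locD; first by case: (Kf_T3_loc hx hy hz lx ly lz).
by apply/locN/loc_T3.
Qed.
Lemma D_skew x y z : Kf x -> Kf y -> Kf z -> skQ (D x y z).
Proof.
move=> hx hy hz; apply: skQD; first exact/vl_sk/Kf_T3.
by apply/skQN/skQ_T3; apply: vl_sk.
Qed.

Lemma D_cyc x y z w : Kf x -> Kf y -> Kf z -> Kf w ->
  cmQ (D x y z) (vl w) + (cmQ (D y z w) (vl x) + (cmQ (D z x w) (vl y)
    + cmQ (D x y w) (vl z))) = 0.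
Proof.
move=> hx hy hz hw.
rewrite (@DC2 z w x) // (@DC2 x w y) // (@DC1 w x y) //.
have e : cmV (T3V x y z) w + (cmV (T3V y z w) x + (cmV (T3V z w x) y + cmV (T3V w x
  y) z)) = 0.
  by apply/subr0_eq; rewrite subr0 -(subrr x) /cm /T3; nca algV.
have [h1 h2 h3 h4] : [/\ Kf (T3V x y z), Kf (T3V y z w), Kf (T3V z w x) & Kf (T3V w x y)].
  by split; apply: Kf_T3.
have [k1 k2 k3 k4] := And4 (Kf_cm h1 hw) (Kf_cm h2 hx) (Kf_cm h3 hy) (Kf_cm h4 hz).
have := congr1 vl e; rewrite (vlD k1 (KfD k2 (KfD k3 k4))) (vlD k2 (KfD k3 k4))
  (vlD k3 k4).
rewrite (vl_cm h1 hw) (vl_cm h2 hx) (vl_cm h3 hy) (vl_cm h4 hz) (vl_kf kf0) => e'.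
by rewrite -[RHS]e' /D /cm /T3; nca algQ.
Qed.

(** [D_cyc] read in column [v]: products ending in a factor local at [S] vanish there, and the
    bracket with [X a b oneH] turns column [v] into column [a] of the defect. *)
Lemma peel S x y z w a b u v : Kf x -> Kf y -> Kf z -> Kf w ->
  locB S (vl x) -> locB S (vl y) -> locB S (vl z) -> vl w = X a b oneH ->
  perp B S v -> B a v = 0 -> B b v = 1 ->
  ev (D x y z) u a = ev (vl x ## D y z w) u v + (ev (vl y ## D z x w) u v
                      + ev (vl z ## D x y w) u v).
Proof.
move=> hx hy hz hw lx ly lz ew pv av bv.
have lD := D_loc hx hy hz lx ly lz.
have := congr1 (fun q => ev q u v) (D_cyc hx hy hz hw).
rewrite ev0 ew evD ev_cmX1 av bv scale1r !(lD v pv _).1 mulr0 scale0r !scaler0.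
rewrite subr0 subrr addr0 /cm !evD !evN.
rewrite (loc_mulr _ _ lx pv) (loc_mulr _ _ ly pv) (loc_mulr _ _ lz pv) !sub0r.
by rewrite -!opprD => /eqP; rewrite subr_eq0 => /eqP.
Qed.

(* Consecutive letters of a chain: [sg x i j] and [sg y j k] give
   [sg (cmV x y) i k]. *)
Definition sg b v x (i j : nat) := Kf x /\ vl x = X (v i) (b j) oneH.

(** The corresponding defect on tetrads, in which the degree-five identities are short; [tw4_double]
    reduces it to [D]. *)
Definition W x y z t := vl (tw4 mulV x y z t) - tw4 mulQ (vl x) (vl y) (vl z) (vl t).

Lemma tw4_double (X' : lmodType F) (mul : X' -> X' -> X') (alg : assoc_algebra mul)
  x y z t :
  tw4 mul x y z t + tw4 mul x y z t =
  T3 mul (cm mul x y) z t + T3 mul y (cm mul x z) t + T3 mul y z (cm mul x t)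
  + T3 mul (cm mul y z) t x + T3 mul z (cm mul y t) x + T3 mul (cm mul z t) y x.
Proof. by rewrite /tw4 /T3 /cm; nca alg. Qed.

Lemma Kf_tw4 x y z t : Kf x -> Kf y -> Kf z -> Kf t -> Kf (tw4 mulV x y z t).
Proof.
move=> hx hy hz ht; set w := tw4 _ _ _ _ _.
have -> : w = 2%:R^-1 *: (w + w).
  by rewrite -mulr2n -scaler_nat scalerA mulVf // scale1r.
rewrite tw4_double //; apply: KfZ.
have [k1 k2 k3 k4] := And4 (Kf_cm hx hy) (Kf_cm hx hz) (Kf_cm hx ht) (Kf_cm hy hz).
have [k5 k6] := conj (Kf_cm hy ht) (Kf_cm hz ht).
have [t1 t2 t3 t4] := And4 (Kf_T3 k1 hz ht) (Kf_T3 hy k2 ht) (Kf_T3 hy hz k3)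
  (Kf_T3 k4 ht hx).
exact: KfD (KfD (KfD (KfD (KfD t1 t2) t3) t4) (Kf_T3 hz k5 hx)) (Kf_T3 k6 hy hx).
Qed.

Lemma W_double x y z t : Kf x -> Kf y -> Kf z -> Kf t ->
  W x y z t + W x y z t =
  D (cmV x y) z t + D y (cmV x z) t + D y z (cmV x t)
  + D (cmV y z) t x + D z (cmV y t) x + D (cmV z t) y x.
Proof.
move=> hx hy hz ht; have k := Kf_tw4 hx hy hz ht.
rewrite /W addrACA -vlD // -opprD (tw4_double algV) (tw4_double algQ).
have [k1 k2 k3 k4] := And4 (Kf_cm hx hy) (Kf_cm hx hz) (Kf_cm hx ht) (Kf_cm hy hz).
have [k5 k6] := conj (Kf_cm hy ht) (Kf_cm hz ht).
have [t1 t2 t3 t4] := And4 (Kf_T3 k1 hz ht) (Kf_T3 hy k2 ht) (Kf_T3 hy hz k3)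
  (Kf_T3 k4 ht hx).
have [t5 t6] := conj (Kf_T3 hz k5 hx) (Kf_T3 k6 hy hx).
have u1 := KfD t1 t2; have u2 := KfD u1 t3; have u3 := KfD u2 t4; have u4 := KfD u3 t5.
rewrite (vlD u4 t6) (vlD u3 t5) (vlD u2 t4) (vlD u1 t3) (vlD t1 t2).
rewrite /D (vl_cm hx hy) (vl_cm hx hz) (vl_cm hx ht) (vl_cm hy hz) (vl_cm hy ht)
  (vl_cm hz ht).
by rewrite /cm /T3; nca algQ.
Qed.

(** Transposing neighbours carries the word [a b e c d] to [b a c e d], and [e b a c d] to
    [b e c a d]; each transposition contributes a tetrad with a commutator as a letter. Comparing
    the values of [vl] with the same identity among the images leaves a relation between defects. *)
Lemma lam_id a b e c d : Kf a -> Kf b -> Kf c -> Kf d -> Kf e ->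
  D (T3V a b e) c d + T3Q (D a b e) (vl c) (vl d)
    - (D b (T3V a c e) d + T3Q (vl b) (D a c e) (vl d)) =
  W (cmV a b) e c d + W b a (cmV e c) d + W (cmV e b) a c d + W b e (cmV a c) d.
Proof.
move=> ha hb hc hd he.
have [k1 k2] := conj (Kf_T3 ha hb he) (Kf_T3 ha hc he).
have [t1 t2] := conj (Kf_T3 k1 hc hd) (Kf_T3 hb k2 hd).
have [c1 c2 c3 c4] := And4 (Kf_cm ha hb) (Kf_cm he hc) (Kf_cm he hb) (Kf_cm ha hc).
have [w1 w2] := conj (Kf_tw4 c1 he hc hd) (Kf_tw4 hb ha c2 hd).
have [w3 w4] := conj (Kf_tw4 c3 ha hc hd) (Kf_tw4 hb he c4 hd).
have e1 : T3V (T3V a b e) c d - T3V b (T3V a c e) d =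
    tw4 mulV (cmV a b) e c d + tw4 mulV b a (cmV e c) d
    + tw4 mulV (cmV e b) a c d + tw4 mulV b e (cmV a c) d.
  by rewrite /cm /T3 /tw4; nca algV.
have := congr1 vl e1; rewrite (vlD t1 (KfN t2)) (vlN t2).
have u1 := KfD w1 w2; have u2 := KfD u1 w3.
rewrite (vlD u2 w4) (vlD u1 w3) (vlD w1 w2) => e2.
rewrite /D /W (vl_cm ha hb) (vl_cm he hc) (vl_cm he hb) (vl_cm ha hc).
(* The relation [e2] is inserted as a vanishing summand, after which the equality is formal in the
   letters. *)
set R := RHS; apply: etrans (_ : R + (vl (T3V (T3V a b e) c d) - vl (T3V b (T3V a c
  e) d) -
  (vl (tw4 mulV (cmV a b) e c d) + vl (tw4 mulV b a (cmV e c) d)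
     + vl (tw4 mulV (cmV e b) a c d) + vl (tw4 mulV b e (cmV a c) d))) = _).
  by rewrite /R /cm /T3 /tw4; nca algQ.
by rewrite e2 subrr addr0.
Qed.

(** Same principle: transpositions carry [a x y b c] to [a b x c y] in three steps and [y x a b c]
    to [x b a c y] in five. *)
Lemma nu_id a b c x y : Kf a -> Kf b -> Kf c -> Kf x -> Kf y ->
  D (T3V a x y) b c + T3Q (D a x y) (vl b) (vl c)
    - (D (T3V a b x) c y + T3Q (D a b x) (vl c) (vl y)) =
  W a x (cmV y b) c + W a (cmV x b) y c + W a b x (cmV y c) + W (cmV y x) a b c
  + (W x (cmV y a) b c + W x a (cmV y b) c + W x a b (cmV y c) + W x (cmV a b) c y).
Proof.
move=> ha hb hc hx hy.
have [k1 k2] := conj (Kf_T3 ha hx hy) (Kf_T3 ha hb hx).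
have [t1 t2] := conj (Kf_T3 k1 hb hc) (Kf_T3 k2 hc hy).
have [c1 c2 c3 c4] := And4 (Kf_cm hy hb) (Kf_cm hx hb) (Kf_cm hy hc) (Kf_cm hy hx).
have [c5 c6] := conj (Kf_cm hy ha) (Kf_cm ha hb).
have [w1 w2 w3 w4] := And4 (Kf_tw4 ha hx c1 hc) (Kf_tw4 ha c2 hy hc) (Kf_tw4 ha hb hx c3)
  (Kf_tw4 c4 ha hb hc).
have [w5 w6 w7 w8] := And4 (Kf_tw4 hx c5 hb hc) (Kf_tw4 hx ha c1 hc) (Kf_tw4 hx ha hb c3)
  (Kf_tw4 hx c6 hc hy).
have e1 : T3V (T3V a x y) b c - T3V (T3V a b x) c y =
    tw4 mulV a x (cmV y b) c + tw4 mulV a (cmV x b) y c + tw4 mulV a b x (cmV y c)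
    + tw4 mulV (cmV y x) a b c + (tw4 mulV x (cmV y a) b c + tw4 mulV x a (cmV y b) c
    + tw4 mulV x a b (cmV y c) + tw4 mulV x (cmV a b) c y).
  by rewrite /cm /T3 /tw4; nca algV.
have := congr1 vl e1; rewrite (vlD t1 (KfN t2)) (vlN t2).
have u1 := KfD w1 w2; have u2 := KfD u1 w3.
have v1 := KfD w5 w6; have v2 := KfD v1 w7.
rewrite (vlD (KfD u2 w4) (KfD v2 w8)) (vlD u2 w4) (vlD u1 w3) (vlD w1 w2).
rewrite (vlD v2 w8) (vlD v1 w7) (vlD w5 w6) => e2.
rewrite /D /W (vl_cm hy hb) (vl_cm hx hb) (vl_cm hy hc) (vl_cm hy hx) (vl_cm hy ha)
  (vl_cm ha hb).
set R := RHS; apply: etrans (_ : R + (vl (T3V (T3V a x y) b c) - vl (T3V (T3V a b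
  x) c y) -
  (vl (tw4 mulV a x (cmV y b) c) + vl (tw4 mulV a (cmV x b) y c)
     + vl (tw4 mulV a b x (cmV y c)) + vl (tw4 mulV (cmV y x) a b c)
   + (vl (tw4 mulV x (cmV y a) b c) + vl (tw4 mulV x a (cmV y b) c)
     + vl (tw4 mulV x a b (cmV y c)) + vl (tw4 mulV x (cmV a b) c y)))) = _).
  by rewrite /R /cm /T3 /tw4; nca algQ.
by rewrite e2 subrr addr0.
Qed.

(** * The defect on chains of rank-two elements *)

Section Chain.
Variables (S : seq U) (b v : nat -> U).
Hypothesis ch : chain B S b v.
Local Notation sg := (sg b v).

Definition T s := S ++ flatten [seq [:: v i; b i] | i <- s].
(** The list [s] records the chain indices that the image of [x] may involve besides [S]; chain
    vectors with other indices are far from [x]. *)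
Definition Lc s x := Kf x /\ locB (T s) (vl x).

Lemma T_perp (s : seq nat) u : perp B S u -> (forall i, i \in s -> B (v i) u = 0 /\
  B (b i) u = 0) ->
  perp B (T s) u.
Proof.
move=> pu h; apply/perp_cat; split=> // t /flattenP[_ /mapP[i /h[h1 h2] ->]].
by rewrite !inE => /orP[]/eqP->.
Qed.
Lemma Bbb i j : i != j -> B (b i) (b j) = 0. Proof. by case: ch => _ _ _ h _;
  apply: h. Qed.
Lemma Bvv i j : i != j -> B (v i) (v j) = 0. Proof. by case: ch => _ _ _ _; apply. Qed.
Lemma Bbv i j : B (b i) (v j) = (i == j)%:R. Proof. by case: ch => _ _ ->. Qed.
Lemma Bvb i j : B (v i) (b j) = eps * (i == j)%:R.
Proof. by rewrite (BC BP (b j)) Bbv eq_sym. Qed.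
Lemma Sb i : perp B S (b i). Proof. by case: ch. Qed.
Lemma Sv i : perp B S (v i). Proof. by case: ch. Qed.
Lemma T_b s k : k \notin s -> perp B (T s) (b k).
Proof.
move=> ks; apply: T_perp (Sb k) _ => i si.
have ik : i != k by apply: contraNneq ks => <-.
by rewrite Bvb Bbb // (negPf ik) mulr0.
Qed.
Lemma T_v s k : k \notin s -> perp B (T s) (v k).
Proof.
move=> ks; apply: T_perp (Sv k) _ => i si.
have ik : i != k by apply: contraNneq ks => <-.
by rewrite Bbv Bvv // (negPf ik).
Qed.
Lemma T_sub (s s' : seq nat) u : {subset s <= s'} -> perp B (T s') u -> perp B (T s) u.
Proof.
move=> ss /perp_cat[pS p]; apply: T_perp => // i si.
by split; apply: p; apply/flattenP; exists [:: v i; b i]; rewrite ?inE ?eqxx ?orbT //;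
  apply/mapP; exists i => //; apply: ss.
Qed.
Lemma Lc_sub s s' x : {subset s <= s'} -> Lc s x -> Lc s' x.
Proof. by move=> ss [k l]; split=> //; apply: loc_sub l => u; apply: T_sub. Qed.
Lemma Lc_S s x : Kf x -> locB S (vl x) -> Lc s x.
Proof. by move=> k l; split=> //; apply: loc_sub l => u /perp_cat[]. Qed.
Lemma sg_loc (s : seq nat) x i j : sg x i j -> i \in s -> j \in s ->
  locB (flatten [seq [:: v i; b i] | i <- s]) (vl x).
Proof.
move=> [k e] si sj; rewrite e; apply: locX => u p.
by split; apply: p; apply/flattenP; [exists [:: v i; b i]|exists [:: v j; b j]];
  rewrite ?inE ?eqxx ?orbT //; apply/mapP; [exists i|exists j].
Qed.
Lemma Lc_sg (s : seq nat) x i j : sg x i j -> i \in s -> j \in s -> Lc s x.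
Proof.
move=> sx si sj; split; first exact: sx.1.
by apply: loc_sub (sg_loc sx si sj) => u /perp_cat[].
Qed.
Lemma Lc_T3 s x y z : Lc s x -> Lc s y -> Lc s z -> Lc s (T3V x y z).
Proof. by move=> [kx lx] [ky ly] [kz lz]; apply: Kf_T3_loc. Qed.
Lemma Lc_cm s x y : Lc s x -> Lc s y -> Lc s (cmV x y).
Proof.
by move=> [kx lx] [ky ly]; split; [exact: Kf_cm|rewrite vl_cm //; apply: loc_cm].
Qed.
Lemma Lc_cm0 s x y : Kf x -> Kf y -> vl (cmV x y) = 0 -> Lc s (cmV x y).
Proof. by move=> kx ky e; split; [exact: Kf_cm|rewrite e; exact: loc0]. Qed.

Lemma sg_cm x y i j k : sg x i j -> sg y j k -> i != j -> j != k -> i != k -> sg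
  (cmV x y) i k.
Proof.
move=> [kx ex] [ky ey] ij jk ik; split; first exact: Kf_cm.
rewrite vl_cm // ex ey cmXX Bbv eqxx Bvv // Bbb // Bvb (negPf ik) !mulr0 !scale0r.
by rewrite mul1H scale1r !subr0 addr0.
Qed.
Lemma cm_S0 z x i j : Kf z -> locB S (vl z) -> sg x i j -> vl (cmV z x) = 0.
Proof. by move=> kz lz [kx ex]; rewrite vl_cm // ex (cmX_far _ lz (Sv i) (Sb j)). Qed.
Lemma cm_sg0 x y i j k l : sg x i j -> sg y k l -> j != k -> i != k -> j != l -> i != l ->
  vl (cmV x y) = 0.
Proof.
move=> [kx ex] [ky ey] jk ik jl il.
rewrite vl_cm // ex ey cmXX Bbv Bvv // Bbb // Bvb (negPf jk) (negPf il).
by rewrite !mulr0 !scale0r !subr0 addr0.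
Qed.
Lemma vl_cmC x y : Kf x -> Kf y -> vl (cmV x y) = 0 -> vl (cmV y x) = 0.
Proof. by move=> kx ky e; have := e; rewrite !vl_cm // => e'; rewrite /cm -opprB
  -[X in - X]/(cmQ (vl x) (vl y)) e' oppr0. Qed.

Lemma Lc_b s x k q t : Lc s x -> k \notin s -> ev (vl x ## q) (b k) t = 0.
Proof. by move=> [_ l] /T_b; apply: loc_mull. Qed.
Lemma Lc_v s x k q t : Lc s x -> k \notin s -> ev (vl x ## q) (v k) t = 0.
Proof. by move=> [_ l] /T_v; apply: loc_mull. Qed.
Lemma sg_b x i j q t : sg x i j -> i != j -> ev (vl x ## q) (b i) t = ev q (b j) t.
Proof.
move=> [_ ->] ij; rewrite ev_Xmul Bbv eqxx Bbb // mulr0 scale0r subr0.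
by rewrite mul1H scale1r.
Qed.
Lemma sg_v x i j q t : sg x i j -> i != j -> ev (vl x ## q) (v j) t = - ev q (v i) t.
Proof.
move=> [_ ->] ij; rewrite ev_Xmul Bvb Bvv 1?eq_sym // eqxx mulr1 (epsK BP) scale0r sub0r.
by rewrite mul1H scale1r.
Qed.
Lemma D_b s x y z k t : Lc s x -> Lc s y -> Lc s z -> k \notin s -> ev (D x y z) (b
  k) t = 0.
Proof.
by move=> [kx lx] [ky ly] [kz lz] /T_b ks; have [] := D_loc kx ky kz lx ly lz ks t.
Qed.
Lemma D_v s x y z k t : Lc s x -> Lc s y -> Lc s z -> k \notin s -> ev (D x y z) t
  (v k) = 0.
Proof.
by move=> [kx lx] [ky ly] [kz lz] /T_v ks; have [] := D_loc kx ky kz lx ly lz ks t.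
Qed.

Lemma D_vl s x y z k t : Lc s x -> Lc s y -> Lc s z -> k \notin s -> ev (D x y z)
  (v k) t = 0.
Proof.
by move=> [kx lx] [ky ly] [kz lz] /T_v ks; have [] := D_loc kx ky kz lx ly lz ks t.
Qed.

Lemma peel_X s x y z w a n u : Lc s x -> Lc s y -> Lc s z -> Kf w -> vl w = X a (b
  n) oneH ->
  n \notin s -> B a (v n) = 0 ->
  ev (D x y z) u a = ev (vl x ## D y z w) u (v n) + (ev (vl y ## D z x w) u (v n)
                      + ev (vl z ## D x y w) u (v n)).
Proof.
move=> [kx lx] [ky ly] [kz lz] kw ew ns an.
by apply: (peel u kx ky kz kw lx ly lz ew (T_v ns) an); rewrite Bbv eqxx.
Qed.
Lemma peel_sg s x y z w i n u : Lc s x -> Lc s y -> Lc s z -> sg w i n -> n \notin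
  s -> i != n ->
  ev (D x y z) u (v i) = ev (vl x ## D y z w) u (v n) + (ev (vl y ## D z x w) u (v n)
                      + ev (vl z ## D x y w) u (v n)).
Proof. by move=> lx ly lz [kw ew] ns ij; apply: peel_X lx ly lz kw ew ns (Bvv ij). Qed.

Lemma sg_ex i j : exists x, sg x i j.
Proof.
have [x [hx e]] := M1X (v i) (b j) oneH.
have k : kf x (r x) by split; [exact/gd_M/M1_M|exact: M1_loc].
by exists x; split; [exact: kf_Kf k|rewrite (vl_kf k)].
Qed.

(** Peeling with the letter [w] that continues the chain; of the three products only the one
    starting with [vl x] survives, since [b i] is far from [y] and [z]. *)
Lemma lam_shift x y z w i j k l n : sg x i j -> sg y j k -> sg z k l -> sg w l n ->
  (i < j)%N -> (j < k)%N -> (k < l)%N -> (l < n)%N ->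
  ev (D x y z) (b i) (v l) = ev (D y z w) (b j) (v n).
Proof.
move=> sx sy sz sw ij jk kl ln.
rewrite (@peel_sg [:: i; j; k; l] x y z w l n) //; try lia; rewrite ?inE; try lia;
  try by apply: Lc_sg; eauto; rewrite !inE ?eqxx ?orbT.
rewrite (sg_b _ _ sx) ?(@Lc_b [:: j; k] y) ?(@Lc_b [:: k; l] z) ?addr0 ?inE //; try lia.
by apply: Lc_sg sz _ _; rewrite !inE ?eqxx ?orbT.
by apply: Lc_sg sy _ _; rewrite !inE ?eqxx ?orbT.
Qed.

Lemma ev_lam p q r1 s t1 t2 t3 t4 u w : p + q - (r1 + s) = t1 + t2 + t3 + t4 ->
  ev p u w + ev q u w - (ev r1 u w + ev s u w) = ev t1 u w + ev t2 u w + ev t3 u w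
    + ev t4 u w.
Proof. by move/(congr1 (fun q => ev q u w)); rewrite !evD evN evD. Qed.
Lemma ev_W x y z t u w : Kf x -> Kf y -> Kf z -> Kf t ->
  ev (W x y z t) u w + ev (W x y z t) u w =
  ev (D (cmV x y) z t) u w + ev (D y (cmV x z) t) u w + ev (D y z (cmV x t)) u w
  + ev (D (cmV y z) t x) u w + ev (D z (cmV y t) x) u w + ev (D (cmV z t) y x) u w.
Proof. by move=> hx hy hz ht; rewrite -evD W_double // !(evD _ (D _ _ _)). Qed.

Lemma ev_W0 x y z t u w : Kf x -> Kf y -> Kf z -> Kf t ->
  [/\ ev (D (cmV x y) z t) u w = 0, ev (D y (cmV x z) t) u w = 0 & ev (D y z (cmV x
    t)) u w = 0] ->
  [/\ ev (D (cmV y z) t x) u w = 0, ev (D z (cmV y t) x) u w = 0 & ev (D (cmV z t)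
    y x) u w = 0] ->
  ev (W x y z t) u w = 0.
Proof.
move=> hx hy hz ht [e1 e2 e3] [e4 e5 e6]; apply: half_eq.
by rewrite ev_W // e1 e2 e3 e4 e5 e6 !addr0.
Qed.

(** Four shifts, through one connecting letter, carry any three-letter chain to a given one further
    out; hence all of them share one entry. *)
Lemma lam_univ x y z x' y' z' i j k l n : sg x i j -> sg y j k -> sg z k l ->
  sg x' n n.+1 -> sg y' n.+1 n.+2 -> sg z' n.+2 n.+3 ->
  (i < j)%N -> (j < k)%N -> (k < l)%N -> (l < n)%N ->
  ev (D x y z) (b i) (v l) = ev (D x' y' z') (b n) (v n.+3).
Proof.
move=> sx sy sz sx' sy' sz' ij jk kl ln; have [w sw] := sg_ex l n.
rewrite (lam_shift sx sy sz sw) // (lam_shift sy sz sw sx') //.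
by rewrite (lam_shift sz sw sx' sy') // (lam_shift sw sx' sy' sz').
Qed.

(** There is no basis over which to expand a product. But an entry depends on the right factor
    through a single column, so this factor may be replaced by a combination of [el] with the same
    column. *)
Lemma ev_mulXmul k q a b' u t :
  ev (k ## (X a b' oneH ## q)) u t =
  mulH (ev q b' t) (ev k u a) - eps *: mulH (ev q a t) (ev k u b').
Proof.
have [[y0 v0] /= [_ _ e]] := fresh_pair BP infU [::].
pose q' := el a y0 (ev q b' t) - eps *: el b' y0 (ev q a t).
rewrite (@tm_mulr _ _ _ _ _ _ _ _ _ _ _ TM k _ q' u t v0) => [|p].
  rewrite /q' (algDr algQ) (algNr algQ) (algZr algQ) evD evN evZ !(tm_mulel TM) e.
  by rewrite !scale1r.
rewrite ev_Xmul /q' evD evN evZ !(tm_el TM) e !mulr1 !mul1H.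
by rewrite scalerA.
Qed.

Lemma mulX_eq0 k q a b' u t : mulH (ev q b' t) (ev k u a) = 0 ->
  mulH (ev q a t) (ev k u b') = 0 -> ev (k ## (X a b' oneH ## q)) u t = 0.
Proof. by move=> e1 e2; rewrite ev_mulXmul e1 e2 scaler0 subr0. Qed.
Lemma peel_in k s x y z w i n u : Lc s x -> Lc s y -> Lc s z -> sg w i n -> n
  \notin s -> i != n ->
  ev (k ## D x y z) u (v i) = ev (k ## (vl x ## D y z w)) u (v n)
    + (ev (k ## (vl y ## D z x w)) u (v n) + ev (k ## (vl z ## D x y w)) u (v n)).
Proof.
move=> lx ly lz sw ns ij; rewrite -!evD -!(algDr algQ).
by apply: (tm_mulr TM) => p; rewrite !(evD (_ ## _)); apply: peel_sg lx ly lz sw ns ij.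
Qed.
Lemma Lc_evv s x k t : Lc s x -> k \notin s -> ev (vl x) t (v k) = 0.
Proof. by move=> [_ l] /T_v p; case: (l _ p t). Qed.
Lemma Lc_evb s x k t : Lc s x -> k \notin s -> ev (vl x) t (b k) = 0.
Proof. by move=> [_ l] /T_b p; case: (l _ p t). Qed.
Lemma Lc_bev s x k t : Lc s x -> k \notin s -> ev (vl x) (b k) t = 0.
Proof. by move=> [_ l] /T_b p; case: (l _ p t). Qed.
Lemma ev_T3 x y z u t : ev (T3Q x y z) u t = ev (x ## (y ## z)) u t + ev (z ## (y
  ## x)) u t.
Proof. by rewrite /T3 evD -!(algA algQ). Qed.
Lemma T3_far s z i k p q : Lc s z -> i \notin s -> k \notin s ->
  ev (T3Q p q (vl z)) (b i) (v k) = 0.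
Proof.
move=> lz si sk; rewrite /T3 evD -(algA algQ (vl z)) (Lc_b _ _ lz si).
by rewrite (loc_mulr _ _ lz.2 (T_v sk)) addr0.
Qed.
Lemma vlT3 x y z : vl (T3V x y z) = D x y z + T3Q (vl x) (vl y) (vl z).
Proof. by rewrite /D subrK. Qed.
Lemma DN2 x y z : Kf x -> Kf y -> Kf z -> D x (- y) z = - D x y z.
Proof.
move=> kx ky kz; rewrite /D vlN //.
have -> : T3V x (- y) z = - T3V x y z by rewrite /T3; nca algV.
by rewrite vlN; [rewrite /T3; nca algQ|exact: Kf_T3].
Qed.

Lemma gap s x y z i j l : sg x i j -> Lc s y -> Lc s z -> i \notin s -> j \notin s ->
  i != j -> i != l -> j != l ->
  ev (D x y z) (b i) (v l) = 0 /\ ev (D x y z) (v j) (v l) = 0.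
Proof.
move=> sx ly lz si sj ij il jl.
pose n := (\max_(m <- [:: i, j, l & s]) m).+1.
have ns : n \notin [:: i, j, l & s].
  by apply/negP => h; have := @leq_bigmax_seq nat _ xpredT id n h isT; rewrite ltnn.
have [w sw] := sg_ex l n; move: (ns); rewrite !inE !negb_or => /and4P[ni nj nl ns'].
have sub t : Lc s t -> Lc [:: i, j & s] t by apply: Lc_sub => m; rewrite !inE =>
  ->; rewrite !orbT.
have lw : Lc [:: l, n & s] w by apply: Lc_sg sw _ _; rewrite !inE eqxx ?orbT.
have sub' t : Lc s t -> Lc [:: l, n & s] t by apply: Lc_sub => m; rewrite !inE =>
  ->; rewrite !orbT.
have lx : Lc [:: i, j & s] x by apply: Lc_sg sx _ _; rewrite !inE eqxx ?orbT.
have pl u := @peel_sg [:: i, j & s] x y z w l n u lx (sub _ ly) (sub _ lz) sw.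
have {}pl u : ev (D x y z) u (v l) = ev (vl x ## D y z w) u (v n) + (ev (vl y ## D
  z x w) u (v n)
                      + ev (vl z ## D x y w) u (v n)).
  by apply: pl; [rewrite !inE !negb_or ni nj|rewrite eq_sym].
have n1 : j \notin [:: l, n & s] by rewrite !inE !negb_or jl (eq_sym j) nj sj.
have n2 : i \notin [:: l, n & s] by rewrite !inE !negb_or il (eq_sym i) ni si.
split; rewrite pl.
  rewrite (Lc_b _ _ ly si) (Lc_b _ _ lz si) !addr0 (sg_b _ _ sx) //.
  by rewrite (D_b _ (sub' _ ly) (sub' _ lz) lw).
rewrite (Lc_v _ _ ly sj) (Lc_v _ _ lz sj) !addr0 (sg_v _ _ sx) //.
by rewrite (D_vl _ (sub' _ ly) (sub' _ lz) lw) // oppr0.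
Qed.

Ltac ni := first [by [] | by rewrite !inE; lia].
Ltac lcs := match goal with h : sg ?x _ _ |- Lc _ ?x => apply: (Lc_sg h); ni end.
Ltac lc := first [lcs | by apply: Lc_S | by apply: Lc_cm0 | apply: Lc_T3; lc |
  apply: Lc_cm; lc].
Tactic Notation "D0v" uconstr(s) := rewrite (@D_v s); [|lc|lc|lc|ni].
Tactic Notation "D0b" uconstr(s) := rewrite (@D_b s); [|lc|lc|lc|ni].

(** [lam_id] is read between [b 0] and [v 5] on five consecutive letters. Every term other than the
    first tetrad vanishes because the chain is broken or a letter is far, and twice that tetrad is
    the common entry. *)
Lemma lam_eq0 x y z i j k l : sg x i j -> sg y j k -> sg z k l ->
  (i < j)%N -> (j < k)%N -> (k < l)%N -> ev (D x y z) (b i) (v l) = 0.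
Proof.
(* [n] exceeds [l] and the indices 0 to 5 of the test chain, so that both chains can be shifted to
   the one starting at [n]. *)
move=> sx sy sz ij jk kl; pose n := (l + 6)%N.
have n5 : (5 < n)%N by rewrite /n; lia.
have [x' sx'] := sg_ex n n.+1; have [y' sy'] := sg_ex n.+1 n.+2.
have [z' sz'] := sg_ex n.+2 n.+3.
set e0 := ev (D x' y' z') (b n) (v n.+3).
have lam x1 y1 z1 i1 j1 k1 l1 : sg x1 i1 j1 -> sg y1 j1 k1 -> sg z1 k1 l1 ->
    (i1 < j1)%N -> (j1 < k1)%N -> (k1 < l1)%N -> (l1 < n)%N -> ev (D x1 y1 z1) (b
      i1) (v l1) = e0.
  by move=> h1 h2 h3; apply: lam_univ h1 h2 h3 sx' sy' sz'.
rewrite (lam _ _ _ _ _ _ _ sx sy sz) //; last by lia.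
have [a sa] := sg_ex 0 1; have [b1 sb] := sg_ex 1 2; have [c sc] := sg_ex 2 3.
have [d sd] := sg_ex 3 4; have [e se] := sg_ex 4 5.
have [w sw] := sg_ex 5 6; have [w' sw'] := sg_ex 6 7.
have [[ka _] [kb _] [kc _]] := And3 sa sb sc; have [[kd _] [ke _]] := conj sd se.
have [kw kw'] := conj sw.1 sw'.1.
have sab := sg_cm sa sb isT isT isT; have sac : vl (cmV a c) = 0 by apply: cm_sg0
  sa sc _ _ _ _.
have K2 : Lc [:: 0; 1; 2; 4; 5] (T3V a b1 e) by lc.
have K1 : Lc [:: 0; 1; 2; 3; 4; 5] (T3V a c e) by lc.
have z1 : ev (vl (T3V a b1 e)) (b 0) (v 5) = 0.
  rewrite vlT3 evD (@peel_sg [:: 0; 1; 2; 4; 5] _ _ _ w 5 6) //; [|lc|lc|lc].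
  rewrite (@Lc_b [:: 1; 2] b1) //; last lc.
  rewrite (@Lc_b [:: 4; 5] e) //; last lc.
  rewrite (sg_b _ _ sa) // !addr0 ev_T3 (@Lc_b [:: 4; 5] e) //; last lc.
  rewrite (sg_b _ _ sa) // (sg_b _ _ sb) // (@Lc_bev [:: 4; 5] e) //; last lc.
  rewrite !addr0; have [-> _] // := @gap [:: 4; 5; 6] b1 e w 1 2 6 sb ltac:(lc)
    ltac:(lc) isT isT isT isT isT.
have z2 : ev (vl (T3V a c e)) (b 0) (v 5) = 0.
  have [g _] := @gap [:: 2; 3; 4; 5] a c e 0 1 5 sa ltac:(lc) ltac:(lc) isT isT isT
    isT isT.
  rewrite vlT3 evD g ev_T3 (@Lc_b [:: 4; 5] e) //; last lc.
  rewrite (sg_b _ _ sa) // (@Lc_b [:: 2; 3] c) //; last lc.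
  by rewrite !addr0.
have E1 : ev (D (T3V a b1 e) c d) (b 0) (v 5) = 0.
  rewrite (@peel_sg [:: 0; 1; 2; 3; 4; 5] _ _ _ w 5 6) //; [|lc|lc|lc].
  rewrite (@Lc_b [:: 2; 3] c) //; last lc.
  rewrite (@Lc_b [:: 3; 4] d) //; last lc.
  rewrite (@peel_in _ [:: 2; 3; 4; 5; 6] _ _ _ w' 6 7) //; [|lc|lc|lc].
  have [g _] := @gap [:: 5; 6; 7] d w w' 3 4 7 sd ltac:(lc) ltac:(lc) isT isT isT isT isT.
  have [_ g'] := @gap [:: 5; 6; 7] c w w' 2 3 7 sc ltac:(lc) ltac:(lc) isT isT isT
    isT isT.
  rewrite -(@DC1 c) // in g'.
  rewrite sc.2 sd.2 sw.2 !mulX_eq0 ?addr0 // ?z1 ?g ?g' ?(alg0l algH) ?(alg0r algH) //.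
  1-3: by rewrite ?(Lc_evb _ K2) ?(Lc_evv _ K2) ?(alg0r algH).
have E2 : ev (T3Q (D a b1 e) (vl c) (vl d)) (b 0) (v 5) = 0.
  by apply: (@T3_far [:: 3; 4]) => //; lc.
have E3 : ev (D b1 (T3V a c e) d) (b 0) (v 5) = 0.
  rewrite (@peel_sg [:: 0; 1; 2; 3; 4; 5] _ _ _ w 5 6) //; [|lc|lc].
  rewrite (@Lc_b [:: 1; 2] b1) //; last lc.
  rewrite (@Lc_b [:: 3; 4] d) //; last lc.
  rewrite (@peel_in _ [:: 1; 2; 3; 4; 5; 6] _ _ _ w' 6 7) //; [|lc|lc|lc].
  have f1 t : ev (D b1 w w') (b 4) t = 0 /\ ev (D b1 w w') (v 3) t = 0.
    by split; [apply: (@D_b [:: 1; 2; 5; 6; 7])|apply: (@D_vl [:: 1; 2; 5; 6; 7])]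
      => //; lc.
  have f2 t : ev (D w d w') (b 2) t = 0 /\ ev (D w d w') (v 1) t = 0.
    by split; [apply: (@D_b [:: 3; 4; 5; 6; 7])|apply: (@D_vl [:: 3; 4; 5; 6; 7])]
      => //; lc.
  have [[f3 f4] [f5 f6]] := conj (f1 (v 7)) (f2 (v 7)).
  rewrite sb.2 sd.2 sw.2 !mulX_eq0 ?addr0 // ?z2 ?f3 ?f4 ?f5 ?f6 ?(alg0l algH)
    ?(alg0r algH) //.
  by rewrite (Lc_evb _ K1) ?(alg0r algH).
have E4 : ev (T3Q (vl b1) (D a c e) (vl d)) (b 0) (v 5) = 0.
  by apply: (@T3_far [:: 3; 4]) => //; lc.
have kA := sab.1.
have zAe : vl (cmV (cmV a b1) e) = 0 by apply: cm_sg0 sab se _ _ _ _.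
have zAd : vl (cmV (cmV a b1) d) = 0 by apply: cm_sg0 sab sd _ _ _ _.
have zec : vl (cmV e c) = 0 by apply: cm_sg0 se sc _ _ _ _.
have zeb : vl (cmV e b1) = 0 by apply: cm_sg0 se sb _ _ _ _.
have sAc := sg_cm sab sc isT isT isT.
have scd := sg_cm sc sd isT isT isT.
have sde := sg_cm sd se isT isT isT.
(* With brackets for commutators, three of the six defects are chains from 0 to 5: [[[a,b1],c], d,
   e] with sign plus, [[a,b1], c, [d,e]] with minus, and [[a,b1], [c,d], e] with plus. *)
have W1 : ev (W (cmV a b1) e c d) (b 0) (v 5) = 0 -> e0 = 0.
  move=> h; have := @ev_W (cmV a b1) e c d (b 0) (v 5) sab.1 ke kc kd; rewrite h.
  D0b [:: 2; 3; 4].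
  rewrite (@DC1 (cmV (cmV a b1) c) e) ?(@DC2 (cmV (cmV a b1) c) d e) //; try exact: sAc.1.
  rewrite (lam _ _ _ _ _ _ _ sAc sd se) //.
  D0b [:: 2; 3; 4; 5]. D0v [:: 0; 2; 3; 4].
  have -> : cmV e d = - cmV d e by rewrite /cm opprB.
  rewrite DN2 ?evN; [|exact: kc|exact: sde.1|exact: sab.1].
  rewrite -(D321 _ (cmV d e)) (@DC2 (cmV a b1) c) ?(lam _ _ _ _ _ _ _ sab sc sde)
    //; try exact: sde.1; try exact: sab.1.
  rewrite -(D321 _ e) (@DC2 (cmV a b1)) ?(lam _ _ _ _ _ _ _ sab scd se) //; try
    exact: scd.1; try exact: sab.1.
  by rewrite !addr0 add0r subrr add0r.
have W2 : ev (W b1 a (cmV e c) d) (b 0) (v 5) = 0.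
  apply: ev_W0 => //; first exact: Kf_cm.
  1-2: split; by D0v [:: 0; 1; 2; 3; 4].
have W3 : ev (W (cmV e b1) a c d) (b 0) (v 5) = 0.
  apply: ev_W0 => //; first exact: Kf_cm.
  1-2: split; by D0v [:: 0; 1; 2; 3; 4].
have W4 : ev (W b1 e (cmV a c) d) (b 0) (v 5) = 0.
  apply: ev_W0 => //; first exact: Kf_cm.
  1-2: split; by D0b [:: 1; 2; 3; 4; 5].
have := @ev_lam _ _ _ _ _ _ _ _ (b 0) (v 5) (lam_id ka kb kc kd ke).
rewrite E1 E2 E3 E4 W2 W3 W4 !addr0 subrr => /esym/W1; exact.
Qed.

Lemma cc_shift z x y w i j k n : Kf z -> locB S (vl z) -> sg x i j -> sg y j k ->
  sg w k n ->
  (i < j)%N -> (j < k)%N -> (k < n)%N ->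
  ev (D z x y) (b i) (v k) = ev (D z y w) (b j) (v n).
Proof.
move=> kz lz sx sy sw ij jk kn; have lz0 : Lc [::] z by apply: Lc_S.
rewrite (@peel_sg [:: i; j; k] z x y w k n) //; [|lc|lc|lc|ni|lia].
rewrite (Lc_b _ _ lz0) // (sg_b _ _ sx); last by lia.
rewrite (@Lc_b [:: j; k] y); [|lc|ni].
by rewrite addr0 add0r -(@DC1 z) //; [apply: sy.1|apply: sw.1].
Qed.

Lemma cc_univ z x y x' y' i j k n : Kf z -> locB S (vl z) -> sg x i j -> sg y j k ->
  sg x' n n.+1 -> sg y' n.+1 n.+2 -> (i < j)%N -> (j < k)%N -> (k < n)%N ->
  ev (D z x y) (b i) (v k) = ev (D z x' y') (b n) (v n.+2).
Proof.
move=> kz lz sx sy sx' sy' ij jk kn; have [w sw] := sg_ex k n.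
rewrite (cc_shift kz lz sx sy sw) // (cc_shift kz lz sy sw sx') //.
by rewrite (cc_shift kz lz sw sx' sy').
Qed.

(* [D z x y] is skew, and peeling with a letter from [b 0] to [b 3] in place of
   [v 0] to [b 3] reverses the chain; the two signs disagree. *)
Lemma cc_eq0 z x y i j k : Kf z -> locB S (vl z) -> sg x i j -> sg y j k ->
  (i < j)%N -> (j < k)%N -> ev (D z x y) (b i) (v k) = 0.
Proof.
move=> kz lz sx sy ij jk.
have [n [n5 kn]] : exists n, (5 < n)%N /\ (k < n)%N by exists (k + 6)%N; lia.
have [x' sx'] := sg_ex n n.+1; have [y' sy'] := sg_ex n.+1 n.+2.
rewrite (cc_univ kz lz sx sy sx' sy') //.
have {x y i j k sx sy ij jk kn} cc x y i j k (sx : sg x i j) (sy : sg y j k) :=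
   cc_univ kz lz sx sy sx' sy'.
set e0 := ev _ _ _ in cc *.
have [x sx] := sg_ex 0 1; have [y sy] := sg_ex 1 2; have [w sw] := sg_ex 3 4.
have [w' sw'] := sg_ex 4 5; have lz0 : Lc [::] z by apply: Lc_S.
have [kx ky kw kw'] := And4 sx.1 sy.1 sw.1 sw'.1.
have [u [hu eu]] := M1X (b 0) (b 3) oneH.
have ku : kf u (r u) by split; [exact/gd_M/M1_M|exact: M1_loc].
have {ku eu} [ku eu] : Kf u /\ vl u = X (b 0) (b 3) oneH by rewrite /Kf (vl_kf ku) -eu.
have lu : Lc [:: 0; 3] u.
  split=> //; rewrite eu; apply: locX => t /perp_cat[_ p].
  by split; apply: p; rewrite !inE eqxx ?orbT.
have s1 := D_skew kz kx ky.
have R1 : ev (D z x y) (v 2) (b 0) = - ev (D z x u) (v 1) (v 3).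
  rewrite (@peel_X [:: 0; 1; 2] z x y u (b 0) 3) //; [|lc|lc|lc|by rewrite Bbv].
  rewrite (Lc_v _ _ lz0) // (@Lc_v [:: 0; 1] x) //; last lc.
  by rewrite !add0r (sg_v _ _ sy).
have R2 : ev (D z x u) (v 1) (v 3) = - ev (D u z w) (v 0) (v 4).
  rewrite (@peel_sg [:: 0; 1; 3] z x u w 3 4) //; [|lc|lc|by apply: Lc_sub lu => m;
    rewrite !inE => /orP[]->; rewrite ?orbT].
  rewrite (Lc_v _ _ lz0) // (Lc_v _ _ lu) //.
  by rewrite addr0 add0r (sg_v _ _ sx).
have R3 : ev (D u z w) (v 0) (v 4) = eps *: ev (D z w w') (b 3) (v 5).
  rewrite (@peel_sg [:: 0; 3; 4] u z w w' 4 5) //; [|by apply: Lc_sub lu => m;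
    rewrite !inE => /orP[]->; rewrite ?orbT|lc|lc].
  rewrite (Lc_v _ _ lz0) // (@Lc_v [:: 3; 4] w) //; last lc.
  rewrite !addr0 eu ev_Xmul !Bvb mulr0 mulr1 mulr0 scale0r subr0.
  by rewrite mul1H.
have := ev_skew (b 0) (v 2) s1.
rewrite R1 R2 R3 (cc _ _ _ _ _ sw sw') // (cc _ _ _ _ _ sx sy) //; try by lia.
by rewrite opprK scalerA (epsK BP) scale1r => /eqN_eq0.
Qed.

Lemma sg_rv x i j q t : sg x i j -> i != j -> ev (q ## vl x) t (v j) = ev q t (v i).
Proof.
move=> [_ ->] ij; rewrite ev_mulX Bbv eqxx Bvv // mulr0 scale0r subr0.
by rewrite mul1H scale1r.
Qed.
Lemma far_mul0 s p q : locB S p -> skQ q -> locB (flatten [seq [:: v i; b i] | i <-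
  s]) q ->
  p ## q = 0.
Proof.
move=> lp sq lq; have [l [-> h]] := loc_decomp sq lq.
rewrite (alg_sumr algQ) big_seq big1 // => c /h {}h.
apply: (tm_inj TM) => u t; rewrite ev0 ev_mulX.
have pS a : (forall t, perp B (flatten [seq [:: v i; b i] | i <- s]) t -> B a t =
  0) -> perp B S a.
  move=> ha y yS; apply: (BC0 BP); apply: ha => w /flattenP[l' /mapP[i _ ->]].
  by rewrite !inE => /orP[]/eqP->; apply: (BC0 BP); [apply: Sv|apply: Sb].
rewrite (lp c.1.1 _ u).1; last by apply: pS => y /h[].
rewrite (lp c.1.2 _ u).1; last by apply: pS => y /h[].
by rewrite (alg0r algH) !scaler0 subrr.
Qed.

Lemma nu_shift x y w w' i j n : Kf x -> Kf y -> locB S (vl x) -> locB S (vl y) ->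
  sg w i j -> sg w' j n -> (i < j)%N -> (j < n)%N ->
  ev (D x y w) (b i) (v j) = ev (D x y w') (b j) (v n).
Proof.
move=> kx ky lx ly sw sw' ij jn; have [lx0 ly0] : Lc [::] x /\ Lc [::] y by split;
  apply: Lc_S.
rewrite (@peel_sg [:: i; j] x y w w' j n) //; [|lc|lc|lc|ni|lia].
by rewrite (Lc_b _ _ lx0) // (Lc_b _ _ ly0) // !add0r (sg_b _ _ sw) //; lia.
Qed.

Lemma nu_univ x y w w' i j n : Kf x -> Kf y -> locB S (vl x) -> locB S (vl y) ->
  sg w i j -> sg w' n n.+1 -> (i < j)%N -> (j < n)%N ->
  ev (D x y w) (b i) (v j) = ev (D x y w') (b n) (v n.+1).
Proof.
move=> kx ky lx ly sw sw' ij jn; have [u su] := sg_ex j n.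
by rewrite (nu_shift kx ky lx ly sw su) // (nu_shift kx ky lx ly su sw').
Qed.

Lemma ev_nu p q r1 s t1 t2 t3 t4 t5 t6 t7 t8 u w :
  p + q - (r1 + s) = t1 + t2 + t3 + t4 + (t5 + t6 + t7 + t8) ->
  ev p u w + ev q u w - (ev r1 u w + ev s u w) = ev t1 u w + ev t2 u w + ev t3 u w
    + ev t4 u w
    + (ev t5 u w + ev t6 u w + ev t7 u w + ev t8 u w).
Proof. by move/(congr1 (fun q => ev q u w)); rewrite !evD evN evD. Qed.

Lemma vl_cm0r x y : Kf x -> Kf y -> vl y = 0 -> vl (cmV x y) = 0.
Proof. by move=> kx ky e; rewrite vl_cm // e (cm0r algQ). Qed.
Lemma vl_cm0l x y : Kf x -> Kf y -> vl x = 0 -> vl (cmV x y) = 0.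
Proof. by move=> kx ky e; rewrite vl_cm // e (cm0l algQ). Qed.

Ltac Kf_tac := first [assumption | apply: Kf_cm; Kf_tac].
Ltac z0 := first [assumption | apply: vl_cm0r; [Kf_tac|Kf_tac|z0] | apply: vl_cm0l;
  [Kf_tac|Kf_tac|z0]].
Ltac lc1 := first [lcs | by apply: Lc_S | apply: Lc_cm0; [Kf_tac|Kf_tac|z0] |
  apply: Lc_T3; lc1 | apply: Lc_cm; lc1].
Tactic Notation "far" uconstr(s1) uconstr(s2) := first [rewrite (@D_b s1); [by []|lc1|lc1|lc1|ni] | rewrite (@D_v s2); [by []|lc1|lc1|lc1|ni]].

(** [nu_id] is read between [b 0] and [v 3] on the chain letters [a], [b1], [c]. Two-letter and
    three-letter chain entries are already zero, which leaves one triple term and the last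
    tetrad. *)
Lemma nu_eq0 x y w i j : Kf x -> Kf y -> locB S (vl x) -> locB S (vl y) ->
  sg w i j -> (i < j)%N -> ev (D x y w) (b i) (v j) = 0.
Proof.
move=> kx ky lx ly sw ij.
have [n [n5 jn]] : exists n, (5 < n)%N /\ (j < n)%N by exists (j + 6)%N; lia.
have [n1 n3] : (1 < n)%N /\ (3 < n)%N by lia.
have [w0 sw0] := sg_ex n n.+1.
rewrite (nu_univ kx ky lx ly sw sw0) //.
have {w i j sw ij jn} nu w i j (sw : sg w i j) := nu_univ kx ky lx ly sw sw0.
set e0 := ev _ _ _ in nu *.
have [a sa] := sg_ex 0 1; have [b1 sb] := sg_ex 1 2; have [c sc] := sg_ex 2 3.
have [w sw] := sg_ex 3 4; have [w' sw'] := sg_ex 4 5.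
have [ka kb kc [kw kw']] := And4 sa.1 sb.1 sc.1 (conj sw.1 sw'.1).
have [lx0 ly0] : Lc [::] x /\ Lc [::] y by split; apply: Lc_S.
have sab := sg_cm sa sb isT isT isT; have sbc := sg_cm sb sc isT isT isT.
have sAc := sg_cm sab sc isT isT isT.
have [kab kbc] := conj sab.1 sbc.1.
have zac : vl (cmV a c) = 0 by apply: cm_sg0 sa sc _ _ _ _.
have [zxa zxb zxc zxA] := And4 (cm_S0 kx lx sa) (cm_S0 kx lx sb) (cm_S0 kx lx sc)
  (cm_S0 kx lx sab).
have [zya zyb zyc zyA] := And4 (cm_S0 ky ly sa) (cm_S0 ky ly sb) (cm_S0 ky ly sc)
  (cm_S0 ky ly sab).
have [zax zay zAy] := And3 (vl_cmC kx ka zxa) (vl_cmC ky ka zya) (vl_cmC ky kab zyA).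
have zcy := vl_cmC ky kc zyc.
have lyx : locB S (vl (cmV y x)) by rewrite vl_cm //; apply: loc_cm.
have lxy : locB S (vl (cmV x y)) by rewrite vl_cm //; apply: loc_cm.
have [kyx kxy] := conj (Kf_cm ky kx) (Kf_cm kx ky).
have zma : vl (cmV (cmV y x) a) = 0 by apply: cm_S0 sa.
have zmb : vl (cmV (cmV y x) b1) = 0 by apply: cm_S0 sb.
have zmc : vl (cmV (cmV y x) c) = 0 by apply: cm_S0 sc.
have gp t : Kf t -> vl t = 0 -> ev (D a t c) (b 0) (v 3) = 0.
  move=> kt zt; have lt : Lc [:: 2; 3] t by split=> //; rewrite zt; apply: loc0.
  by have [] := @gap [:: 2; 3] a t c 0 1 3 sa lt ltac:(lc) isT isT isT isT isT.
have W1 : ev (W a x (cmV y b1) c) (b 0) (v 3) = 0.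
  apply: ev_W0; [Kf_tac|Kf_tac|Kf_tac|Kf_tac| |]; split; try far [:: 1; 2; 3] [::
    0; 1; 2].
  by rewrite -D321 (@DC2 a) ?gp //; try Kf_tac; z0.
have W2 : ev (W a (cmV x b1) y c) (b 0) (v 3) = 0.
  apply: ev_W0; [Kf_tac|Kf_tac|Kf_tac|Kf_tac| |]; split; try far [:: 1; 2; 3] [::
    0; 1; 2].
  by rewrite -D321 (@DC2 a) ?gp //; try Kf_tac; z0.
have W3 : ev (W a b1 x (cmV y c)) (b 0) (v 3) = 0.
  by apply: ev_W0; [Kf_tac|Kf_tac|Kf_tac|Kf_tac| |]; split; far [:: 1; 2; 3] [:: 0; 1; 2].
have W4 : ev (W (cmV y x) a b1 c) (b 0) (v 3) = 0.
  apply: ev_W0; [Kf_tac|Kf_tac|Kf_tac|Kf_tac| |]; split; try far [:: 1; 2; 3] [::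
    0; 1; 2].
  - by apply: gp; [Kf_tac|z0].
  - by rewrite -D321 (@DC2 (cmV y x)) ?(cc_eq0 kyx lyx sab sc) //; Kf_tac.
  - by rewrite -D321 (cc_eq0 kyx lyx sa sbc).
have W5 : ev (W x (cmV y a) b1 c) (b 0) (v 3) = 0.
  by apply: ev_W0; [Kf_tac|Kf_tac|Kf_tac|Kf_tac| |]; split; far [:: 1; 2; 3] [:: 0; 1; 2].
have W6 : ev (W x a (cmV y b1) c) (b 0) (v 3) = 0.
  apply: ev_W0; [Kf_tac|Kf_tac|Kf_tac|Kf_tac| |]; split; try far [:: 1; 2; 3] [::
    0; 1; 2].
  by apply: gp; [Kf_tac|z0].
have W7 : ev (W x a b1 (cmV y c)) (b 0) (v 3) = 0.
  by apply: ev_W0; [Kf_tac|Kf_tac|Kf_tac|Kf_tac| |]; split; far [:: 1; 2; 3] [:: 0; 1; 2].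
have W8 : ev (W x (cmV a b1) c y) (b 0) (v 3) + ev (W x (cmV a b1) c y) (b 0) (v 3) = e0.
  rewrite ev_W; [|Kf_tac|Kf_tac|Kf_tac|Kf_tac].
  rewrite (@D_b [:: 2; 3] (cmV x (cmV a b1))) //; [|lc1|lc1|lc1].
  rewrite (@D_v [:: 0; 1; 2] (cmV a b1) (cmV x c)) //; [|lc1|lc1|lc1].
  rewrite -(D321 _ c (cmV x y)) (@DC2 (cmV x y)) ?(cc_eq0 kxy lxy sab sc) //.
  rewrite -(D321 _ y x) (nu _ _ _ sAc) //.
  rewrite (@D_b [:: 2; 3] c) //; [|lc1|lc1|lc1].
  rewrite (@D_v [:: 0; 1; 2] (cmV c y)) //; [|lc1|lc1|lc1].
  by rewrite !addr0 add0r.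
have K1 : Lc [:: 0; 1] (T3V a x y) by lc1.
have K2 : Lc [:: 0; 1; 2] (T3V a b1 x) by lc1.
have F1 : ev (D (T3V a x y) b1 c) (b 0) (v 3) = 0.
  rewrite (@peel_sg [:: 0; 1; 2; 3] _ _ _ w 3 4) //; [|lc1|lc1|lc1].
  rewrite (@Lc_b [:: 1; 2] b1) //; last lc.
  rewrite (@Lc_b [:: 2; 3] c) //; last lc.
  rewrite (@peel_in _ [:: 1; 2; 3; 4] _ _ _ w' 4 5) //; [|lc1|lc1|lc1].
  rewrite sb.2 sc.2 sw.2 !mulX_eq0 ?addr0 ?(lam_eq0 sc sw sw') ?(alg0l algH) //
    ?(Lc_evb _ K1) ?(Lc_evv _ K1) ?(alg0r algH) //.
have F2 : ev (T3Q (D a x y) (vl b1) (vl c)) (b 0) (v 3) = e0.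
  rewrite ev_T3 (@Lc_b [:: 2; 3] c) //; last lc.
  rewrite addr0 (algA algQ) (sg_rv _ _ sc) // (sg_rv _ _ sb) //.
  by rewrite -(@DC1 a) // (@DC2 x) // (nu _ _ _ sa).
have F3 : ev (D (T3V a b1 x) c y) (b 0) (v 3) = 0.
  rewrite (@peel_sg [:: 0; 1; 2; 3] _ _ _ w 3 4) //; [|lc1|lc1|lc1].
  rewrite (@Lc_b [:: 2; 3] c) //; last lc.
  rewrite (Lc_b _ _ ly0) //.
  rewrite (@peel_in _ [:: 2; 3; 4] _ _ _ w' 4 5) //; [|lc1|lc1|lc1].
  have E : vl y ## D w c w' = 0.
    apply: (@far_mul0 [:: 2; 3; 4; 5]) => //; first exact: D_skew.
    by apply: D_loc => //; [apply: sg_loc sw _ _|apply: sg_loc sc _ _|apply: sg_loc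
      sw' _ _].
  rewrite E (alg0r algQ) ev0 sc.2 sw.2 !mulX_eq0 ?addr0 ?(cc_eq0 ky ly sw sw')
    ?(alg0l algH) // ?(Lc_evb _ K2) ?(Lc_evv _ K2) ?(alg0r algH) //.
have F4 : ev (T3Q (D a b1 x) (vl c) (vl y)) (b 0) (v 3) = 0.
  by apply: (@T3_far [::]).
have := @ev_nu _ _ _ _ _ _ _ _ _ _ _ _ (b 0) (v 3) (nu_id ka kb kc kx ky).
rewrite F1 F2 F3 F4 W1 W2 W3 W4 W5 W6 W7 !addr0 !add0r subr0 => e.
(* [nu_id] equates [e0] with the last tetrad, whereas twice that tetrad is [e0]; so
   [e0 = e0 + e0]. *)
by apply: (addrI e0); rewrite addr0 {1 2}e W8.
Qed.

(** The double orthogonal complement of [S]. Skew tensors local at [S] are built from such vectors,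
    so left multiplication by one of them sees only old rows of the right factor. *)
Definition old p := forall t, perp B S t -> B p t = 0.

Lemma old_mul k q u t : skQ k -> locB S k -> (forall p, old p -> ev q p t = 0) ->
  ev (k ## q) u t = 0.
Proof.
move=> sq lk h; have [l [-> hl]] := loc_decomp sq lk.
rewrite (alg_suml algQ) ev_sum big_seq big1 // => c /hl {}hl.
rewrite ev_Xmul !h ?(alg0r algH) ?scaler0 ?subrr // => s /hl[] //.
Qed.
Lemma sg_old x i j q p t : sg x i j -> old p -> ev (vl x ## q) p t = 0.
Proof.
move=> [_ ->] op; rewrite ev_Xmul (op _ (Sv i)) (op _ (Sb j)) mulr0.
by rewrite !scale0r subrr.
Qed.

(** Repeated peeling replaces the local letters by those of a chain starting at [a]. A product
    beginning with a local letter needs only old rows, where the next peeling applies; one beginning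
    with [w1] meets an entry killed by [nu_eq0], [cc_eq0] or [lam_eq0]; later chain letters vanish
    on old rows. *)
Lemma D_old x y z a u : Kf x -> Kf y -> Kf z -> locB S (vl x) -> locB S (vl y) ->
  locB S (vl z) -> old a -> ev (D x y z) u a = 0.
Proof.
move=> kx ky kz lx ly lz oa.
have [w1 [h1 e1]] := M1X a (b 1) oneH.
have k1 : kf w1 (r w1) by split; [exact/gd_M/M1_M|exact: M1_loc].
have {k1 e1 h1} [k1 e1] : Kf w1 /\ vl w1 = X a (b 1) oneH by rewrite /Kf (vl_kf k1) -e1.
have [w2 s2] := sg_ex 1 2; have [w3 s3] := sg_ex 2 3; have [w4 s4] := sg_ex 3 4.
have l1 : Lc [:: 1] w1.
  split=> //; rewrite e1; apply: locX => t /perp_cat[pS p]; split; first exact: oa.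
  by apply: p; rewrite !inE eqxx ?orbT.
have l1s (s : seq nat) : 1%N \in s -> Lc s w1.
  by move=> h; apply: Lc_sub l1 => m; rewrite inE => /eqP->.
have w1_mul q p t : old p -> ev q (b 1) t = 0 -> ev (vl w1 ## q) p t = 0.
  move=> op e; rewrite e1 ev_Xmul e (op _ (Sb 1)) (alg0r algH) mulr0 scaler0 scale0r.
  by rewrite subrr.
have c3 p : old p -> ev (D w1 w2 w3) p (v 3) = 0.
  move=> op; rewrite (@peel_sg [:: 1; 2; 3] _ _ _ w4 3 4) //; [|exact: l1s|lc|lc].
  by rewrite (sg_old _ _ s2) // (sg_old _ _ s3) // w1_mul ?(lam_eq0 s2 s3 s4) ?addr0.
have c2 z' p : Kf z' -> locB S (vl z') -> old p -> ev (D z' w1 w2) p (v 2) = 0.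
  move=> kz' lz' op; rewrite (@peel_sg [:: 1; 2] _ _ _ w3 2 3) //; [|lc|exact: l1s|lc].
  rewrite (old_mul _ (vl_sk kz') lz' c3) (sg_old _ _ s2) // w1_mul ?addr0 //.
  by rewrite (@DC1 z' w2) //; [apply: cc_eq0 s2 s3 _ _|exact: s2.1|exact: s3.1].
have c1 y' z' p : Kf y' -> Kf z' -> locB S (vl y') -> locB S (vl z') -> old p ->
    ev (D y' z' w1) p (v 1) = 0.
  move=> ky' kz' ly' lz' op.
  rewrite (@peel_sg [:: 1] _ _ _ w2 1 2) //; [|lc|lc].
  rewrite (old_mul _ (vl_sk ky') ly') => [|p' op']; last exact: c2.
  rewrite (old_mul _ (vl_sk kz') lz') => [|p' op']; last first.
    by rewrite (@DC1 y') //; [exact: c2|exact: s2.1].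
  by rewrite w1_mul ?addr0 // (nu_eq0 ky' kz' ly' lz' s2).
rewrite (@peel_X [::] x y z w1 a 1) //; [|lc|lc|lc|exact: oa (Sv 1)].
rewrite (old_mul _ (vl_sk kx) lx) => [|p op]; last exact: c1.
rewrite (old_mul _ (vl_sk ky) ly) => [|p op]; last exact: c1.
by rewrite (old_mul _ (vl_sk kz) lz) ?addr0 // => p op; apply: c1.
Qed.

End Chain.

Lemma vl_T3 x y z : Kf x -> Kf y -> Kf z -> vl (T3V x y z) = T3Q (vl x) (vl y) (vl z).
Proof.
move=> kx ky kz; apply/subr0_eq/(tm_inj TM) => u a; rewrite ev0 -/(D x y z).
have [[_ [S1 l1]] [_ [S2 l2]] [_ [S3 l3]]] := And3 kx ky kz.
(* Placing [a] in the set to which the chain is orthogonal makes [a] old. *)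
have [b [v ch]] := exists_chain BP infU (a :: S1 ++ S2 ++ S3).
apply: (D_old ch) => //.
- by apply: loc_sub l1 => t /perp_cons[_ /perp_cat[]].
- by apply: loc_sub l2 => t /perp_cons[_ /perp_cat[_ /perp_cat[]]].
- by apply: loc_sub l3 => t /perp_cons[_ /perp_cat[_ /perp_cat[]]].
- by move=> t /perp_cons[].
Qed.

(** * From triple products to the associative envelope *)

Lemma K0_kf n : K0 n -> kf n 0.
Proof. by move=> h; split=> //; exists [::]; apply: loc0. Qed.
Lemma K0_Kf n : K0 n -> Kf n. Proof. by move/K0_kf/kf_Kf. Qed.
Lemma M1_kf x : M1 x -> kf x (r x).
Proof. by move=> h; split; [exact/gd_M/M1_M|exact: M1_loc]. Qed.
Lemma M1_Kf x : M1 x -> Kf x. Proof. by move/M1_kf/kf_Kf. Qed.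
Lemma T3C (X' : lmodType F) (mul : X' -> X' -> X') x y z : T3 mul z y x = T3 mul x y z.
Proof. by rewrite /T3 addrC. Qed.

Lemma kf_cmM x y k : M x -> kf y k -> kf (cmV x y) (cmQ (r x) k).
Proof.
move=> Mx [gy [S ly]]; split; first by apply: gd_cm => //; apply: gd_M.
by have [S' h] := loc_cm_any (r x) S; exists S'; apply: h.
Qed.
Lemma Kf_cmM x y : M x -> Kf y -> Kf (cmV x y).
Proof. by move=> Mx ky; apply: kf_Kf (kf_cmM Mx ky). Qed.
Lemma Kf_cmMr x y : M x -> Kf y -> Kf (cmV y x).
Proof.
move=> Mx ky; have -> : cmV y x = - cmV x y by rewrite /cm opprB.
exact/KfN/Kf_cmM. Qed.

(** The image of [x] need not be local now. In the bracket of [r x] with the triad, computed by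
    [vl_T3], each product has at one end [vl y] or a product of [vl y] with [r x], and these are
    local. *)
Lemma T3_M_letters S x y z : M x -> Kf y -> Kf z ->
  cl S y \/ K0 y /\ (forall x', M1 x' -> Kf (T3V x x' z)) ->
  cl S z \/ K0 z /\ (forall x', M1 x' -> Kf (T3V x x' y)) ->
  Kf (T3V x y z).
Proof.
move=> Mx ky kz hy hz.
have [[gy [S1 ly]] [gz [S2 lz]]] := conj ky kz.
pose S0 := S ++ S1 ++ S2.
have {}ly : locB S0 (vl y) by apply: loc_sub ly => t /perp_cat[_ /perp_cat[]].
have {}lz : locB S0 (vl z) by apply: loc_sub lz => t /perp_cat[_ /perp_cat[]].
have [S' hS'] := tm_loc TM (r x) S0.
have [[ly1 ly2] [lz1 lz2]] := conj (hS' _ ly) (hS' _ lz).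
pose S'' := S0 ++ S'.
have sub : forall t, perp B S'' t -> perp B S t by move=> t /perp_cat[/perp_cat[]].
have [k [gk lk]] : exists k, gd (T3V x y z) k /\ locB S'' k; last first.
  by apply: (@kf_Kf _ k); split=> //; exists S''.
have [sy sz sx] := And3 (Kf_sk ky) (Kf_sk kz) (M_sk Mx).
apply: T3_inner => // x' hx'; have kx' := M1_Kf hx'; have sx' := Kf_sk kx'; split.
- have kT := Kf_T3 ky kz kx'.
  apply: term_M kT.1 Mx _ => u v /perp_cat[u0 u'] /perp_cat[v0 v'].
  rewrite vl_T3 // /cm evD evN /T3 (algDl algQ) (algDr algQ) 2!evD.
  rewrite -!(algA algQ) (loc_mull _ _ ly u0).
  have -> : vl x' ## (vl z ## (vl y ## r x)) = (vl x' ## vl z) ## (vl y ## r x) by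
    rewrite (algA algQ).
  rewrite (loc_mulr _ _ ly2 v').
  have -> : r x ## (vl y ## (vl z ## vl x')) = r x ## vl y ## (vl z ## vl x') by
    rewrite (algA algQ).
  rewrite (loc_mull _ _ ly1 u').
  have -> : r x ## (vl x' ## (vl z ## vl y)) = (r x ## (vl x' ## vl z)) ## vl y.
    by rewrite !(algA algQ).
  by rewrite (loc_mulr _ _ ly v0) !addr0 subrr.
- case: hy => [cy|[ny /(_ x' hx') kT]].
    by apply: term_cl; [exact: sk_T3|exact: cl_sub cy].
  by rewrite T3C in kT; apply: term_K0 kT.1 ny.
- case: hz => [cz|[nz /(_ x' hx') kT]].
    by apply: term_cl; [exact: sk_T3|exact: cl_sub cz].
  have e : T3V x' x y = T3V x x' y + cmV (cmV x' x) y by rewrite /T3 /cm; nca algV.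
  have k : Kf (T3V x' x y) by rewrite e; apply: KfD => //; apply: Kf_cm => //;
    apply: Kf_cmMr.
  exact: term_K0 k.1 nz.
Qed.

Lemma Kf_split y : Kf y -> exists y1 n, [/\ y = y1 + n, M1 y1 & K0 n].
Proof.
move=> [gy [S ly]]; have [|S' [y1 [n [e c k _ _]]]] := kf_split (v := 0) gy ly.
  by move=> s _; rewrite (B0r BP).
by exists y1, n; split=> //; exists S'.
Qed.

Lemma Kf_T3_M x y z : M x -> Kf y -> Kf z -> Kf (T3V x y z).
Proof.
move=> Mx ky kz.
have cc y' z' : M1 y' -> M1 z' -> Kf (T3V x y' z').
  move=> hy hz; have [kz' ky'] := conj (M1_Kf hz) (M1_Kf hy).
  have [[S1 c1] [S2 c2]] := conj hy hz; apply: (@T3_M_letters (S1 ++ S2)) => //; left.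
    by apply: cl_sub c1 => t /perp_cat[].
  by apply: cl_sub c2 => t /perp_cat[].
have cn y' n : M1 y' -> K0 n -> Kf (T3V x y' n).
  move=> hy hn; have [[S c] ky'] := conj hy (M1_Kf hy).
  apply: (@T3_M_letters S) => //; [exact: K0_Kf|by left|right].
  by split=> // x' hx'; apply: cc.
have nc n z' : K0 n -> M1 z' -> Kf (T3V x n z').
  move=> hn hz; have [[S c] kz'] := conj hz (M1_Kf hz).
  apply: (@T3_M_letters S) => //; [exact: K0_Kf|right|by left].
  by split=> // x' hx'; apply: cc.
have nn n m : K0 n -> K0 m -> Kf (T3V x n m).
  move=> hn hm; apply: (@T3_M_letters [::]) => //; try exact: K0_Kf.
    by right; split=> // x' hx'; apply: cn.
  by right; split=> // x' hx'; apply: cn.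
have [y1 [n [-> hy hn]]] := Kf_split ky; have [z1 [m [-> hz hm]]] := Kf_split kz.
have -> : T3V x (y1 + n) (z1 + m) = T3V x y1 z1 + T3V x y1 m + (T3V x n z1 + T3V x n m).
  by rewrite /T3; nca algV.
apply: KfD; first by apply: KfD; [exact: cc|exact: cn].
by apply: KfD; [exact: nc|exact: nn].
Qed.

(* Pairs consisting of an element of the [n.+1]-st power of the associative
   algebra generated by [Kf] and its image. *)
Inductive Rn : nat -> V -> Q -> Prop :=
| Rn_kf x k : kf x k -> Rn 0 x k
| Rn_lin n c x y k l : Rn n x k -> Rn n y l -> Rn n (c *: x + y) (c *: k + l)
| Rn_mull n x k y l : kf x k -> Rn n y l -> Rn n.+1 (x ** y) (k ## l)
| Rn_weak n x k : Rn n.+1 x k -> Rn n x k.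

Lemma Rn00 n : Rn n 0 0.
Proof.
elim: n => [|n IH]; first exact/Rn_kf/kf0.
by rewrite -(alg0l algV 0) -(alg0l algQ 0); apply: Rn_mull kf0 IH.
Qed.
Lemma RnD n x y k l : Rn n x k -> Rn n y l -> Rn n (x + y) (k + l).
Proof. by move=> h h'; have := Rn_lin 1 h h'; rewrite !scale1r. Qed.
Lemma RnZ n c x k : Rn n x k -> Rn n (c *: x) (c *: k).
Proof. by move=> h; have := Rn_lin c h (Rn00 n); rewrite !addr0. Qed.
Lemma RnN n x k : Rn n x k -> Rn n (- x) (- k).
Proof. by rewrite -!scaleN1r; apply: RnZ. Qed.
Lemma RnB n x y k l : Rn n x k -> Rn n y l -> Rn n (x - y) (k - l).
Proof. by move=> h /RnN; apply: RnD. Qed.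
Lemma Rn_leq n m x k : (m <= n)%N -> Rn n x k -> Rn m x k.
Proof.
move=> /subnK <-; elim: (n - m)%N => [|d IH] // h; apply: IH; exact: Rn_weak.
Qed.
Lemma Rn_RF n x k : Rn n x k -> Rn 0 x k. Proof. exact: Rn_leq. Qed.

Lemma RnM n m x y k l : Rn n x k -> Rn m y l -> Rn (n + m).+1 (x ** y) (k ## l).
Proof.
move=> h hy; elim: h => {n x k} [x k hx|n c x x' k k' _ IH _ IH'|n x k x' k' hx _
  IH|n x k _ IH].
- exact: Rn_mull.
- by rewrite (algDl algV) (algZl algV) (algDl algQ) (algZl algQ); apply: Rn_lin.
- by rewrite -(algA algV) -(algA algQ); apply: Rn_mull.
- exact: Rn_weak.
Qed.
Lemma RFM x y k l : Rn 0 x k -> Rn 0 y l -> Rn 0 (x ** y) (k ## l).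
Proof. by move=> h h'; apply/Rn_weak/(RnM h h'). Qed.
Lemma kf_star x k : kf x k -> star x = - x /\ starQ k = - k.
Proof. by move=> [[]]. Qed.
Lemma Rn_star n x k : Rn n x k -> Rn n (star x) (starQ k).
Proof.
elim=> {n x k} [x k hx|n c x x' k k' _ IH _ IH'|n x k x' k' hx _ IH|n x k _ IH].
- by have [-> ->] := kf_star hx; apply/RnN/Rn_kf.
- by rewrite starD starZ starQD starQZ; apply: Rn_lin.
- rewrite starM starQM; have [-> ->] := kf_star hx.
  by have := RnM IH (RnN (Rn_kf hx)); rewrite addn0.
- exact: Rn_weak.
Qed.

Lemma kf_T3Q x y z k l m : kf x k -> kf y l -> kf z m -> kf (T3V x y z) (T3Q k l m).
Proof.
move=> hx hy hz; have [kx ky kz] := And3 (kf_Kf hx) (kf_Kf hy) (kf_Kf hz).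
have := Kf_T3 kx ky kz; rewrite /Kf vl_T3 //.
by rewrite (vl_kf hx) (vl_kf hy) (vl_kf hz).
Qed.
Lemma kf_half x k : kf (x + x) (k + k) -> kf x k.
Proof.
move=> h; have := kfZ 2%:R^-1 h.
by rewrite -!mulr2n -!(scaler_nat 2) !scalerA mulVf // !scale1r.
Qed.

Local Notation jdV := (jd mulV).
Local Notation jdQ := (jd mulQ).

(** Only on skew elements is the image known to be unique. For a skew letter [c], with
    [h = y + star y] and [k = y - star y], twice [c ** y - star (c ** y)] is [jd c h + cm c k], and
    Jordan products with [c ** y + star (c ** y)] reduce to commutators, Jordan products with [h]
    and triads with [k]; so both properties are proved together. *)
Lemma Rn_sym n x k : Rn n x k -> kf (x - star x) (k - starQ k) /\
  forall c g, kf c g -> kf (jdV c (x + star x)) (jdQ g (k + starQ k)).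
Proof.
elim=> {n x k} [x k hx|n a x x' k k' _ [IH1 IH2] _ [IH1' IH2']
               |n x k x' k' hx _ [IH1 IH2]|n x k _ IH] //.
- have [-> ->] := kf_star hx; split=> [|c g _]; first by rewrite !opprK; apply: kfD.
  by rewrite !subrr /jd !(alg0r algV) !(alg0l algV) !(alg0r algQ) !(alg0l algQ)
    !addr0; apply: kf0.
- split=> [|c g hc].
    have e (X' : lmodType F) (u v w t : X') : a *: u + v - (a *: w + t) = a *: (u -
      w) + (v - t).
      by rewrite scalerBr opprD addrACA.
    by rewrite starD starZ starQD starQZ !e; apply: kfP.
  have e (X' : lmodType F) (mul : X' -> X' -> X') (al : assoc_algebra mul) d u v w t :
      jd mul d (a *: u + v + (a *: w + t)) = a *: jd mul d (u + w) + jd mul d (v + t).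
    by rewrite addrACA -scalerDr /jd (algDl al) (algDr al) (algZl al) (algZr al)
      scalerDr addrACA.
  by rewrite starD starZ starQD starQZ (e _ _ algV) (e _ _ algQ); apply: kfP; auto.
have [e1 e2] := kf_star hx; rewrite starM starQM e1 e2; split=> [|c g hc]; apply: kf_half.
  have := kfD (IH2 _ _ hx) (kf_cm hx IH1).
  by congr kf; rewrite /jd /cm; [nca algV|nca algQ].
have h1 := kf_cm hx (IH2 _ _ hc).
have h2 := kfN (IH2 _ _ (kf_cm hx hc)).
have h3 := kfD (kf_T3Q hc hx IH1) (kf_T3Q hc IH1 hx).
have := kfD (kfD h1 h2) h3.
by congr kf; rewrite /jd /cm /T3; [nca algV|nca algQ].
Qed.

(** By [Rn_sym] such a [q] is symmetric and anticommutes with every [X a b oneH]. Passing to a dual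
    pair costs a sign; reaching the second pair directly or through the first makes an entry equal
    to its negative. *)
Lemma Rn_fun0 n q : Rn n 0 q -> q = 0.
Proof.
case/Rn_sym; rewrite star0 subrr addr0 => h1 h2.
have sq : starQ q = q by apply/esym/subr0_eq/(kf_uniq h1)/kf0.
have {h1}h2 a b : jdQ (X a b oneH) q = 0.
  have [x [hx ex]] := M1X a b oneH; have := M1_kf hx; rewrite ex => kx.
  have := h2 _ _ kx; rewrite sq /jd (alg0l algV) (alg0r algV) addr0 => /(kf_uniq kf0).
  by rewrite (algDl algQ) (algDr algQ) addrACA => /esym h; apply: half_eq; rewrite
    h addr0.
have e a u b v : B b a = 0 -> B b u = 0 -> B a v = 0 -> B u a = 1 ->
    ev q b v = - (B b v *: ev q u a).
  move=> ba bu av ua; have := congr1 (fun q => ev q u v) (h2 a b).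
  rewrite ev0 evD ev_Xmul ev_mulX ua (BC0 BP bu) av !mul1H !mulr0 !scale0r scale1r !subr0.
  by move/eqP; rewrite addr_eq0 => /eqP.
apply: (tm_inj TM) => b v; rewrite ev0.
have [[u a] /= [pu pa ua]] := fresh_pair BP infU [:: b; v].
have [bu /perp_cons[vu _]] := (perp_cons _ _ _ _).1 pu.
have [ba /perp_cons[va _]] := (perp_cons _ _ _ _).1 pa.
have [[u' a'] /= [pu' pa' ua']] := fresh_pair BP infU [:: b; v; u; a].
have [bu' /perp_cons[vu' /perp_cons[uu' /perp_cons[au' _]]]] := (perp_cons _ _ _ _).1 pu'.
have [ba' /perp_cons[va' /perp_cons[ua0' /perp_cons[aa' _]]]] := (perp_cons _ _ _
  _).1 pa'.
have e1 := e a u b v ba bu (BC0 BP va) ua.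
have e2 := e a' u' b v ba' bu' (BC0 BP va') ua'.
have e3 := e a' u' u a ua0' uu' (BC0 BP aa') ua'.
by apply: eqN_eq0; rewrite {1}e1 e3 ua scale1r scalerN opprK [in RHS]e2 opprK.
Qed.
Lemma Rn_fun n x k k' : Rn n x k -> Rn n x k' -> k = k'.
Proof. by move=> h h'; apply/subr0_eq/(@Rn_fun0 n); rewrite -(subrr x); apply: RnB. Qed.

Fixpoint word x (l : seq V) := if l is y :: l' then x ** word y l' else x.
Definition Kfs (l : seq V) := forall y, y \in l -> Kf y.

Lemma Rn_word x l : Kf x -> Kfs l -> exists q, Rn (size l) (word x l) q.
Proof.
elim: l x => [|y l IH] x kx kl; first by exists (vl x); apply: Rn_kf.
have [||q hq] := IH y; first by apply: kl; rewrite inE eqxx.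
  by move=> z zl; apply: kl; rewrite inE zl orbT.
by exists (vl x ## q); apply: Rn_mull.
Qed.

Lemma Rn_words n x k : Rn n x k -> exists s : seq (V * seq V),
  x = \sum_(p <- s) word p.1 p.2 /\
  forall p, p \in s -> [/\ Kf p.1, Kfs p.2 & (n <= size p.2)%N].
Proof.
elim=> {n x k} [x k hx|n c x x' k k' _ [s [-> hs]] _ [s' [-> hs']]
               |n x k x' k' hx _ [s [-> hs]]|n x k _ [s [-> hs]]].
- exists [:: (x, [::])]; rewrite big_seq1; split=> // p; rewrite inE => /eqP->.
  by split=> //; exact: kf_Kf hx.
- exists ([seq (c *: p.1, p.2) | p <- s] ++ s'); split.
    rewrite big_cat big_map scaler_sumr; congr (_ + _); apply: eq_bigr => -[y [|z
      l]] _ //=.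
    by rewrite (algZl algV).
  move=> p; rewrite mem_cat => /orP[/mapP[q /hs[h1 h2 h3] ->]|/hs'//].
  by split=> //; apply: KfZ.
- exists [seq (x, p.1 :: p.2) | p <- s]; split; first by rewrite big_map (alg_sumr algV).
  move=> p /mapP[q /hs[h1 h2 h3] ->]; split=> //; first exact: kf_Kf hx.
  by move=> y; rewrite inE => /orP[/eqP->|/h2].
- by exists s; split=> // p /hs[h1 h2 h3]; split=> //; apply: ltnW.
Qed.

Definition inR x := exists k, Rn 0 x k.
Lemma inRP c x y : inR x -> inR y -> inR (c *: x + y).
Proof. by move=> [k h] [l h']; exists (c *: k + l); apply: Rn_lin. Qed.
Lemma inR0 : inR 0. Proof. by exists 0; apply: Rn00. Qed.
Lemma inRD x y : inR x -> inR y -> inR (x + y).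
Proof. by move=> h h'; have := inRP 1 h h'; rewrite scale1r. Qed.
Lemma inRN x : inR x -> inR (- x).
Proof. by move=> h; have := inRP (-1) h inR0; rewrite addr0 scaleN1r. Qed.
Lemma inRM x y : inR x -> inR y -> inR (x ** y).
Proof. by move=> [k h] [l h']; exists (k ## l); apply: RFM. Qed.
Lemma inR_Kf x : Kf x -> inR x. Proof. by exists (vl x); apply: Rn_kf. Qed.
Lemma inR_half x : inR (x + x) -> inR x.
Proof.
move=> h; have := inRP 2%:R^-1 h inR0.
by rewrite addr0 -!mulr2n -!(scaler_nat 2) !scalerA mulVf // !scale1r.
Qed.

Section Multiplier.
Variable x : V.
Hypothesis Mx : M x.

(** On a skew letter this is the commutator with [x], on a product of two skew letters a triad with
    [x]; both are already under control. *)
Definition Tx w := x ** w + star w ** x.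
Lemma TxD w w' : Tx (w + w') = Tx w + Tx w'.
Proof. by rewrite /Tx starD; nca algV. Qed.
Lemma Tx0 : Tx 0 = 0.
Proof. by rewrite /Tx star0 (alg0l algV) (alg0r algV) addr0. Qed.
Lemma TxN w : Tx (- w) = - Tx w.
Proof. by rewrite /Tx starN; nca algV. Qed.

(* On words of length at least three [Tx] is, modulo shorter words, both
   symmetric in the first three letters and antisymmetric under their reversal. *)
Lemma Tx_word n y l : (size l < n)%N -> Kf y -> Kfs l -> inR (Tx (word y l)).
Proof.
elim: n y l => [|n IH] y l //; rewrite ltnS => ln ky kl.
case: l ln kl => [|z [|w l]] ln kl.
- rewrite /Tx /= (Kf_sk ky); apply: inR_Kf.
  by have := Kf_cmM Mx ky; congr Kf; rewrite /cm; nca algV.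
- have kz : Kf z by apply: kl; rewrite inE eqxx.
  rewrite /Tx /= starM (Kf_sk ky) (Kf_sk kz); apply: inR_Kf.
  by have := Kf_T3_M Mx ky kz; congr Kf; rewrite /T3; nca algV.
have kz : Kf z by apply: kl; rewrite inE eqxx.
have kw : Kf w by apply: kl; rewrite !inE eqxx !orbT.
have {}kl : Kfs l by move=> t tl; apply: kl; rewrite !inE tl !orbT.
have kcons a l' : Kf a -> Kfs l' -> Kfs (a :: l').
  by move=> ka kl' t; rewrite inE => /orP[/eqP->|/kl'].
have wl a b : word (a ** b) l = a ** word b l by case: l {ln kl} => //= c l;
  rewrite (algA algV).
have wD a b : word (a + b) l = word a l + word b l by case: l {ln kl wl} => //= c
  l; rewrite (algDl algV).
have e : word y [:: z, w & l] + word y [:: z, w & l] =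
    word (T3V y z w) l + - word (cmV w z) (y :: l) + - word z (cmV w y :: l)
    + - word (cmV z y) (w :: l).
  rewrite /= /T3 /cm wD -!(algA algV) !(wl, wD).
  have wN a : word (- a) l = - word a l by rewrite -scaleN1r; case: l {ln kl wl wD}
    => [|c l] /=; rewrite ?(algZl algV) !scaleN1r.
  by rewrite wN !wl; nca algV.
apply: inR_half; rewrite -TxD e; rewrite !(TxD, TxN).
have s2 : (size l < n)%N by apply: leq_trans ln => /=; lia.
have s1 a : (size (a :: l) < n)%N by [].
apply: inRD; last by apply/inRN/IH => //; [apply: Kf_cm|apply: kcons].
apply: inRD; last by apply/inRN/IH => //; apply: kcons => //; apply: Kf_cm.
apply: inRD; last by apply/inRN/IH => //; [apply: Kf_cm|apply: kcons].
by apply: IH => //; apply: Kf_T3.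
Qed.

Lemma inR_Tx w : inR w -> inR (Tx w).
Proof.
move=> [k /Rn_words[s [-> hs]]]; rewrite big_seq; elim/big_ind: _ => [|a b ha hb|p
  /hs[h1 h2 _]].
- by rewrite Tx0; apply: inR0.
- by rewrite TxD; apply: inRD.
- exact: (@Tx_word (size p.2).+1).
Qed.
Lemma inR_star w : inR w -> inR (star w).
Proof. by move=> [k h]; exists (starQ k); apply: Rn_star. Qed.

(** [Tx] of [star a], of [star b] and of their product are combined so that all terms with [x] on
    the left or in the middle cancel. *)
Lemma inR_jd a b : inR a -> inR b -> inR (jdV a b ** x).
Proof.
move=> ha hb; have [ra rb] := conj (inR_star ha) (inR_star hb).
have h1 := inRM (inR_Tx ra) rb; have h2 := inRM ha (inR_Tx rb).
have h3 := inR_Tx (inRM ra rb).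
have := inRD (inRN h1) (inRD h2 h3); congr inR.
by rewrite /Tx starM !starK /jd; nca algV.
Qed.

(** Five symmetrized products add up to twice [a ** b ** c]. This is why the third power, which is
    [Rn 2], is the one multiplied by [M]. *)
Lemma inR_mul3 a b c : inR a -> inR b -> inR c -> inR (a ** b ** c ** x).
Proof.
move=> ha hb hc; apply: inR_half.
have h1 := inR_jd (inRM ha hb) hc; have h2 := inRM hc (inR_jd ha hb).
have h3 := inR_jd (inRM hb ha) hc; have h4 := inRM hb (inR_jd ha hc).
have h5 := inR_jd (inRM hb hc) ha.
have := inRD (inRD h1 (inRN h2)) (inRD (inRD h3 (inRN h4)) h5); congr inR.
by rewrite /jd; nca algV.
Qed.

Lemma Rn2_inR w k : Rn 2 w k -> inR (w ** x).
Proof.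
move=> /Rn_words[s [-> hs]]; rewrite (alg_suml algV) big_seq.
elim/big_ind: _ => [|a b|[y [|z [|t l]]] /hs[] //= ky kl _]; [exact: inR0|exact: inRD|].
rewrite (algA algV); apply: inR_mul3; [exact: inR_Kf|by apply/inR_Kf/kl; rewrite
  inE eqxx|].
have [||q hq] := @Rn_word t l; first by apply: kl; rewrite !inE eqxx orbT.
  by move=> u ul; apply: kl; rewrite !inE ul !orbT.
by exists q; apply: Rn_RF hq.
Qed.

(* [d] measures how far multiplication by [x] is from being represented by [r x]. *)
Definition gap_of w q d := Rn 2 w q /\ Rn 0 (w ** x) (q ## r x + d).

Lemma gap_ex w q : Rn 2 w q -> exists d, gap_of w q d.
Proof.
move=> h; have [k hk] := Rn2_inR h; exists (k - q ## r x); split=> //.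
by rewrite addrC subrK.
Qed.
Lemma gap_fun w w' q q' d d' : gap_of w q d -> gap_of w' q' d' -> w = w' -> d = d'.
Proof.
move=> [h1 h2] [h3 h4] e; rewrite -e in h3 h4.
by have := Rn_fun h2 h4; rewrite (Rn_fun h1 h3) => /addrI.
Qed.
Lemma Rn_cm n c k : Rn n c k -> Rn 0 (cmV x c) (cmQ (r x) k).
Proof.
elim=> {n c k} [c k hc|n a c c' k k' _ IH _ IH'|n c k c' k' hc hc' IH|n c k _ IH] //.
- exact/Rn_kf/kf_cmM.
- by rewrite (cmDr algV) (cmZr algV) (cmDr algQ) (cmZr algQ); apply: Rn_lin.
have h1 := RFM (Rn_kf (kf_cmM Mx hc)) (Rn_RF hc').
have h2 := RFM (Rn_kf hc) IH.
by have := RnD h1 h2; congr Rn; rewrite /cm; [nca algV|nca algQ].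
Qed.
Lemma gap_mull c k w q d : Rn 0 c k -> gap_of w q d -> gap_of (c ** w) (k ## q) (k ## d).
Proof.
move=> hc [h1 h2]; split; first by apply/Rn_weak/(RnM hc h1).
by have := RFM hc h2; rewrite (algA algV) (algDr algQ) (algA algQ).
Qed.
Lemma gap_mulr c k w q d : Rn 0 c k -> gap_of w q d -> gap_of (w ** c) (q ## k) (d ## k).
Proof.
move=> hc [h1 h2]; split.
  by have := RnM h1 hc; rewrite addn0 => /Rn_weak.
have := RnB (RFM h2 hc) (RFM (Rn_RF h1) (Rn_cm hc)).
by congr Rn; rewrite /cm; [nca algV|nca algQ].
Qed.
Lemma gap_star w q d : gap_of w q d -> gap_of (star w) (starQ q) (- starQ d).
Proof.
move=> [h1 h2]; split; first exact: Rn_star.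
have h3 := Rn_star h2; have h4 := Rn_cm (Rn_RF (Rn_star h1)).
have := RnN (RnD h3 h4); rewrite starM starQD starQM (M_sk Mx) (rS Mx).
by congr Rn; rewrite /cm; [nca algV|nca algQ].
Qed.
(** The gap of [w ** c ** w'] is computed from that of [w] by right multiplication and from that of
    [w'] by left multiplication. *)
Lemma gap_comm w q d w' q' d' c k : gap_of w q d -> gap_of w' q' d' -> Rn 0 c k ->
  d ## k ## q' = q ## k ## d'.
Proof.
move=> h h' hc; have [rw rw'] := conj (Rn_RF h.1) (Rn_RF h'.1).
apply: gap_fun (gap_mulr rw' (gap_mulr hc h)) (gap_mull (RFM rw hc) h') _.
by [].
Qed.

Lemma ev_mulelmul p q a b u v :
  ev (p ## el a b oneH ## q) u v = mulH (ev q b v) (ev p u a).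
Proof.
have [[y0 v0] /= [_ _ e]] := fresh_pair BP infU [::].
rewrite -(algA algQ) (@tm_mulr _ _ _ _ _ _ _ _ _ _ _ TM p _ (el a y0 (ev q b v)) u
  v v0) => [|t].
  by rewrite (tm_mulel TM) e scale1r.
by rewrite (tm_elmul TM) (tm_el TM) e mulr1 mul1H.
Qed.
End Multiplier.

Lemma RX a b h : exists x, Rn 0 x (X a b h).
Proof.
by have [x [hx <-]] := M1X a b h; exists x; apply/Rn_kf/M1_kf.
Qed.

(** For fresh dual pairs the product of [X a c], [X c' d] and [X d' b] has rank one, and rank-one
    elements are products of rank-one elements, so they occur in every power. *)
Lemma Rn_el n a b : exists x, Rn n x (el a b oneH).
Proof.
suff [m [nm [x hx]]] : exists m, (n <= m)%N /\ exists x, Rn m x (el a b oneH).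
  by exists x; apply: Rn_leq hx.
elim: n a b => [|n IH] a b.
  have [[c c'] /= [pc pc' cc']] := fresh_pair BP infU [:: a; b].
  have [ac /perp_cons[bc _]] := (perp_cons _ _ _ _).1 pc.
  have [ac' /perp_cons[bc' _]] := (perp_cons _ _ _ _).1 pc'.
  have [[d d'] /= [pd pd' dd']] := fresh_pair BP infU [:: a; b; c; c'].
  have [ad /perp_cons[bd /perp_cons[cd /perp_cons[c'd _]]]] := (perp_cons _ _ _ _).1 pd.
  have [ad' /perp_cons[bd' /perp_cons[cd' /perp_cons[c'd' _]]]] := (perp_cons _ _ _
    _).1 pd'.
  have [x1 h1] := RX a c oneH; have [x2 h2] := RX c' d oneH; have [x3 h3] := RX d' b oneH.
  have := RFM (RFM h1 h2) h3; set q := (X in Rn _ _ X) => hq.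
  have -> : el a b oneH = q; last by exists 0%N; split=> //; exists (x1 ** x2 ** x3).
  apply: (tm_inj TM) => u v; rewrite /q ev_mulX !ev_mulX !ev_X (tm_el TM) !mul1H.
  rewrite cc' dd' (BC0 BP bd).
  rewrite c'd' (BC0 BP bc') ac' !(mulr0, scale0r, subr0, scaler0) !mulr1 scale1r scalerA.
  by rewrite mulrC.
have [[c c'] /= [_ _ cc']] := fresh_pair BP infU [::].
have [m [nm [x hx]]] := IH a c; have [m' [_ [x' hx']]] := IH c' b.
exists (m + m').+1; split; first by lia.
exists (x ** x'); have := RnM hx hx'; congr Rn.
apply: (tm_inj TM) => u v; rewrite (tm_elmul TM) !(tm_el TM) mul1H scalerA.
by congr (_ *: _); rewrite cc' mul1r.
Qed.

(* For [w] with image [q], [gap_comm] with [star w] in place of [w'] gives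
   [d Y q* = - q Y d*] for all rank-one [Y], which forces [d = 0] when [q] has
   rank one, and then [gap_comm] again transports this to every [w]. *)
Lemma gap_eq0 x w q d : M x -> gap_of x w q d -> d = 0.
Proof.
move=> Mx hw.
have [[b u] /= [_ _ bu]] := fresh_pair BP infU [::].
have [w0 h0] := Rn_el 2 u b; have [d0 g0] := gap_ex Mx h0.
have e0 : ev (el u b oneH) b u = oneH.
  by rewrite (tm_el TM) bu mulr1 scale1r.
have d00 : d0 = 0.
  have gs := gap_star Mx g0.
  have key v y v' y' : mulH (ev (el u b oneH) v' y') (ev d0 v y) = - mulH (ev d0 v'
    y') (ev (el u b oneH) v y).
    have [c hc] := Rn_el 0 y y'.
    have := congr1 (fun q => ev q v v') (gap_comm Mx g0 gs hc).
    rewrite !ev_mulelmul evN !(tm_star TM) (algNl algH) !(algZl algH).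
    by rewrite -scalerN => /(scalerI (eps_neq0 BP)).
  have k0 : ev d0 b u = 0.
    by apply: eqN_eq0; have := key b u b u; rewrite e0 mul1H (mulHC _ oneH) mul1H.
  apply: (tm_inj TM) => v y; rewrite ev0; have := key v y b u.
  by rewrite e0 k0 mul1H (alg0l algH) oppr0.
rewrite d00 in g0; apply: (tm_inj TM) => v y; rewrite ev0.
have [c hc] := Rn_el 0 y b.
have := congr1 (fun q => ev q v u) (gap_comm Mx hw g0 hc).
by rewrite ev_mulelmul e0 mul1H (alg0r algQ) ev0.
Qed.

Lemma Rn2_M x w q : M x -> Rn 2 w q -> Rn 0 (w ** x) (q ## r x).
Proof.
move=> Mx h; have [d g] := gap_ex Mx h.
by have := g.2; rewrite (gap_eq0 Mx g) addr0.
Qed.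

Lemma Rn_M m x w q : M x -> Rn m.+3 w q -> Rn m (w ** x) (q ## r x).
Proof.
move=> Mx; move e: m.+3 => n h.
elim: h m e => {n w q} [w k hw|n c w w' k k' _ IH _ IH'|n w k w' k' hw hw' IH|n w k
  _ IH] m //= e.
- by rewrite (algDl algV) (algZl algV) (algDl algQ) (algZl algQ); apply: Rn_lin; auto.
- rewrite -(algA algV) -(algA algQ).
  case: m e => [|m] [e]; last by apply: Rn_mull => //; apply: IH.
  by apply/Rn_weak/Rn_mull => //; apply: Rn2_M => //; rewrite e.
- by apply/Rn_weak/IH; rewrite e.
Qed.

Inductive Gr : V -> Q -> Prop :=
| Gr_M x : M x -> Gr x (r x)
| Gr_lin c x y k l : Gr x k -> Gr y l -> Gr (c *: x + y) (c *: k + l)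
| Gr_mul x y k l : Gr x k -> Gr y l -> Gr (x ** y) (k ## l).

(** Each multiplication by an element of [M] lowers the power by a fixed amount, so the depth [n]
    needed depends on how the pair was generated. *)
Lemma Gr_good x k : Gr x k ->
  forall m, exists n, forall w q, Rn n w q -> Rn m (w ** x) (q ## k).
Proof.
elim=> {x k} [x Mx|c x y k l _ IH _ IH'|x y k l _ IH _ IH'] m.
- by exists m.+3 => w q; apply: Rn_M.
- have [[n hn] [n' hn']] := conj (IH m) (IH' m); exists (n + n')%N => w q h.
  rewrite (algDr algV) (algZr algV) (algDr algQ) (algZr algQ); apply: Rn_lin.
    by apply/hn/(Rn_leq (leq_addr _ _) h).
  by apply/hn'/(Rn_leq (leq_addl _ _) h).
have [n' hn'] := IH' m; have [n hn] := IH n'; exists n => w q /hn/hn'.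
by rewrite (algA algV) (algA algQ).
Qed.

Lemma Gr_fun x k l : Gr x k -> Gr x l -> k = l.
Proof.
move=> h h'; apply/esym/subr0_eq; have := Gr_lin (-1) h h'.
rewrite !scaleN1r addNr addrC => /Gr_good/(_ 0%N)[n hn].
apply: (tm_inj TM) => u v; rewrite ev0.
have [[b a] /= [_ _ ba]] := fresh_pair BP infU [::].
have [w hw] := Rn_el n a u; have := hn _ _ hw; rewrite (alg0r algV).
move=> /Rn_fun0 /(congr1 (fun q => ev q b v)).
by rewrite (tm_elmul TM) ba scale1r mul1H ev0.
Qed.

End Skew.

(** * Lie ideals containing all rank-two skew elements *)

Section Ideal.
Variables (P : Q -> Prop) (l : U -> U) (ql : Q).
Hypothesis PP : forall c q q', P q -> P q' -> P (c *: q + q').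
Hypothesis Pcm : forall a b q, P q -> P (cm mulQ (X a b oneH) q).
Hypothesis Pl : P ql.
Hypothesis evl : forall u v, ev ql u v = B u (l v) *: oneH.
Hypothesis lskew : forall u v, B (l u) v = - B u (l v).

Lemma ideal_P0 : P 0.
Proof. by have := PP (-1) Pl Pl; rewrite scaleN1r addNr. Qed.
Lemma ideal_PZ c q : P q -> P (c *: q).
Proof. by move=> h; have := PP c h ideal_P0; rewrite addr0. Qed.
Lemma ideal_PD q q' : P q -> P q' -> P (q + q').
Proof. by move=> h h'; have := PP 1 h h'; rewrite scale1r. Qed.
Lemma ideal_PZV c q : c != 0 -> P (c *: q) -> P q.
Proof. by move=> c0 /(ideal_PZ c^-1); rewrite scalerA mulVf // scale1r. Qed.
Lemma ideal_cmr a b q : P q -> P (cm mulQ q (X a b oneH)).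
Proof.
move=> h; have -> : cm mulQ q (X a b oneH) = -1 *: cm mulQ (X a b oneH) q.
  by rewrite scaleN1r /cm opprB.
exact/ideal_PZ/Pcm.
Qed.
Lemma cm_ql a b : cm mulQ ql (X a b oneH) = X (l a) b oneH + X a (l b) oneH.
Proof.
apply: (tm_inj TM) => u v; rewrite ev_cmX1 evD !ev_X !evl !scalerA -!scalerBl -!scalerDl.
congr (_ *: _).
have e x y : B x (l y) = - (eps * B (l y) x * -1) by rewrite (BC BP (l y) x); ring.
have f x y : B (l x) y = - B x (l y) by apply: lskew.
rewrite (BC BP u b) (BC BP u a) !f.
have := epsK BP; set X1 := B u (l a); set X2 := B u (l b).
by move=> e2; ring: e2.
Qed.

(* Two brackets with far vectors already cut [l] down to a nonzero multiple of
   some [X b d 1]. *)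
Lemma ideal_X : (exists a c, B a c = 0 /\ B (l a) c != 0) -> forall a b, P (X a b oneH).
Proof.
move=> [a [c [ac lac]]].
have mulH11 : mulH oneH oneH = oneH by rewrite mul1H.
have far : exists S, forall b, perp B S b -> exists T, forall d, perp B T d ->
    P (X b d oneH).
  exists [:: a; c; l a; l c] => b /perp_cons[ab /perp_cons[cb /perp_cons[lab
    /perp_cons[lcb _]]]].
  exists [:: a; c; l a; l b; b] => d /perp_cons[ad /perp_cons[cd /perp_cons[lad
    /perp_cons[lbd /perp_cons[bd _]]]]].
  have := ideal_cmr c d (ideal_cmr a b Pl).
  rewrite cm_ql (cmDl algQ) !cmXX mulH11.
  have lbc : B (l b) c = 0 by rewrite lskew (BC0 BP lcb) oppr0.
  rewrite (BC0 BP cb) bd lad ad lbc ac lbd !mulr0 !scale0r !subr0 !addr0 sub0r.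
  rewrite -scaleNr; apply: ideal_PZV.
  by rewrite oppr_eq0 mulf_neq0 ?(eps_neq0 BP).
have {far} [S hS] := far.
(* A bracket with [X d' g] trades the far vector [d] for any [g] orthogonal to [b]. The same device
   then replaces [b], and [X_perfect] removes the remaining orthogonality. *)
have far1 b g : perp B S b -> B b g = 0 -> P (X b g oneH).
  move=> bS bg; have [T hT] := hS _ bS.
  have [[d d'] /= [pd pd' dd']] := fresh_pair BP infU (b :: g :: T).
  have [bd /perp_cons[gd Td]] := (perp_cons _ _ _ _).1 pd.
  have [bd' _] := (perp_cons _ _ _ _).1 pd'.
  have := ideal_cmr d' g (hT _ Td); rewrite cmXX mulH11 dd' bd' (BC0 BP gd) bg.
  by rewrite mulr0 !scale0r !subr0 addr0 scale1r.
have orth e g : B e g = 0 -> P (X e g oneH).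
  move=> eg; have [[b b'] /= [pb pb' bb']] := fresh_pair BP infU (e :: g :: S).
  have [eb /perp_cons[gb Sb]] := (perp_cons _ _ _ _).1 pb.
  have [eb' _] := (perp_cons _ _ _ _).1 pb'.
  have := ideal_cmr b' g (far1 _ _ Sb (BC0 BP eb)).
  rewrite cmXX mulH11 eb' bb' eg (BC0 BP gb) !mulr0 mulr1 !scale0r sub0r subr0 !addr0.
  by rewrite -scaleNr; apply: ideal_PZV; rewrite oppr_eq0 (eps_neq0 BP).
move=> a0 b0; have [[d d'] /= [pd pd' dd']] := fresh_pair BP infU [:: a0; b0].
have [ad /perp_cons[bd _]] := (perp_cons _ _ _ _).1 pd.
have [ad' /perp_cons[bd' _]] := (perp_cons _ _ _ _).1 pd'.
apply: (@ideal_PZV 2%:R) => //; rewrite scaler_nat mulr2n (X_perfect _ dd' pd pd').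
apply: ideal_PD; first by apply/ideal_cmr/orth.
by apply/ideal_PZ/ideal_cmr/orth.
Qed.
End Ideal.

End Tensor.

(** * The concrete model *)

Section Separation.
Variables (F : fieldType) (H : lmodType F).

(** Needed because tensors are compared through functionals on an arbitrary [H]. A maximal subspace
    avoiding [h] is a complement of the line of [h], and the coefficient along [h] is the
    functional. *)
Lemma separating_functional (h : H) : h != 0 -> exists g, lin_fun g /\ g h != 0.
Proof.
move=> h0; pose P (N : set H) := (forall c x y, N x -> N y -> N (c *: x + y)) /\ ~ N h.
have [N [[Nlin Nh] Nmax]] : exists N, P N /\ forall N', (N `<` N')%classic -> ~ P N'.
  apply: Zorn_bigcup => C CP Ctot; split=> [c x y [X CX Xx] [Y CY Yy]|[X CX Xh]];
    last first.
    by have [_] : P X := CP _ CX; apply.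
  case: (Ctot _ _ CX CY) => sub.
    by exists Y => //; have [+ _] : P Y := CP _ CY; apply; [apply: sub|].
  by exists X => //; have [+ _] : P X := CP _ CX; apply; [|apply: sub].
(* [P] has to admit the empty set, the union of the empty chain; that [N] contains zero follows from
   maximality. *)
have N0 : N 0.
  apply: contrapT => n0; apply: (Nmax (N `|` [set 0])%classic).
    by split=> [x Nx|s]; [left|apply/n0/s; right].
  split=> [c x y|[//|/eqP]]; last by rewrite (negPf h0).
  have NZ z : N z -> N 0 by move=> Nz; have := Nlin (-1) _ _ Nz Nz; rewrite
    scaleN1r addNr.
  by move=> [/NZ//|->] [/NZ//|->]; right; rewrite scaler0 addr0.
have NZ c x : N x -> N (c *: x) by move=> Nx; have := Nlin c _ _ Nx N0; rewrite addr0.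
have dec x : exists c, N (x - c *: h).
  have [Nx|nNx] := pselect (N x); first by exists 0; rewrite scale0r subr0.
  pose N' y := exists c n, N n /\ y = c *: x + n.
  have [c [n [Nn e]]] : N' h.
    apply: contrapT => nN'h; apply: (Nmax N'); last first.
      split=> // c _ _ [a [n [Nn ->]]] [a' [n' [Nn' ->]]].
      exists (c * a + a'), (c *: n + n'); split; first exact: Nlin.
      by rewrite scalerDr scalerA scalerDl addrACA.
    split=> [y Ny|s]; first by exists 0, y; rewrite scale0r add0r.
    by apply/nNx/s; exists 1, 0; rewrite scale1r addr0.
  have c0 : c != 0 by apply/eqP => c0; apply: Nh; rewrite e c0 scale0r add0r.
  exists c^-1; rewrite e scalerDr scalerA mulVf // scale1r opprD addrA subrr add0r.
  by rewrite -scaleN1r scalerA; apply: NZ.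
have [g gP] := choice dec.
have uniq x c c' : N (x - c *: h) -> N (x - c' *: h) -> c = c'.
  move=> h1 h2; apply/eqP; rewrite -subr_eq0; apply/negPn/negP => d0; apply: Nh.
  have := NZ (c - c')^-1 _ (Nlin (-1) _ _ h1 h2).
  have -> : -1 *: (x - c *: h) + (x - c' *: h) = (c - c') *: h.
    by rewrite scaleN1r opprB addrA subrK scalerBl.
  by rewrite scalerA mulVf // scale1r.
exists g; split=> [c x y|].
  apply: (@uniq (c *: x + y)); first exact: gP.
  have := Nlin c _ _ (gP x) (gP y).
  by rewrite scalerBr addrACA -opprD scalerA -scalerDl.
rewrite (@uniq h (g h) 1) ?oner_neq0 //; by rewrite scale1r subrr.
Qed.

End Separation.

Section SubspaceType.
Variables (F : fieldType) (W : lmodType F) (P : W -> Prop).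
(** The closure proof is an argument, so that the predicate carries what its submodule structure
    requires. *)
Definition subspace_pred of is_subspace P : {pred W} := fun x => `[<P x>].
Variable PP : is_subspace P.
Lemma subspace_pred_closed : submod_closed (subspace_pred PP).
Proof.
split; first by apply/asboolP; case: PP.
by move=> c x y /asboolP Px /asboolP Py; apply/asboolP; case: PP => _; apply.
Qed.
HB.instance Definition _ :=
  GRing.isSubmodClosed.Build F W (subspace_pred PP) subspace_pred_closed.
Record subspace_type :=
  SubspaceType { subspace_val : W; _ : subspace_val \in subspace_pred PP }.
HB.instance Definition _ := [isSub for subspace_val].
HB.instance Definition _ := [Choice of subspace_type by <:].
HB.instance Definition _ := [SubChoice_isSubLmodule of subspace_type by <:].
End SubspaceType.

(** * The form attached to the involution *)

Section EndForm.
Variables (F : fieldType) (U : lmodType F) (Pi : (U -> F) -> Prop).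
Variables (A : (U -> U) -> Prop) (phi : (U -> U) -> U -> U).
Hypothesis infU : infinite_dim U.
Hypothesis dualPi : dual_subspace Pi.
Hypothesis totalPi : is_total Pi.
Hypothesis algA' : end_algebra A.
Hypothesis FPiA : forall a, FPi Pi a -> A a.
Hypothesis invA : end_involution A phi.

Lemma A_lin f : A f -> lin_map f. Proof. by case: algA' => + _; apply. Qed.
Lemma A_comp f g : A f -> A g -> A (f \o g).
Proof. by case: algA' => _ [_ [_]]; apply. Qed.
Lemma A_fadd c f g : A f -> A g -> A (fadd (fscale c f) g).
Proof. by case: algA' => _ [_ []]; auto. Qed.
Lemma A_zero : A (@fzero F U). Proof. by case: algA' => _ []. Qed.
Lemma A_linD f x y : A f -> f (x + y) = f x + f y.
Proof. by move=> /A_lin/(_ 1 x y); rewrite !scale1r. Qed.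
Lemma A_lin0 f : A f -> f 0 = 0.
Proof. by move=> Af; apply: (addrI (f 0)); rewrite -A_linD // !addr0. Qed.
Lemma A_linZ f c x : A f -> f (c *: x) = c *: f x.
Proof. by move=> Af; have := A_lin Af c x 0; rewrite (A_lin0 Af) !addr0. Qed.
Lemma A_scale c f : A f -> A (fun x => c *: f x).
Proof.
move=> Af; have := A_fadd c Af A_zero; congr A.
by apply: funext => x; rewrite /fadd /fscale /fzero addr0.
Qed.
Lemma phi_A f : A f -> A (phi f). Proof. by case: invA => + _; apply. Qed.
Lemma phi_fadd c f g : A f -> A g ->
  phi (fadd (fscale c f) g) = fadd (fscale c (phi f)) (phi g).
Proof. by case: invA => _ [+ _]; apply. Qed.
Lemma phiM f g : A f -> A g -> phi (f \o g) = phi g \o phi f.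
Proof. by case: invA => _ [_ [+ _]]; apply. Qed.
Lemma phiK f : A f -> phi (phi f) = f. Proof. by case: invA => _ [_ [_]]; apply. Qed.
Lemma phi0 : phi (@fzero F U) = @fzero F U.
Proof.
have := phi_fadd (-1) A_zero A_zero.
have -> : fadd (fscale (-1) (@fzero F U)) (@fzero F U) = @fzero F U.
  by apply: funext => x; rewrite /fadd /fscale /fzero scaler0 addr0.
by move=> ->; apply: funext => x; rewrite /fadd /fscale scaleN1r addNr.
Qed.
Lemma phi_scale c f : A f -> phi (fun x => c *: f x) = fun x => c *: phi f x.
Proof.
move=> Af; have := phi_fadd c Af A_zero; rewrite phi0.
have -> : fadd (fscale c f) (@fzero F U) = fun x => c *: f x.
  by apply: funext => x; rewrite /fadd /fscale /fzero addr0.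
by move=> ->; apply: funext => x; rewrite /fadd /fscale /fzero addr0.
Qed.

Lemma Pi_A f u : Pi f -> A (fun x => f x *: u).
Proof.
move=> Pf; apply: FPiA; exists [:: (f, u)]; split; first by case.
by apply: funext => x; rewrite big_seq1.
Qed.
Lemma Pi_lin f : Pi f -> lin_fun f. Proof. by case: dualPi => + _; apply. Qed.
Lemma Pi_norm v : v != 0 -> exists f, Pi f /\ f v = 1.
Proof.
move=> /totalPi[f [Pf nz]]; exists (fun u => (f v)^-1 * f u); split; last by
  rewrite mulVf.
case: dualPi => _ [P0 PP]; have := PP (f v)^-1 _ _ Pf P0; congr Pi.
by apply: funext => x; rewrite addr0.
Qed.

(* [phi] maps the rank-one operators [f0(.) u] to operators of rank one with a
   common image [F v1], and the coefficient of [v1] is the form. *)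
Lemma end_form : exists (B : U -> U -> F) (eps : F),
  [/\ form_axioms B eps, forall x, A x -> forall u w, B (x u) w = B u (phi x w)
    & forall u w, A (fun x => B w x *: u)].
Proof.
have [v0 nv0] := infU [::].
have v00 : v0 != 0.
  by apply/eqP => e; apply: nv0; exists (fun=> 0); rewrite e big_ord0.
have [f0 [Pf0 f0v0]] := Pi_norm v00.
pose a u : U -> U := fun x => f0 x *: u.
have Aa u : A (a u) by apply: Pi_A.
pose p := phi (a v0).
have Ap : A p by apply: phi_A.
have f0Z c x : f0 (c *: x) = c * f0 x.
  have f00 : f0 0 = 0.
    have := Pi_lin Pf0 1 0 0; rewrite scale1r addr0 mul1r => e.
    by apply: (addrI (f0 0)); rewrite -e addr0.
  by have := Pi_lin Pf0 c x 0; rewrite !addr0 f00 addr0.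
have phi_neq0 u : u != 0 -> exists x, phi (a u) x != 0.
  move=> u0; apply: contrapT => h; move/eqP: u0; apply.
  have e : phi (a u) = @fzero F U.
    by apply: funext => x; apply/eqP/negPn/negP => nz; apply: h; exists x.
  have := phiK (Aa u); rewrite e phi0 => /(congr1 (fun f => f v0)).
  by rewrite /a f0v0 scale1r.
have [x0 px0] := phi_neq0 _ v00; rewrite -/p in px0.
pose v1 := p x0; have [f [Pf fv1]] := Pi_norm px0; rewrite -/v1 in fv1.
have fZ c x : f (c *: x) = c * f x.
  have f00 : f 0 = 0.
    have := Pi_lin Pf 1 0 0; rewrite scale1r addr0 mul1r => e.
    by apply: (addrI (f 0)); rewrite -e addr0.
  by have := Pi_lin Pf c x 0; rewrite !addr0 f00 addr0.
(* Any operator of [A] placed between two copies of [a v0] gives a multiple of [a v0]. Applying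
   [phi], with a suitable middle operator, shows that the image of [p] is the line of [v1]. *)
have pE w : p w = f (p w) *: v1.
  have Ay : A (fun x => f x *: w) by apply: Pi_A.
  have e : a v0 \o phi (fun x => f x *: w) \o a v0 =
           fun x => f0 (phi (fun x => f x *: w) v0) *: a v0 x.
    apply: funext => x; rewrite /a /= (A_linZ _ _ (phi_A Ay)) f0Z.
    by rewrite scalerA mulrC.
  have Ac := A_comp (Aa v0) (phi_A Ay); have := congr1 phi e.
  rewrite (phi_scale _ (Aa v0)) (phiM Ac (Aa v0)) (phiM (Aa v0) (phi_A Ay)) (phiK Ay).
  move=> /(congr1 (fun f => f x0)) /=; rewrite -/p -/v1 fv1 scale1r => ->.
  by rewrite fZ fv1 mulr1.
have aE u : a u = a u \o a v0.
  by apply: funext => x; rewrite /a /= f0Z f0v0 mulr1.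
pose B u x := f (phi (a u) x).
have phiE u x : phi (a u) x = B u x *: v1.
  by rewrite /B aE (phiM (Aa u) (Aa v0)) /= -/p -pE.
have BDZl c x y z : B (c *: x + y) z = c * B x z + B y z.
  have e : a (c *: x + y) = fadd (fscale c (a x)) (a y).
    by apply: funext => t; rewrite /a /fadd /fscale scalerDr !scalerA mulrC.
  by rewrite /B e phi_fadd // /fadd /fscale (Pi_lin Pf).
have Badj x : A x -> forall u w, B (x u) w = B u (phi x w).
  move=> Ax u w; have e : a (x u) = x \o a u.
    by apply: funext => t; rewrite /a /= A_linZ.
  by rewrite /B e (phiM Ax (Aa u)).
have v10 : v1 != 0 by [].
(* [phi] sends [phi (a w) \o a u] to [phi (a u) \o a w]; both are multiples of [a v1], so [B w u]
   and [B u w] differ by a fixed factor, which will be [eps]. *)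
have key w u x : B w u * B v1 x = B u w * f0 x.
  have e : phi (a w) \o a u = fun x => B w u *: a v1 x.
    by apply: funext => t; rewrite /= {2}/a (A_linZ _ _ (phi_A (Aa w))) phiE /a
      !scalerA mulrC.
  have e' : phi (a u) \o a w = fun x => B u w *: a v1 x.
    by apply: funext => t; rewrite /= {2}/a (A_linZ _ _ (phi_A (Aa u))) phiE /a
      !scalerA mulrC.
  have := congr1 phi e; rewrite (phi_scale _ (Aa v1)) (phiM (phi_A (Aa w)) (Aa u))
    (phiK (Aa w)).
  rewrite e' => /(congr1 (fun f => f x)); rewrite phiE /a !scalerA.
  move/(congr1 f)/esym; rewrite /= !fZ fv1 !mulr1.
  by move=> ->.
have BC' x y : B y x = B v1 v0 * B x y.
  by have := key x y v0; rewrite f0v0 mulr1 mulrC.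
have nd u : u != 0 -> exists v, B u v != 0.
  move=> /phi_neq0[x]; rewrite phiE scaler_eq0 negb_or => /andP[nz _].
  by exists x.
exists B, (B v1 v0); split=> //.
  split=> //.
  have [w] := nd _ v00 => nz.
  apply: (mulIf nz); rewrite mul1r -mulrA -BC' -BC' //.
move=> u w; have := A_comp (Pi_A u Pf) (phi_A (Aa w)).
by [].
Qed.

(** * Tensors as matrices *)

Section Model.
Variables (B : U -> U -> F) (eps : F) (H : lmodType F) (mulH : H -> H -> H) (oneH : H).
Hypothesis BP : form_axioms B eps.
Hypothesis Badj : forall x, A x -> forall u w, B (x u) w = B u (phi x w).
Hypothesis Bel : forall u w, A (fun x => B w x *: u).
Hypothesis HP : unital_comm_algebra mulH oneH.

Let algH : assoc_algebra mulH. Proof. by case: HP. Qed.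
Let mHC x y : mulH x y = mulH y x. Proof. by case: HP => _ []. Qed.
Let m1H x : mulH oneH x = x. Proof. by case: HP => _ []. Qed.

Lemma Badjr x : A x -> forall u w, B u (x w) = B (phi x u) w.
Proof. by move=> Ax u w; rewrite Badj ?phiK //; exact: phi_A. Qed.

Lemma firsts_cons (S : (U -> U) -> Prop) (p : (U -> U) * H) t :
  firsts_in S (p :: t) <-> S p.1 /\ firsts_in S t.
Proof.
split=> [h|[h1 h2] [|i] //= /h2 //].
by split=> [|i it]; [exact: (h 0%N)|exact: (h i.+1)].
Qed.
Lemma firsts_nil (S : (U -> U) -> Prop) : firsts_in S ([::] : Tens U H).
Proof. by case. Qed.
Lemma firsts_cat (S : (U -> U) -> Prop) (t s : Tens U H) :
  firsts_in S t -> firsts_in S s -> firsts_in S (t ++ s).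
Proof.
move=> ht hs; elim: t ht => //= p t IH /firsts_cons[h1 h2].
by apply/firsts_cons; split=> //; apply: IH.
Qed.
Lemma firsts_map (S S' : (U -> U) -> Prop) (g : (U -> U) * H -> (U -> U) * H) t :
  (forall p, S p.1 -> S' (g p).1) -> firsts_in S t -> firsts_in S' (map g t).
Proof.
move=> h; elim: t => [|p t IH] /=; first by move=> _; apply: firsts_nil.
by move=> /firsts_cons[h1 h2]; apply/firsts_cons; split; [apply: h|apply: IH].
Qed.
Lemma firsts_sub (S S' : (U -> U) -> Prop) (t : Tens U H) :
  (forall f, S f -> S' f) -> firsts_in S t -> firsts_in S' t.
Proof. by move=> h ht i it; apply/h/ht. Qed.
Lemma firsts_tmul t s : firsts_in A t -> firsts_in A s -> firsts_in A (tmul mulH t s).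
Proof.
move=> ht hs; rewrite /tmul; elim: t ht => [|p t IH]; first by move=> _; apply:
  firsts_nil.
move=> /firsts_cons[h1 h2] /=; apply: firsts_cat; last exact: IH.
by apply: firsts_map hs => q; apply: A_comp.
Qed.
Lemma eq_firsts (S : (U -> U) -> Prop) (W : zmodType) (g g' : (U -> U) * H -> W) t :
  firsts_in S t -> (forall p, S p.1 -> g p = g' p) ->
  \sum_(p <- t) g p = \sum_(p <- t) g' p.
Proof.
move=> + h; elim: t => [|p t IH]; first by rewrite !big_nil.
by move=> /firsts_cons[h1 h2]; rewrite !big_cons h // IH.
Qed.

Definition mat (t : Tens U H) : U -> U -> H :=
  fun u v => \sum_(p <- t) B u (p.1 v) *: p.2.

Lemma mat_cat t s : mat (t ++ s) = mat t + mat s.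
Proof. by apply: funext => u; apply: funext => v; rewrite /mat big_cat. Qed.
Lemma mat_scale c t : mat (tscale c t) = c *: mat t.
Proof.
apply: funext => u; apply: funext => v; rewrite /mat big_map.
rewrite -[RHS]/(c *: (\sum_(p <- t) B u (p.1 v) *: p.2)) scaler_sumr.
by apply: eq_bigr => p _; rewrite /= /fscale (BZr BP) scalerA.
Qed.

Lemma mat_mulr t s u v :
  mat (tmul mulH t s) u v = \sum_(q <- s) mulH (mat t u (q.1 v)) q.2.
Proof.
rewrite /mat big_allpairs_dep exchange_big /=; apply: eq_bigr => q _.
by rewrite (alg_suml algH); apply: eq_bigr => p _; rewrite (algZl algH).
Qed.
(** The adjoint moves the left factor onto the row vector, so the right factor matters only through
    its matrix. Together with [mat_mulr] this makes products independent of representatives. *)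
Lemma mat_mull t s u v : firsts_in A t ->
  mat (tmul mulH t s) u v = \sum_(p <- t) mulH p.2 (mat s (phi p.1 u) v).
Proof.
move=> ht; rewrite /mat big_allpairs_dep; apply: (eq_firsts ht) => p Ap /=.
by rewrite (alg_sumr algH); apply: eq_bigr => q _; rewrite (algZr algH) -Badjr.
Qed.

Lemma teq_mat t s : teq t s <-> mat t = mat s.
Proof.
have sE (g : H -> F) r u v : lin_fun g -> g (mat r u v) = B u (\sum_(p <- r) g p.2
  *: p.1 v).
  move=> hg; have g0 : g 0 = 0.
    have := hg 1 0 0; rewrite scale1r addr0 mul1r => e.
    by apply: (addrI (g 0)); rewrite -e addr0.
  rewrite /mat (B_sumr BP); elim: r => [|p r IH]; first by rewrite !big_nil.
  by rewrite !big_cons hg IH (BZr BP) mulrC.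
split=> h.
  apply: funext => u; apply: funext => v; apply: contrapT => /eqP.
  rewrite -subr_eq0 => /separating_functional[g [hg]]; apply/negP/negPn.
  have -> : g (mat t u v - mat s u v) = g (mat t u v) - g (mat s u v).
    by have := hg (-1) (mat s u v) (mat t u v); rewrite scaleN1r mulN1r !(addrC (- _)).
  by rewrite !sE // h // subrr.
move=> g hg u; apply: (Binj BP) => z.
by rewrite -!sE // h.
Qed.

Lemma mat_subspace :
  is_subspace (fun m : U -> U -> H => exists t, firsts_in A t /\ mat t = m).
Proof.
split.
  exists [::]; split; first exact: firsts_nil.
  by apply: funext => u; apply: funext => v; rewrite /mat big_nil.
move=> c _ _ [t [ht <-]] [s [hs <-]]; exists (tscale c t ++ s); split.
  by apply: firsts_cat => //; apply: firsts_map ht => p; apply: A_scale.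
by rewrite mat_cat mat_scale.
Qed.

Definition QT : lmodType F := subspace_type mat_subspace.
Definition evT (q : QT) : U -> U -> H := subspace_val q.
Arguments evT : simpl never.
Definition mkQ t : QT := insubd (0 : subspace_type mat_subspace) (mat t).
Lemma mkQE t : firsts_in A t -> evT (mkQ t) = mat t.
Proof.
move=> ht; rewrite /evT /mkQ -[subspace_val _]/(val _) insubdK //.
by apply/asboolP; exists t.
Qed.
Lemma rep_ex (q : QT) : exists t, firsts_in A t /\ mat t = evT q.
Proof. by case: q => m /= /[dup] /asboolP. Qed.
Definition rep q := projT1 (cid (rep_ex q)).
Lemma repA q : firsts_in A (rep q). Proof. by rewrite /rep; case: cid => t []. Qed.
Arguments repA : clear implicits.
Lemma repE q : mat (rep q) = evT q. Proof. by rewrite /rep; case: cid => t []. Qed.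

Definition mulT q q' := mkQ (tmul mulH (rep q) (rep q')).
Definition starT q := mkQ [seq (phi p.1, p.2) | p <- rep q].
Definition elT a b h := mkQ [:: (fun x => B b x *: a, h)].

Lemma evT_inj q q' : evT q = evT q' -> q = q'. Proof. exact: val_inj. Qed.
Lemma evT_mkQ q t : firsts_in A t -> mat t = evT q -> q = mkQ t.
Proof. by move=> ht e; apply: evT_inj; rewrite mkQE. Qed.
Lemma evT_mul q q' : evT (mulT q q') = mat (tmul mulH (rep q) (rep q')).
Proof. by apply: mkQE; apply: firsts_tmul; apply: repA. Qed.
Lemma evT_mulr s q q' u v : firsts_in A s -> q' = mkQ s ->
  evT (mulT q q') u v = \sum_(p <- s) mulH (evT q u (p.1 v)) p.2.
Proof.
move=> hs ->; rewrite evT_mul (mat_mull _ _ _ (repA q)) repE (mkQE hs).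
by rewrite -(mat_mull _ _ _ (repA q)) mat_mulr repE.
Qed.
Lemma evT_mull t q q' u v : firsts_in A t -> q = mkQ t ->
  evT (mulT q q') u v = \sum_(p <- t) mulH p.2 (evT q' (phi p.1 u) v).
Proof.
move=> ht ->; rewrite evT_mul mat_mulr repE (mkQE ht) -mat_mulr.
by rewrite (mat_mull _ _ _ ht) repE.
Qed.
Lemma rep_mkQ q : q = mkQ (rep q).
Proof. by apply: evT_mkQ; [exact: repA|exact: repE]. Qed.
Lemma evT_mulrE q q' u v :
  evT (mulT q q') u v = \sum_(p <- rep q') mulH (evT q u (p.1 v)) p.2.
Proof. by apply: evT_mulr; [exact: repA|exact: rep_mkQ]. Qed.
Lemma evT_mullE q q' u v :
  evT (mulT q q') u v = \sum_(p <- rep q) mulH p.2 (evT q' (phi p.1 u) v).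
Proof. by apply: evT_mull; [exact: repA|exact: rep_mkQ]. Qed.
Lemma evT_star q u v : evT (starT q) u v = eps *: evT q v u.
Proof.
rewrite mkQE; last by apply: firsts_map (repA q) => p; apply: phi_A.
rewrite -(repE q) /mat big_map scaler_sumr.
apply: (eq_firsts (repA q)) => p Ap /=.
by rewrite -Badj // (BC BP v) scalerA.
Qed.
Lemma evT_lin c q q' : evT (c *: q + q') = c *: evT q + evT q'.
Proof. by []. Qed.
Lemma evT_linE c q q' u v : evT (c *: q + q') u v = c *: evT q u v + evT q' u v.
Proof. by []. Qed.
Lemma phi_el a b u : phi (fun x => B b x *: a) u = B u a *: b.
Proof.
apply: (Binj BP) => z; rewrite -(Badj (Bel a b)) (BZl BP) (BZr BP).
by rewrite (BC BP z b) (BC BP u a) mulrACA (epsK BP) mul1r mulrC.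
Qed.
Lemma elT_firsts a b (h : H) : firsts_in A ([:: (fun x => B b x *: a, h)] : Tens U H).
Proof. by apply/firsts_cons; split; [exact: Bel|exact: firsts_nil]. Qed.
Lemma evT_el a b h u v : evT (elT a b h) u v = (B u a * B b v) *: h.
Proof.
by rewrite mkQE; [rewrite /mat big_seq1 /= (BZr BP) mulrC|exact: elT_firsts].
Qed.

Lemma evT_linl q c u u' v : evT q (c *: u + u') v = c *: evT q u v + evT q u' v.
Proof.
rewrite -repE /mat scaler_sumr -big_split /=; apply: eq_bigr => p _.
by rewrite (BDZl BP) scalerDl scalerA.
Qed.
Lemma evT_linr q c u u' v : evT q v (c *: u + u') = c *: evT q v u + evT q v u'.
Proof.
rewrite -repE /mat scaler_sumr -big_split /=.
apply: (eq_firsts (repA q)) => p Ap.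
by rewrite (A_linD _ _ Ap) (A_linZ _ _ Ap) (BDr BP) (BZr BP) scalerDl scalerA.
Qed.
Lemma evT_0l q v : evT q 0 v = 0.
Proof.
by apply: (addrI (evT q 0 v)); have := evT_linl q 1 0 0 v; rewrite !scale1r !addr0.
Qed.
Lemma evT_0r q v : evT q v 0 = 0.
Proof.
by apply: (addrI (evT q v 0)); have := evT_linr q 1 0 0 v; rewrite !scale1r !addr0.
Qed.
Lemma evT_Zl q c u v : evT q (c *: u) v = c *: evT q u v.
Proof. by have := evT_linl q c u 0 v; rewrite evT_0l !addr0. Qed.
Lemma evT_Zr q c u v : evT q v (c *: u) = c *: evT q v u.
Proof. by have := evT_linr q c u 0 v; rewrite evT_0r !addr0. Qed.

Lemma model : tensor_model B eps mulH mulT starT evT elT.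
Proof.
split.
- split; [|split].
  + move=> x y z; apply: evT_inj; apply: funext => u; apply: funext => v.
    rewrite evT_mullE evT_mulrE.
    under eq_bigr do rewrite evT_mulrE (alg_sumr algH).
    under [RHS]eq_bigr do rewrite evT_mullE (alg_suml algH).
    rewrite exchange_big /=; apply: eq_bigr => p _; apply: eq_bigr => q _.
    exact: (algA algH).
  + move=> c x y z; apply: evT_inj; apply: funext => u; apply: funext => v.
    rewrite evT_linE !evT_mulrE scaler_sumr -big_split /=; apply: eq_bigr => p _.
    by rewrite evT_linE (algDl algH) (algZl algH).
  + move=> c x y z; apply: evT_inj; apply: funext => u; apply: funext => v.
    rewrite evT_linE !evT_mullE scaler_sumr -big_split /=; apply: eq_bigr => p _.
    by rewrite evT_linE (algDr algH) (algZr algH).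
- split; [|split].
  + move=> c x y; apply: evT_inj; apply: funext => u; apply: funext => v.
    by rewrite evT_linE !evT_star evT_linE scalerDr !scalerA mulrC.
  + move=> x y; apply: evT_inj; apply: funext => u; apply: funext => v.
    rewrite evT_star evT_mullE.
    rewrite (@evT_mulr [seq (phi p.1, p.2) | p <- rep x]) // ?big_map ?scaler_sumr.
      apply: eq_bigr => p _ /=.
      by rewrite evT_star (algZl algH) mHC.
    by apply: firsts_map (repA x) => p; apply: phi_A.
  + move=> x; apply: evT_inj; apply: funext => u; apply: funext => v.
    by rewrite !evT_star scalerA (epsK BP) scale1r.
- exact: evT_linE.
- move=> q q' h; apply: evT_inj; apply: funext => u; apply: funext => v; exact: h.
- exact: evT_linl.
- exact: evT_linr.
- exact: evT_el.
- move=> q a b h u v; rewrite (@evT_mulr ([:: (fun x => B b x *: a, h)] : Tens U H)) //.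
    by rewrite big_seq1 /= evT_Zr (algZl algH) mHC.
  exact: elT_firsts.
- move=> q a b h u v; rewrite (@evT_mull ([:: (fun x => B b x *: a, h)] : Tens U H)) //.
    by rewrite big_seq1 /= phi_el evT_Zl (algZr algH).
  exact: elT_firsts.
- exact: evT_star.
- move=> k q q' u v v' h; rewrite !evT_mullE.
  by apply: eq_bigr => p _; rewrite h.
- move=> k q q' u u' v h; rewrite !evT_mulrE.
  by apply: eq_bigr => p _; rewrite h.
move=> k S.
(* Multiplication by [k] moves supports by the finitely many operators of a representative of [k]
   and by their adjoints. *)
exists (S ++ flatten [seq [seq p.1 s | s <- S] ++ [seq phi p.1 s | s <- S] | p <- rep k]).
move=> q lq; have E (p : (U -> U) * H) v : A p.1 -> perp B ([seq p.1 s | s <- S] ++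
  [seq phi p.1 s | s <- S]) v ->
    perp B S (phi p.1 v) /\ perp B S (p.1 v).
  move=> Ap /perp_cat[h1 h2]; split=> s sS.
    by rewrite -Badj // h1 // map_f.
  by rewrite Badjr // h2 // map_f.
have E' (T : Tens U H) v : firsts_in A T ->
    perp B (flatten [seq [seq p.1 s | s <- S] ++ [seq phi p.1 s | s <- S] | p <- T]) v ->
    forall u, \sum_(p <- T) mulH p.2 (evT q (phi p.1 v) u) = 0 /\
              \sum_(p <- T) mulH (evT q u (p.1 v)) p.2 = 0.
  elim: T => [|p T IH] hT; first by move=> _ u; rewrite !big_nil.
  move=> /perp_cat[h1 h2] u; have [Ap hT'] := (firsts_cons _ _ _).1 hT.
  have [p1 p2] := E _ _ Ap h1; have [s1 s2] := IH hT' h2 u.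
  rewrite !big_cons s1 s2 (lq _ p1 u).2 (lq _ p2 u).1.
  by rewrite (alg0l algH) (alg0r algH) !addr0.
split=> v /perp_cat[pS p] u; have [e1 e2] := E' _ _ (repA k) p u.
  split; rewrite evT_mullE ?e1 // big1 // => t _.
  by rewrite (lq _ pS _).1 (alg0r algH).
split; rewrite evT_mulrE ?e2 // big1 // => t _.
by rewrite (lq _ pS _).2 (alg0l algH).
Qed.

(** * The homomorphism attached to [rho] *)

Section Main.
Variables (L : (U -> U) -> Prop) (V : lmodType F) (mulV : V -> V -> V).
Variables (star : V -> V) (M : V -> Prop) (rho : V -> Tens U H).
Hypothesis two : (2%:R : F) != 0.
Hypothesis idealL : end_lie_ideal_K A phi L.
Hypothesis noncL : noncentral A L.
Hypothesis algV : assoc_algebra mulV.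
Hypothesis invV : is_involution mulV star.
Hypothesis idealM : lie_ideal_K mulV star M.
Hypothesis rhoL : forall x, M x -> in_tensor L (rho x).
Hypothesis rhoP : forall (c : F) x y, M x -> M y ->
  teq (rho (c *: x + y)) (tadd (tscale c (rho x)) (rho y)).
Hypothesis rho_cm : forall x y, M x -> M y ->
  teq (rho (mulV x y - mulV y x)) (tbracket mulH (rho x) (rho y)).
Hypothesis rho_surj : forall t : Tens U H, firsts_in L t ->
  exists x, M x /\ teq (rho x) t.

Lemma L_A l : L l -> A l. Proof. by case: idealL => _ [_ [+ _]] => /[apply] -[]. Qed.
Lemma L_skew l : L l -> forall u v, B (l u) v = - B u (l v).
Proof.
move=> Ll u v; rewrite Badj; last exact: L_A.
have [_ ->] : Kend A phi l by case: idealL => _ [_ [+ _]]; apply.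
by rewrite /fopp (BNr BP).
Qed.

Local Notation XT := (X eps elT).

(** This realizes [X a b oneH] by an operator in the skew part of [A], under whose bracket [L] is
    stable. *)
Lemma XT_op a b : exists k, Kend A phi k /\
  forall w, k w = B b w *: a - (eps * B a w) *: b.
Proof.
exists (fadd (fscale (- eps) (fun x => B a x *: b)) (fun x => B b x *: a)).
have kE w : fadd (fscale (- eps) (fun x => B a x *: b)) (fun x => B b x *: a) w =
    B b w *: a - (eps * B a w) *: b.
  by rewrite /fadd /fscale scalerA mulNr scaleNr addrC.
split=> //; have Ak := A_fadd (- eps) (Bel b a) (Bel a b); split=> //.
apply: funext => w; apply: (Binj BP) => z; rewrite -Badj // /fopp !kE.
rewrite (BDl BP) (BNl BP) !(BZl BP) (BNr BP) (BDr BP) (BNr BP) !(BZr BP).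
rewrite (BC BP z b) (BC BP z a); have e := epsK BP; ring: e.
Qed.

Definition PL q := exists l, L l /\ q = mkQ [:: (l, oneH)].
Lemma ev_mk1 l h u v : A l -> evT (mkQ [:: (l, h)]) u v = B u (l v) *: h.
Proof.
move=> Al; rewrite mkQE; first by rewrite /mat big_seq1.
by apply/firsts_cons; split=> //; apply: firsts_nil.
Qed.

Lemma PL_lin c q q' : PL q -> PL q' -> PL (c *: q + q').
Proof.
move=> [l [Ll ->]] [l' [Ll' ->]].
have L'' : L (fadd (fscale c l) l') by case: idealL => _ [+ _]; apply.
exists (fadd (fscale c l) l'); split=> //.
apply: evT_inj; apply: funext => u; apply: funext => v.
rewrite evT_linE !ev_mk1; try exact: L_A.
by rewrite /fadd /fscale (BDr BP) (BZr BP) scalerDl scalerA.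
Qed.
Lemma PL_cm a b q : PL q -> PL (cm mulT (XT a b oneH) q).
Proof.
move=> [l [Ll ->]]; have [k [Kk kE]] := XT_op a b.
have Lk : L (fcomm k l) by case: idealL => _ [_ [_]]; apply.
exists (fcomm k l); split=> //.
apply: evT_inj; apply: funext => u; apply: funext => v.
have -> : cm mulT (XT a b oneH) (mkQ [:: (l, oneH)]) = - cm mulT (mkQ [:: (l,
  oneH)]) (XT a b oneH).
  by rewrite /cm opprB.
rewrite (evN model) (ev_cmX1 BP HP model) !ev_mk1; try exact: L_A.
rewrite !scalerA -!scalerBl -scalerDl -scaleNr; congr (_ *: _).
rewrite /fcomm !kE (A_linD _ _ (L_A Ll)) -!scaleNr !(A_linZ _ _ (L_A Ll)).
rewrite (BDr BP) (BNr BP) !(BDr BP) !(BZr BP).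
rewrite (BC BP u b) (BC BP u a); have e := epsK BP; ring: e.
Qed.

(** If every [l] in [L] preserved all relations [B a c = 0], applying this to [a + b] and
    [c - B a c *: v] would make [l] a scalar, hence commute with [A]. *)
Lemma noncentral_vectors : exists l a c, [/\ L l, B a c = 0 & B (l a) c != 0].
Proof.
have [l [a' [Ll [Aa nc]]]] := noncL; apply: contrapT => h; apply: nc.
have {}h a c : B a c = 0 -> B (l a) c = 0.
  move=> e; apply: contrapT => /eqP nz; apply: h; exists l, a, c; split=> //.
have Al := L_A Ll.
have main a c b v : B a v = 0 -> B b c = 0 -> B b v = 1 -> B (l a) c = B a c * B (l b) v.
  move=> av bc bv; have := h (a + b) (c - B a c *: v).
  rewrite !(A_linD _ _ Al) !(BDl BP) !(BDr BP) !(BNr BP) !(BZr BP) av bc bv.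
  rewrite (h _ _ av) (h _ _ bc) !mulr0 mulr1 !subr0 ?add0r ?addr0 ?sub0r ?subrr.
  by move/(_ erefl)/subr0_eq.
have [[b0 v0] /= [_ _ bv0]] := fresh_pair BP infU [::].
have lE a : l a = B (l b0) v0 *: a.
  apply: (Binj BP) => c; rewrite (BC BP (l a)) (BZr BP) (BC BP a c).
  have [[b v] /= [pb pv bv]] := fresh_pair BP infU [:: a; c; b0; v0].
  have [_ /perp_cons[cb /perp_cons[_ /perp_cons[v0b _]]]] := (perp_cons _ _ _ _).1 pb.
  have [av /perp_cons[_ /perp_cons[b0v _]]] := (perp_cons _ _ _ _).1 pv.
  rewrite (main a c b v av (BC0 BP cb) bv).
  by rewrite (main b0 v0 b v b0v (BC0 BP v0b) bv) bv0 mul1r; ring.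
by apply: funext => w; rewrite /= (lE (a' w)) (lE w) (A_linZ _ _ Aa).
Qed.

Lemma PL_X a b : PL (XT a b oneH).
Proof.
have [l [a0 [c0 [Ll e ne]]]] := noncentral_vectors.
apply: (@ideal_X F U H QT B eps mulH oneH mulT starT evT elT two BP infU HP model
          PL l (mkQ [:: (l, oneH)])).
- exact: PL_lin.
- exact: PL_cm.
- by exists l.
- by move=> u v; apply: ev_mk1; apply: L_A.
- exact: L_skew.
by exists a0, c0.
Qed.

Lemma Lrep_ex x : exists t, M x -> teq (rho x) t /\ firsts_in L t.
Proof.
have [Mx|nM] := pselect (M x); last by exists [::].
by have [t h] := rhoL Mx; exists t.
Qed.
(** A value of [rho] is only equal, as a tensor, to a sum over [L]; its own first components need
    not be linear, so a representative over [L] is fixed. *)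
Definition Lrep := projT1 (choice Lrep_ex).
Lemma LrepE x : M x -> mat (rho x) = mat (Lrep x).
Proof.
by move=> Mx; apply/teq_mat; rewrite /Lrep; case: choice => f h /=; case: (h x Mx).
Qed.
Lemma Lrep_L x : M x -> firsts_in L (Lrep x).
Proof. by move=> Mx; rewrite /Lrep; case: choice => f h /=; case: (h x Mx). Qed.
Definition rT x := mkQ (Lrep x).
Lemma rTE x : M x -> evT (rT x) = mat (rho x).
Proof.
move=> Mx; rewrite mkQE ?LrepE //.
by apply: (@firsts_sub L A); [exact: L_A|exact: Lrep_L].
Qed.

(** The factors are exchanged for representatives over [A] one at a time, the left one first:
    expansion along the left factor requires adjoints, expansion along the right one does not. *)
Lemma mat_tmul t s x y : firsts_in A x -> firsts_in A y -> mat t = mat x -> mat s =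
  mat y ->
  mat (tmul mulH t s) = evT (mulT (mkQ x) (mkQ y)).
Proof.
move=> hx hy et es; apply: funext => u; apply: funext => v.
rewrite mat_mulr et -mat_mulr (mat_mull _ _ _ hx) es -(mat_mull _ _ _ hx) mat_mulr.
rewrite (evT_mulr _ _ _ hy erefl).
by apply: eq_bigr => p _; rewrite (mkQE hx).
Qed.
Lemma mat_rho_mul x y : M x -> M y ->
  mat (tmul mulH (rho x) (rho y)) = evT (mulT (rT x) (rT y)).
Proof.
have LA z : M z -> firsts_in A (Lrep z).
  by move=> Mz; apply: (@firsts_sub L A); [exact: L_A|exact: Lrep_L].
by move=> Mx My; apply: mat_tmul; [exact: LA|exact: LA|exact: LrepE|exact: LrepE].
Qed.

Lemma rT_lin c x y : M x -> M y -> rT (c *: x + y) = c *: rT x + rT y.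
Proof.
move=> Mx My; have Mxy : M (c *: x + y) by case: idealM => -[_ +] _; apply.
apply: evT_inj; rewrite evT_lin !rTE //.
by rewrite (iffLR (teq_mat _ _) (rhoP c Mx My)) mat_cat mat_scale.
Qed.
Lemma rT_cm x y : M x -> M y -> rT (cm mulV x y) = cm mulT (rT x) (rT y).
Proof.
move=> Mx My; have Mxy : M (cm mulV x y).
  by case: idealM => _ [skM ML]; apply: ML => //; apply: skM.
have e : cm mulT (rT x) (rT y) = -1 *: mulT (rT y) (rT x) + mulT (rT x) (rT y).
  by rewrite scaleN1r addrC.
apply: evT_inj; rewrite e evT_lin rTE // (iffLR (teq_mat _ _) (rho_cm Mx My)).
by rewrite mat_cat mat_scale !mat_rho_mul // addrC.
Qed.
Lemma rT_skew x : M x -> starT (rT x) = - rT x.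
Proof.
move=> Mx; apply: evT_inj; apply: funext => u; apply: funext => v.
rewrite evT_star (evN model) rTE // LrepE // /mat scaler_sumr -sumrN.
apply: (eq_firsts (Lrep_L Mx)) => p Lp.
by rewrite scalerA -(BC BP) L_skew // scaleNr.
Qed.
Lemma rT_X a b h : exists x, M x /\ rT x = XT a b h.
Proof.
have [l [Ll e]] := PL_X a b.
have [|x [Mx ex]] := @rho_surj [:: (l, h)].
  by apply/firsts_cons; split=> //; apply: firsts_nil.
exists x; split=> //; apply: evT_inj; apply: funext => u; apply: funext => v.
rewrite rTE // (iffLR (teq_mat _ _) ex).
have := congr1 (fun q => mulH h (evT q u v)) e; rewrite ev_mk1; last exact: L_A.
rewrite (ev_X model) !(algZr algH) mHC m1H /mat big_seq1 /= => <-.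
by rewrite (ev_X model).
Qed.

Local Notation GT := (Gr mulT mulV M rT).

Lemma GT_fun x k l : GT x k -> GT x l -> k = l.
Proof.
exact: (Gr_fun two BP infU HP model algV invV idealM rT_lin rT_cm rT_skew rT_X).
Qed.
Lemma GT_ex x : exists k, gen_subalg mulV M x -> GT x k.
Proof.
have [gx|ng] := pselect (gen_subalg mulV M x); last by exists 0.
have [k Gk] : exists k, GT x k; last by exists k.
apply: (gx (fun x => exists k, GT x k)).
- split; first by exists (rT 0); apply: Gr_M; case: idealM => -[].
  by move=> c y z [k hk] [l hl]; exists (c *: k + l); apply: Gr_lin.
- by move=> y z [k hk] [l hl]; exists (mulT k l); apply: Gr_mul.
- by move=> y My; exists (rT y); apply: Gr_M.
Qed.

Lemma lift_rho : exists (sigma : V -> Tens U H) (tau : V -> H),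
  (forall x, gen_subalg mulV M x -> in_tensor (unitize A) (sigma x)) /\
  (forall (c : F) x y, gen_subalg mulV M x -> gen_subalg mulV M y ->
     teq (sigma (c *: x + y)) (tadd (tscale c (sigma x)) (sigma y))) /\
  (forall x y, gen_subalg mulV M x -> gen_subalg mulV M y ->
     teq (sigma (mulV x y)) (tmul mulH (sigma x) (sigma y))) /\
  (forall (c : F) x y, M x -> M y -> tau (c *: x + y) = c *: tau x + tau y) /\
  (forall x y, M x -> M y -> tau (mulV x y - mulV y x) = 0) /\
  (forall x, M x -> teq (rho x) (tadd (sigma x) (tone U (tau x)))).
Proof.
have [s sP] := choice GT_ex.
have sfun x k : gen_subalg mulV M x -> GT x k -> s x = k.
  by move=> gx; apply: GT_fun; apply: sP.
exists (fun x => rep (s x)), (fun=> 0); split=> [x gx|].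
  exists (rep (s x)); split=> //; apply: (@firsts_sub A) => [f Af|]; last exact: repA.
  by exists f, 0; split=> //; apply: funext => u; rewrite scale0r addr0.
split=> [c x y gx gy|].
  have g : gen_subalg mulV M (c *: x + y).
    by move=> S SS SM MS; case: (SS) => _; apply; [apply: gx|apply: gy].
  apply/teq_mat; rewrite mat_cat mat_scale !repE -evT_lin.
  by congr evT; apply: (sfun _ _ g); apply: Gr_lin; apply: sP.
split=> [x y gx gy|].
  have g : gen_subalg mulV M (mulV x y).
    by move=> S SS SM MS; apply: (SM); [apply: gx|apply: gy].
  apply/teq_mat; rewrite repE -evT_mul.
  by congr evT; apply: (sfun _ _ g); apply: Gr_mul; apply: sP.
split=> [c x y _ _|]; first by rewrite scaler0 addr0.
split=> // x Mx; apply/teq_mat; rewrite mat_cat repE.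
have gx : gen_subalg mulV M x by move=> S _ _; apply.
rewrite (sfun x (rT x) gx (Gr_M _ _ _ Mx)) rTE //.
apply: funext => u; apply: funext => v.
by rewrite /mat -[RHS]/(_ + _) big_seq1 scaler0 addr0.
Qed.

End Main.
End Model.
End EndForm.

Theorem theorem4p9
  (F : fieldType) (U : lmodType F)
  (Pi : (U -> F) -> Prop) (A : (U -> U) -> Prop)
  (phi : (U -> U) -> (U -> U)) (L : (U -> U) -> Prop)
  (H : lmodType F) (mulH : H -> H -> H) (oneH : H)
  (V : lmodType F) (mulV : V -> V -> V) (star : V -> V) (M : V -> Prop)
  (rho : V -> Tens U H) :
  (2%:R : F) != 0 ->
  infinite_dim U ->
  dual_subspace Pi -> is_total Pi ->
  end_algebra A ->
  (forall a, FPi Pi a -> A a) ->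
  end_involution A phi ->
  end_lie_ideal_K A phi L -> noncentral A L ->
  unital_comm_algebra mulH oneH ->
  assoc_algebra mulV -> is_involution mulV star -> lie_ideal_K mulV star M ->
  (* rho : M -> L (x) H is a surjective Lie homomorphism *)
  (forall x, M x -> in_tensor L (rho x)) ->
  (forall (c : F) x y, M x -> M y ->
     teq (rho (c *: x + y)) (tadd (tscale c (rho x)) (rho y))) ->
  (forall x y, M x -> M y ->
     teq (rho (mulV x y - mulV y x)) (tbracket mulH (rho x) (rho y))) ->
  (forall t : Tens U H, firsts_in L t -> exists x, M x /\ teq (rho x) t) ->
  exists (sigma : V -> Tens U H) (tau : V -> H),
    (* sigma : <M> -> A^# (x) H is an algebra homomorphism *)
    (forall x, gen_subalg mulV M x -> in_tensor (unitize A) (sigma x)) /\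
    (forall (c : F) x y, gen_subalg mulV M x -> gen_subalg mulV M y ->
       teq (sigma (c *: x + y)) (tadd (tscale c (sigma x)) (sigma y))) /\
    (forall x y, gen_subalg mulV M x -> gen_subalg mulV M y ->
       teq (sigma (mulV x y)) (tmul mulH (sigma x) (sigma y))) /\
    (* tau : M -> 1 (x) H, x |-> 1 (x) tau x, is linear *)
    (forall (c : F) x y, M x -> M y -> tau (c *: x + y) = c *: tau x + tau y) /\
    (* tau([M, M]) = 0 *)
    (forall x y, M x -> M y -> tau (mulV x y - mulV y x) = 0) /\
    (* rho = sigma + tau on M *)
    (forall x, M x -> teq (rho x) (tadd (sigma x) (tone U (tau x)))).
Proof.
move=> two infU dualPi totalPi algA FPiA invA idealL noncL HP algV invV idealM.
move=> rhoL rhoP rho_cm rho_surj.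
have [B [eps [BP Badj Bel]]] := end_form infU dualPi totalPi algA FPiA invA.
exact: (lift_rho infU algA invA BP Badj Bel HP two idealL noncL algV invV idealM
          rhoL rhoP rho_cm rho_surj).
Qed.
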